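(* Let $p$ be a prime. The operations \[ K \rightsquigarrow \bigl(K', \ker(\Theta: W(\mathfrak{o}_{K'}) \to \mathfrak{o}_K)\bigr),\qquad (F,I)\rightsquigarrow W(\mathfrak{o}_F)[p^{-1}]/I\,W(\mathfrak{o}_F)[p^{-1}] \] define an equivalence of categories between perfectoid analytic fields $K$ and pairs $(F,I)$ in which $F$ is a perfect analytic field of characteristic $p$ and $I$ is an ideal of $W(\mathfrak{o}_F)$ generated by a primitive element.
   Context: An analytic field is a field $K$ complete with respect to a multiplicative nonarchimedean norm $|\cdot|$; put $\mathfrak{o}_K=\{x\in K:|x|\le 1\}$, $\mathfrak{m}_K=\{x \in K:|x|<1\}$. $K$ has mixed characteristics if $|p|=p^{-1}$ and $\mathfrak{o}_K/\mathfrak{m}_K$ has characteristic $p$. $K$ is perfectoid if it is of mixed characteristics, is not discretely valued, and the $p$-th power Frobenius map on $\mathfrak{o}_K/(p)$ is surjective. Morphisms of analytic fields are isometric field homomorphisms; a morphism of pairs $(F_1,I_1)\to(F_2,I_2)$ is an isometric field homomorphism $F_1\to F_2$ for which the induced map $W(\mathfrak{o}_{F_1})\to W(\mathfrak{o}_{F_2})$ carries $I_1$ into $I_2$. For a perfect ring $\overline{R}$ of characteristic $p$, $W(\overline{R})$ is the ring of $p$-typical Witt vectors: the unique $p$-torsion-free, $p$-adically complete ring with $W(\overline{R})/(p)\cong\overline{R}$. $[\cdot]:\overline{R}\to W(\overline{R})$ is the Teichmüller map, and every element of $W(\overline{R})$ is uniquely $\sum_{n\ge0}p^n[\overline{x}_n]$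 with $\overline{x}_n\in\overline{R}$. Perfect norm field: for $K$ an analytic field of mixed characteristics, $\mathfrak{o}_{K'}=\{(\overline{x}_n)_{n\ge 0}\in\prod_{n\ge0}\mathfrak{o}_K/(p): \overline{x}_{n+1}^p=\overline{x}_n\}$, a perfect ring of characteristic $p$. For $\overline{x}=(\overline{x}_n)\in\mathfrak{o}_{K'}$ put $\theta(\overline{x})=\lim_{n}x_n^{p^n}\in\mathfrak{o}_K$ with $x_n\in\mathfrak{o}_K$ any lift of $\overline{x}_n$, and $|\overline{x}|'=|\theta(\overline{x})|$. Then $\mathfrak{o}_{K'}$ is the valuation ring of an analytic field $K'$ (with norm extending $|\cdot|'$), perfect of characteristic $p$. $\Theta:W(\mathfrak{o}_{K'})\to\mathfrak{o}_K$ is the ring homomorphism $\sum p^n[\overline{x}_n]\mapsto\sum p^n\theta(\overline{x}_n)$. For $F$ a perfect analytic field of characteristic $p$ with norm $|\cdot|'$, an element $z=\sum_{n\ge0} p^n[\overline{z}_n]\in W(\mathfrak{o}_F)$ is primitive if $|\overline{z}_0|'=p^{-1}$ and $p^{-1}(z-[\overline{z}_0])\in W(\mathfrak{o}_F)^\times$ (equivalently $|\overline{z}_0|'=p^{-1}$ and $|\overline{z}_1|'=1$). For $z$ a primitive generator of $I$, the norm on $W(\mathfrak{o}_F)[p^{-1}]/I\,W(\mathfrak{o}_F)[p^{-1}]$ is the unique multiplicative norm extending the following one on $W(\mathfrak{o}_F)/(z)$: every class has a representative $y=\sum p^n[\overline{y}_n]$ with $|\overline{y}_n|'\le|\overline{y}_0|'$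 for all $n$, and its norm is $|\overline{y}_0|'$. *)

(* Defs.v *)
From HB Require Import structures.
From mathcomp Require Import all_boot all_order all_algebra generic_quotient ring_quotient.
From mathcomp.multinomials Require monalg.
Set Implicit Arguments.
Unset Strict Implicit.
Unset Printing Implicit Defensive.
Import Order.TTheory GRing.Theory Num.Theory.
Local Open Scope ring_scope.

(* The polynomial ring over the integers in an arbitrary set of variables,
   sealed behind its universal property. *)
Module FreeComRing.
Record type (I : Type) := Pack {
  ring : comNzRingType;
  gen : I -> ring;
  eval : forall S : comNzRingType, (I -> S) -> {rmorphism ring -> S};
  eval_gen : forall (S : comNzRingType) (e : I -> S) i, eval e (gen i) = e i;
  ring_ind : forall P : ring -> Prop, P 1 ->
    (forall x y, P x -> P y -> P (x - y)) ->
    (forall x y, P x -> P y -> P (x * y)) -> (forall i, P (gen i)) -> forall x, P x;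
  torsion_free : forall (n : nat) (x : ring), (0 < n)%N -> n%:R * x = 0 -> x = 0 }.

Lemma hom_ext (I : Type) (F : type I) (S : comNzRingType) (f g : {rmorphism ring F -> S}) :
  (forall i, f (gen F i) = g (gen F i)) -> f =1 g.
Proof.
move=> fg; elim/(@ring_ind _ F) => [|x y fx fy|x y fx fy|i]; last exact: fg.
- by rewrite !rmorph1.
- by rewrite !rmorphB fx fy.
- by rewrite !rmorphM fx fy.
Qed.
End FreeComRing.

Module FreeComRingConstruction.
Import xfinmap monalg.
Local Open Scope fset_scope.
Local Open Scope ring_scope.
Section Def.
Variable I : choiceType.

Local Notation ring := {malg int[cmonom I]}.
Definition gen (i : I) : ring := << ucm i >>.

Section Eval.
Variables (S : comNzRingType) (e : I -> S).

Definition evmon (m : cmonom I) : S := \prod_(i <- finsupp m) e i ^+ m i.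

Lemma evmonEw (d : {fset I}) (m : cmonom I) : (finsupp m `<=` d)%fset ->
  evmon m = \prod_(i <- d) e i ^+ m i.
Proof.
move=> le; rewrite /evmon (big_fset_incl _ le) // => x xd.
by rewrite -cmE_eq0 => /eqP ->; rewrite expr0.
Qed.

Lemma evmon_mmorphism : mmorphism evmon.
Proof.
split=> [m1 m2|]; last by rewrite /evmon mdom1 big_seq_fset0.
rewrite {1}/evmon mdomD.
rewrite (@evmonEw (finsupp m1 `|` finsupp m2) m1) ?fsubsetUl //.
rewrite (@evmonEw (finsupp m1 `|` finsupp m2) m2) ?fsubsetUr //.
by rewrite -big_split /=; apply: eq_bigr => i _; rewrite cmM exprD.
Qed.

HB.instance Definition _ := isMultiplicative.Build (cmonom I) S evmon evmon_mmorphism.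

Definition eval : ring -> S := mmap (intr : int -> S) evmon.

HB.instance Definition _ := GRing.RMorphism.on eval.

Lemma eval_gen i : eval (gen i) = e i.
Proof.
rewrite /eval /gen mmapU /= mul1r /evmon mdomU big_seq_fset1 cmUU.
by rewrite expr1.
Qed.
End Eval.

Lemma cmon_ind (P : cmonom I -> Prop) : P mone ->
  (forall i m, P m -> P (mmul (ucm i) m)) -> forall m, P m.
Proof.
move=> P1 PM m; have [n] := ubnP (mdeg m); elim: n m => // n IH m ltn.
have [/eqP m0|] := boolP (finsupp m == fset0).
  suff -> : m = mone by [].
  by apply/eqP/cmP => i; rewrite cm1; apply/eqP; rewrite cmE_eq0 m0 in_fset0.
case/fset0Pn => i im; have mi : (0 < m i)%N by rewrite lt0n cmE_neq0.
have E : m = mmul (ucm i) (divcm m (ucm i)).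
  apply/eqP/cmP => j; rewrite cmM divcmE cmU.
  by case: eqP => [<-|_]; rewrite ?subn0 // subnKC.
rewrite E; apply/PM/IH; move: ltn; rewrite {1}E mdegM mdegU.
by rewrite add1n ltnS.
Qed.

Lemma ring_ind (P : ring -> Prop) : P 1 -> (forall x y, P x -> P y -> P (x - y)) ->
  (forall x y, P x -> P y -> P (x * y)) -> (forall i, P (gen i)) -> forall x, P x.
Proof.
move=> P1 PB PM Pg x.
have P0 : P 0 by rewrite -(subrr 1); apply: PB.
have PN y : P y -> P (- y) by move=> ?; rewrite -sub0r; apply: PB.
have PD y z : P y -> P z -> P (y + z).
  by move=> ? ?; rewrite -[z]opprK; apply: PB => //; apply: PN.
have Pn y n : P y -> P (y *+ n).
  by move=> Py; elim: n => [|n IH]; rewrite ?mulr0n // mulrS; apply: PD.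
have Pm (m : cmonom I) : P << m >>.
  elim/cmon_ind: m => [//|i m Pm].
  have -> : << mmul (ucm i) m >> = gen i * << m >> :> ring.
    by rewrite /gen malgM_def fgmulUU mulr1.
  by apply: (PM _ _ (Pg i) Pm).
have Ps (r : seq (cmonom I)) (F : cmonom I -> int) :
    P (\sum_(k <- r) << F k *g k >> : ring).
  elim: r => [|k r IH]; first by rewrite big_nil.
  rewrite big_cons.
  refine (PD _ _ _ IH).
  have -> : << F k *g k >> = (<< k >> : ring) *~ F k.
    by rewrite -[in LHS](intz (F k)) raddfMz.
  case: (F k) => n; rewrite ?NegzE ?mulrNz -pmulrn.
    refine (Pn _ _ (Pm k)).
  refine (PN _ (Pn _ _ (Pm k))).
have := Ps (msupp x) (fun k => mcoeff k x).
by rewrite -monalgE.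
Qed.

Lemma torsion_free (n : nat) (x : ring) : (0 < n)%N -> n%:R * x = 0 -> x = 0.
Proof.
move=> n0; rewrite mulr_natl => /malgP xn; apply/malgP => k.
move: (xn k); rewrite mcoeffMn mcoeff0 => /eqP.
by rewrite -mulr_natr mulf_eq0 => /orP[/eqP//|]; rewrite Num.Theory.pnatr_eq0 -leqn0 leqNgt n0.
Qed.
End Def.
Definition poly (I : choiceType) : FreeComRing.type I.
Proof.
pose A : comNzRingType := {malg int[cmonom I]}.
pose ev (S : comNzRingType) (e : I -> S) : {rmorphism A -> S} :=
  eval e.
refine (@FreeComRing.Pack I A (@gen I) ev _ _ _).
- by move=> S e i; apply: eval_gen.
- exact: ring_ind.
- exact: torsion_free.
Qed.

End FreeComRingConstruction.

From mathcomp Require Import all_classical all_reals topology normedtype.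
Import numFieldNormedType.Exports.
Local Open Scope classical_set_scope.
Local Open Scope quotient_scope.
Local Open Scope ring_scope.

(* The n-th ghost component \sum_(i <= n) p^i a_i^(p^(n-i)). *)
Definition ghost (p : nat) (A : comNzRingType) (n : nat) (a : nat -> A) : A :=
  \sum_(i < n.+1) p%:R ^+ i * a i ^+ (p ^ (n - i)).

Module WittPolynomials.
Definition vars := FreeComRingConstruction.poly (bool * nat)%type.
Section Cong.
Variables (p : nat) (A : comNzRingType).
Implicit Types x y z : A.

Definition cong k x y := exists z, x = y + p%:R ^+ k * z.

Lemma cong_refl k x : cong k x x.
Proof. by exists 0; rewrite mulr0 addr0. Qed.
Lemma congD k x y x' y' : cong k x y -> cong k x' y' -> cong k (x + x') (y + y').
Proof. by move=> [z ->] [t ->]; exists (z + t); rewrite mulrDr addrACA. Qed.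
Lemma congN k x y : cong k x y -> cong k (- x) (- y).
Proof. by move=> [z ->]; exists (- z); rewrite mulrN opprD. Qed.
Lemma congM k x y x' y' : cong k x y -> cong k x' y' -> cong k (x * x') (y * y').
Proof.
move=> [z ->] [t ->]; exists (y * t + z * y' + z * p%:R ^+ k * t).
by rewrite mulrDl !mulrDr !addrA; congr (_ + _ + _ + _);
   rewrite ?mulrA //; rewrite [y * _]mulrC.
Qed.
Lemma cong_sym k x y : cong k x y -> cong k y x.
Proof. by move=> [z ->]; exists (- z); rewrite mulrN addrK. Qed.
Lemma cong_trans k x y z : cong k x y -> cong k y z -> cong k x z.
Proof. by move=> [t ->] [u ->]; exists (u + t); rewrite mulrDr addrA. Qed.
Lemma cong_sum k n (F G : 'I_n -> A) : (forall i, cong k (F i) (G i)) ->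
  cong k (\sum_i F i) (\sum_i G i).
Proof. by move=> FG; apply: big_ind2 => //; [apply: cong_refl | exact: congD]. Qed.
Lemma cong_sum0 k n (F : 'I_n -> A) : (forall i, cong k (F i) 0) ->
  cong k (\sum_i F i) 0.
Proof.
move=> F0; apply: (big_ind (fun x => cong k x 0)) => //; first exact: cong_refl.
by move=> x y x0 y0; have := congD x0 y0; rewrite addr0.
Qed.
Lemma congMp j k x y : cong k x y -> cong (j + k) (p%:R ^+ j * x) (p%:R ^+ j * y).
Proof. by move=> [z ->]; exists z; rewrite mulrDr exprD mulrA. Qed.
Lemma congX k n x y : cong k x y -> cong k (x ^+ n) (y ^+ n).
Proof.
by move=> xy; elim: n => [|n IH]; rewrite ?expr0 ?exprS; [exact: cong_refl|exact: congM].
Qed.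

Lemma cong_expp k x y : cong k.+1 x y -> cong k.+2 (x ^+ p) (y ^+ p).
Proof.
move=> [z xE]; have : cong 1 (\sum_(i < p) x ^+ (p.-1 - i) * y ^+ i) 0.
  apply: (@cong_trans _ _ (\sum_(i < p) y ^+ p.-1)).
    apply: cong_sum => i; rewrite -[in X in cong _ _ X](@subnK i p.-1); last first.
      by rewrite -ltnS (ltn_predK (ltn_ord i)).
    rewrite exprD; apply: congM; last exact: cong_refl.
    by apply: congX; exists (p%:R ^+ k * z); rewrite mulrA -exprD add1n.
  exists (y ^+ p.-1).
  by rewrite sumr_const card_ord add0r expr1 mulr_natl.
move=> [t]; rewrite add0r => tE; exists (z * t).
apply/eqP; rewrite addrC -subr_eq; apply/eqP.
rewrite subrXX.
rewrite [X in x - X]/= {1}xE addrAC subrr add0r.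
have -> : \sum_(i < p) x ^+ (p.-1 - i) * y ^+ i = p%:R ^+ 1 * t by [].
by rewrite mulrACA -exprSr.
Qed.

Lemma cong_exppX k x y : cong 1 x y -> cong k.+1 (x ^+ (p ^ k)) (y ^+ (p ^ k)).
Proof.
move=> xy; elim: k => [|k IH]; first by rewrite expn0 !expr1.
by rewrite expnSr !exprM; apply: cong_expp.
Qed.
End Cong.

Section Lift.
Variables (p : nat) (p_pr : prime p) (I : choiceType).
Let F := FreeComRingConstruction.poly I.
Let A := FreeComRing.ring F.

Lemma frobD (x y : A) : cong p 1 ((x + y) ^+ p) (x ^+ p + y ^+ p).
Proof.
have [q pE] : exists q, p = q.+2.
  by move: (prime_gt1 p_pr); case: (p) => [|[|q]] //; exists q.
rewrite exprDn pE big_ord_recr big_ord_recl /= -pE !subn0 subnn !expr0 !bin0 binn.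
rewrite !mulr1n mulr1 mul1r.
suff [z ->] : cong p 1 (\sum_(i < q.+1) x ^+ (p - lift ord0 i) * y ^+ (lift ord0 i)
    *+ 'C(p, lift ord0 i)) 0.
  by exists z; rewrite add0r addrAC.
apply: cong_sum0 => i.
have /dvdnP[c ->] : (p %| 'C(p, lift ord0 i))%N.
  by apply: prime_dvd_bin => //; rewrite lift0 pE /= !ltnS; case: (i).
exists (x ^+ (p - lift ord0 i) * y ^+ lift ord0 i *+ c).
by rewrite add0r expr1 mulrnA mulr_natl.
Qed.

Definition frob : {rmorphism A -> A} :=
  FreeComRing.eval F (fun i : I => FreeComRing.gen F i ^+ p).

Lemma frob_lift (x : A) : cong p 1 (frob x) (x ^+ p).
Proof.
have p0 := prime_gt0 p_pr.
elim/FreeComRing.ring_ind: x => [|x y fx fy|x y fx fy|i].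
- by rewrite rmorph1 expr1n; apply: cong_refl.
- rewrite rmorphB; apply: (@cong_trans _ _ _ _ (x ^+ p - y ^+ p)).
    by apply: congD => //; apply: congN.
  have h := frobD (x - y) y; rewrite subrK in h.
  have := congD h (cong_refl p 1 (- y ^+ p)).
  by rewrite addrK.
- by rewrite rmorphM exprMn; apply: congM.
- by rewrite /frob /= FreeComRing.eval_gen; apply: cong_refl.
Qed.

Lemma ghostS n (a : nat -> A) :
  cong p n.+1 (ghost p n.+1 a) (frob (ghost p n a)).
Proof.
rewrite /ghost big_ord_recr /= rmorph_sum /=.
apply: (@cong_trans _ _ _ _
  (\sum_(i < n.+1) p%:R ^+ i * a i ^+ (p ^ (n.+1 - i)))).
  by exists (a n.+1); rewrite subnn expn0 expr1.
apply: cong_sum => i; have lein : (i <= n)%N by rewrite -ltnS.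
rewrite rmorphM rmorphXn rmorph_nat rmorphXn.
rewrite -[in X in cong _ X](subnKC (leqW lein)); apply: congMp.
rewrite subSn // expnS exprM.
by apply/cong_sym/cong_exppX/frob_lift.
Qed.

Lemma ghost_inj n (a b : nat -> A) : (forall m, (m <= n)%N -> ghost p m a = ghost p m b) ->
  forall m, (m <= n)%N -> a m = b m.
Proof.
move=> ab; elim/ltn_ind => m IH lemn.
have := ab m lemn; rewrite /ghost !big_ord_recr /=.
have -> : \sum_(i < m) p%:R ^+ i * a i ^+ (p ^ (m - i)) =
          \sum_(i < m) p%:R ^+ i * b i ^+ (p ^ (m - i)).
  by apply: eq_bigr => i _; rewrite IH // (leq_trans (ltnW (ltn_ord i))).
move=> /addrI; rewrite subnn expn0 !expr1 => /eqP.
rewrite -subr_eq0 -mulrBr -natrX => /eqP /FreeComRing.torsion_free E.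
by apply/eqP; rewrite -subr_eq0; apply/eqP/E; rewrite expn_gt0 prime_gt0.
Qed.

(* Dwork's criterion: w is the ghost vector of some a as soon as
   w_(n+1) = frob(w_n) modulo p^(n+1) for all n. *)
Lemma dwork (w : nat -> A) : (forall n, cong p n.+1 (w n.+1) (frob (w n))) ->
  exists a, forall n, ghost p n a = w n.
Proof.
move=> wP.
have step n : exists a : nat -> A, forall m, (m <= n)%N -> ghost p m a = w m.
  elim: n => [|n [a aP]].
    exists (fun=> w 0%N) => m; rewrite leqn0 => /eqP ->.
    by rewrite /ghost big_ord1 expr0 mul1r subnn expn0 expr1.
  have [z zE] : cong p n.+1 (w n.+1) (ghost p n.+1 a).
    apply: (cong_trans (wP n)); apply: cong_sym.
    by have := ghostS n a; rewrite (aP n).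
  pose b i := if i == n.+1 then a i + z else a i.
  have ba m : (m <= n)%N -> b m = a m.
    by move=> lemn; rewrite /b ltn_eqF // ltnS.
  exists b => m; rewrite leq_eqVlt => /orP[/eqP ->|].
    rewrite zE /ghost !(@big_ord_recr _ _ _ n.+1) /= -addrA; congr (_ + _).
      by apply: eq_bigr => i _; rewrite ba // -ltnS.
    by rewrite subnn expn0 !expr1 /b eqxx mulrDr.
  rewrite ltnS => lemn; rewrite -aP //; apply: eq_bigr => i _.
  by rewrite ba // (leq_trans _ lemn) // -ltnS.
have [s sP] := choice step.
exists (fun n => s n n) => n; rewrite -(sP n n (leqnn n)).
apply: eq_bigr => i _; congr (_ * _ ^+ _).
have lein : (i <= n)%N by rewrite -ltnS.
apply: (@ghost_inj i) => // m lemi.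
by rewrite !sP // (leq_trans lemi).
Qed.
End Lift.

Section Universal.
Variables (p : nat) (p_pr : prime p).
Let A := FreeComRing.ring vars.

Definition X (i : nat) : A := FreeComRing.gen vars (false, i).
Definition Y (i : nat) : A := FreeComRing.gen vars (true, i).


Lemma sum_ex : exists s, forall n, ghost p n s = ghost p n X + ghost p n Y.
Proof. by apply: (dwork p_pr) => n; rewrite rmorphD; apply: congD; apply: ghostS. Qed.
Lemma prod_ex : exists s, forall n, ghost p n s = ghost p n X * ghost p n Y.
Proof. by apply: (dwork p_pr) => n; rewrite rmorphM; apply: congM; apply: ghostS. Qed.
Lemma opp_ex : exists s, forall n, ghost p n s = - ghost p n X.
Proof. by apply: (dwork p_pr) => n; rewrite rmorphN; apply: congN; apply: ghostS. Qed.

(* The universal Witt polynomials, uniquely determined by the ghost identities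
   sumP, prodP and oppP (ghost_inj). *)
Definition sum := sval (cid sum_ex).
Definition prod := sval (cid prod_ex).
Definition opp := sval (cid opp_ex).

Lemma sumP n : ghost p n sum = ghost p n X + ghost p n Y.
Proof. exact: (svalP (cid sum_ex)). Qed.
Lemma prodP n : ghost p n prod = ghost p n X * ghost p n Y.
Proof. exact: (svalP (cid prod_ex)). Qed.
Lemma oppP n : ghost p n opp = - ghost p n X.
Proof. exact: (svalP (cid opp_ex)). Qed.
End Universal.
End WittPolynomials.

(* p-typical Witt vectors, in Witt coordinates.  When R is perfect of
   characteristic p, witt p_pr R is p-torsion free and p-adically complete with
   residue ring R, and (a_0, a_1, ...) = \sum_n p^n [a_n^(1/p^n)]. *)
Record witt (p : nat) (p_pr : prime p) (R : Type) := Witt { wcoord : nat -> R }.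

Lemma wittP p (p_pr : prime p) R (a b : witt p_pr R) :
  wcoord a =1 wcoord b -> a = b.
Proof. by case: a b => [a] [b] /= /funext ->. Qed.

HB.instance Definition _ p (p_pr : prime p) R := gen_eqMixin (witt p_pr R).
HB.instance Definition _ p (p_pr : prime p) R := gen_choiceMixin (witt p_pr R).

Definition witt_map p (p_pr : prime p) R S (f : R -> S) (a : witt p_pr R) :
  witt p_pr S := Witt p_pr (f \o wcoord a).

Section WittRing.
Variables (p : nat) (p_pr : prime p).

Section Ops.
Variable R : comNzRingType.
Implicit Types a b : witt p_pr R.

Definition witt_subst a b (P : nat -> FreeComRing.ring WittPolynomials.vars) :=
  Witt p_pr (fun n => FreeComRing.eval WittPolynomials.vars
    (fun v : bool * nat => wcoord (if v.1 then b else a) v.2) (P n)).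

Definition witt_add a b := witt_subst a b (WittPolynomials.sum p_pr).
Definition witt_mul a b := witt_subst a b (WittPolynomials.prod p_pr).
Definition witt_opp a := witt_subst a a (WittPolynomials.opp p_pr).
Definition teich (x : R) : witt p_pr R := Witt p_pr (fun n => if n == 0%N then x else 0).

Definition wghost n a := ghost p n (wcoord a).

Lemma wghost_subst a b P n : wghost n (witt_subst a b P) =
  FreeComRing.eval WittPolynomials.vars (fun v : bool * nat => wcoord (if v.1 then b else a) v.2)
    (ghost p n P).
Proof.
rewrite /wghost /ghost rmorph_sum; apply: eq_bigr => i _ /=.
by rewrite rmorphM !rmorphXn rmorph_nat.
Qed.

Lemma eval_ghost a b c n :
  FreeComRing.eval WittPolynomials.vars (fun v : bool * nat => wcoord (if v.1 then b else a) v.2)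
    (ghost p n (fun i => FreeComRing.gen WittPolynomials.vars (c, i))) = wghost n (if c then b else a).
Proof.
rewrite /wghost /ghost rmorph_sum; apply: eq_bigr => i _ /=.
by rewrite rmorphM !rmorphXn rmorph_nat FreeComRing.eval_gen.
Qed.

Lemma wghost_add a b n : wghost n (witt_add a b) = wghost n a + wghost n b.
Proof. by rewrite wghost_subst WittPolynomials.sumP rmorphD !eval_ghost. Qed.
Lemma wghost_mul a b n : wghost n (witt_mul a b) = wghost n a * wghost n b.
Proof. by rewrite wghost_subst WittPolynomials.prodP rmorphM !eval_ghost. Qed.
Lemma wghost_opp a n : wghost n (witt_opp a) = - wghost n a.
Proof. by rewrite wghost_subst WittPolynomials.oppP rmorphN !eval_ghost. Qed.
Lemma wghost_teich x n : wghost n (teich x) = x ^+ (p ^ n).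
Proof.
rewrite /wghost /ghost big_ord_recl /= expr0 mul1r subn0 big1 ?addr0 // => i _.
by rewrite expr0n expn_eq0 -leqn0 leqNgt prime_gt0 //= mulr0.
Qed.
End Ops.

Section Functorial.
Variables (R S : comNzRingType) (f : {rmorphism R -> S}).

Lemma witt_map_subst (a b : witt p_pr R) P :
  witt_map f (witt_subst a b P) = witt_subst (witt_map f a) (witt_map f b) P.
Proof.
apply: wittP => n /=.
set e1 := FreeComRing.eval _ _; set e2 := FreeComRing.eval _ _.
apply: (FreeComRing.hom_ext (f := f \o e1) (g := e2)) => i /=.
by rewrite !FreeComRing.eval_gen; case: i.1.
Qed.

Lemma witt_map_add a b :
  witt_map f (witt_add a b) = witt_add (witt_map f a) (witt_map f b).
Proof. exact: witt_map_subst. Qed.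
Lemma witt_map_mul a b :
  witt_map f (witt_mul a b) = witt_mul (witt_map f a) (witt_map f b).
Proof. exact: witt_map_subst. Qed.
Lemma witt_map_opp a : witt_map f (witt_opp a) = witt_opp (witt_map f a).
Proof. exact: witt_map_subst. Qed.

Lemma witt_map_teich (x : R) : witt_map f (teich x) = teich (f x).
Proof. by apply: wittP => n /=; case: eqP; rewrite ?rmorph0. Qed.
End Functorial.

(* The ring axioms are checked on ghost components over a torsion-free cover
   of R. *)
Section RingLaws.
Variable R : comNzRingType.
Let F := FreeComRingConstruction.poly R.
Let A := FreeComRing.ring F.
Let pi : {rmorphism A -> R} := FreeComRing.eval F (fun x : R => x).
Let lift (a : witt p_pr R) : witt p_pr A :=
  witt_map (fun x => FreeComRing.gen F x) a.

Let liftK a : witt_map pi (lift a) = a.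
Proof. by apply: wittP => n /=; rewrite FreeComRing.eval_gen. Qed.

Let ghostP (a b : witt p_pr A) : (forall n, wghost n a = wghost n b) -> a = b.
Proof.
by move=> ab; apply: wittP => n; apply: (WittPolynomials.ghost_inj p_pr (n := n)) => // m _; apply: ab.
Qed.

Let gE := (wghost_add, wghost_mul, wghost_opp, wghost_teich).
Let mE := (witt_map_add, witt_map_mul, witt_map_opp, witt_map_teich).

Let addA : associative (@witt_add R).
Proof.
by move=> a b c; rewrite -(liftK a) -(liftK b) -(liftK c) -!mE;
  congr witt_map; apply: ghostP => n; rewrite !gE addrA.
Qed.
Let addC : commutative (@witt_add R).
Proof.
by move=> a b; rewrite -(liftK a) -(liftK b) -!mE;
  congr witt_map; apply: ghostP => n; rewrite !gE addrC.
Qed.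
Let add0 : left_id (teich 0) (@witt_add R).
Proof.
move=> a; rewrite -(liftK a) -(rmorph0 pi) -!mE.
by congr witt_map; apply: ghostP => n; rewrite !gE expr0n expn_eq0 eqn0Ngt prime_gt0 // add0r.
Qed.
Let addN : left_inverse (teich 0) (@witt_opp R) (@witt_add R).
Proof.
move=> a; rewrite -(liftK a) -(rmorph0 pi) -!mE.
by congr witt_map; apply: ghostP => n; rewrite !gE expr0n expn_eq0 eqn0Ngt prime_gt0 // addNr.
Qed.
Let mulA : associative (@witt_mul R).
Proof.
by move=> a b c; rewrite -(liftK a) -(liftK b) -(liftK c) -!mE;
  congr witt_map; apply: ghostP => n; rewrite !gE mulrA.
Qed.
Let mulC : commutative (@witt_mul R).
Proof.
by move=> a b; rewrite -(liftK a) -(liftK b) -!mE;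
  congr witt_map; apply: ghostP => n; rewrite !gE mulrC.
Qed.
Let mul1 : left_id (teich 1) (@witt_mul R).
Proof.
move=> a; rewrite -(liftK a) -(rmorph1 pi) -!mE.
by congr witt_map; apply: ghostP => n; rewrite !gE expr1n mul1r.
Qed.
Let mulD : left_distributive (@witt_mul R) (@witt_add R).
Proof.
by move=> a b c; rewrite -(liftK a) -(liftK b) -(liftK c) -!mE;
  congr witt_map; apply: ghostP => n; rewrite !gE mulrDl.
Qed.
Let one_neq0 : teich 1 != teich 0 :> witt p_pr R.
Proof.
by apply/eqP => /(congr1 (fun a => wcoord a 0%N)) /= /eqP; rewrite oner_eq0.
Qed.

HB.instance Definition _ := GRing.isZmodule.Build (witt p_pr R) addA addC add0 addN.
HB.instance Definition _ := GRing.Zmodule_isComNzRing.Build (witt p_pr R)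
  mulA mulC mul1 mulD one_neq0.
End RingLaws.

Section WittMap.
Variables (R S : comNzRingType) (f : {rmorphism R -> S}).

Let map_zmod : zmod_morphism (@witt_map p p_pr R S f).
Proof. by move=> a b; rewrite [LHS]witt_map_add; congr witt_add; exact: witt_map_opp. Qed.

Let map_monoid : monoid_morphism (@witt_map p p_pr R S f).
Proof.
by split=> [|a b]; [rewrite [LHS]witt_map_teich rmorph1 | exact: witt_map_subst].
Qed.

HB.instance Definition _ :=
  GRing.isZmodMorphism.Build (witt p_pr R) (witt p_pr S) (witt_map f) map_zmod.
HB.instance Definition _ :=
  GRing.isMonoidMorphism.Build (witt p_pr R) (witt p_pr S) (witt_map f) map_monoid.
End WittMap.

End WittRing.

Section Ideal.
Variable R : comPzRingType.

Definition is_ideal (J : set R) : Prop :=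
  [/\ J 0, forall x y, J x -> J y -> J (x + y) & forall a x, J x -> J (a * x)].

Definition ideal_gen (S : set R) : set R := smallest is_ideal S.

Lemma ideal_genP S : is_ideal (ideal_gen S).
Proof.
split=> [J [[]]//|x y Sx Sy J JS|a x Sx J JS]; case: (JS) => -[J0 JD JM] _.
- by apply: JD; [apply: Sx | apply: Sy].
- by apply: JM; apply: Sx.
Qed.

Definition ideal_pred (S : set R) : {pred R} := fun x => `[< ideal_gen S x >].

Lemma ideal_zmod S : zmod_closed (ideal_pred S).
Proof.
have [I0 ID IM] := ideal_genP S; split=> [|x y]; rewrite !unfold_in; first exact/asboolP.
move=> /asboolP xS /asboolP yS; apply/asboolP; apply: ID => //.
by rewrite -mulN1r; apply: IM.
Qed.

HB.instance Definition _ S := GRing.isZmodClosed.Build R (ideal_pred S) (ideal_zmod S).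

(* The quotient of R by the ideal generated by S, possibly zero. *)
Definition quot (S : set R) : Type := Quotient.quot (ideal_pred S).

Section Quot.
Variable S : set R.

HB.instance Definition _ := Choice.on (quot S).
HB.instance Definition _ := EqQuotient.on (quot S).
HB.instance Definition _ := GRing.Zmodule.on (quot S).

Definition qclass (x : R) : quot S := \pi x.

Lemma qclassP x y : qclass x = qclass y <-> ideal_gen S (x - y).
Proof.
rewrite /qclass; split=> [/eqP|h].
  by rewrite -Quotient.idealrBE => /asboolP.
by apply/eqP; rewrite -Quotient.idealrBE; apply/asboolP.
Qed.

Definition qmul (x y : quot S) : quot S := qclass (repr x * repr y).

Let qclassK x : qclass (repr x) = x. Proof. exact: reprK. Qed.

Lemma qclassM x y : qclass (x * y) = qmul (qclass x) (qclass y).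
Proof.
have [_ ID IM] := ideal_genP S; apply/qclassP.
set x' := repr _; set y' := repr _.
have hx : ideal_gen S (x - x') by apply/qclassP; rewrite qclassK.
have hy : ideal_gen S (y - y') by apply/qclassP; rewrite qclassK.
have -> : x * y - x' * y' = y * (x - x') + x' * (y - y').
  by rewrite !mulrBr mulrC [x' * y]mulrC addrA subrK.
by apply: ID; apply: IM.
Qed.

Lemma qclassB : zmod_morphism qclass.
Proof. by move=> x y; rewrite /qclass !piE. Qed.

Let qmulA : associative qmul.
Proof.
move=> x y z; rewrite -(qclassK x) -(qclassK y) -(qclassK z).
by rewrite -!qclassM mulrA.
Qed.
Let qmulC : commutative qmul.
Proof. by move=> x y; rewrite /qmul mulrC. Qed.
Let qmul1 : left_id (qclass 1) qmul.
Proof. by move=> x; rewrite -(qclassK x) -qclassM mul1r. Qed.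
Let qmulD : left_distributive qmul +%R.
Proof.
have qD x y : qclass (x + y) = qclass x + qclass y by rewrite /qclass !piE.
move=> x y z; rewrite -(qclassK x) -(qclassK y) -(qclassK z).
by rewrite -qD -!qclassM mulrDl qD.
Qed.

HB.instance Definition _ := GRing.Zmodule_isComPzRing.Build (quot S)
  qmulA qmulC qmul1 qmulD.
HB.instance Definition _ := GRing.isZmodMorphism.Build R (quot S) qclass qclassB.
HB.instance Definition _ := GRing.isMonoidMorphism.Build R (quot S) qclass
  (erefl, qclassM).

Lemma quot_nz (J : set R) : is_ideal J -> S `<=` J -> ~ J 1 -> 1 != 0 :> quot S.
Proof.
move=> Jid SJ J1; apply/eqP => E.
have /qclassP : qclass 1 = qclass 0 by rewrite rmorph1 rmorph0.
by rewrite subr0 => /(_ J (conj Jid SJ)).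
Qed.
End Quot.
End Ideal.

(* R[1/s], presented as R[X]/(sX - 1). *)
Definition away (R : comNzRingType) (s : R) : Type :=
  quot [set (s *: 'X - 1 : {poly R})].
HB.instance Definition _ R s := GRing.ComPzRing.on (@away R s).
Definition to_away (R : comNzRingType) (s x : R) : away s :=
  qclass [set s *: 'X - 1] x%:P.

Section NormLimits.
Variables (R : realType) (K : zmodType) (N : K -> R).

Definition norm_cvg (u : nat -> K) (l : K) : Prop :=
  forall e : R, 0 < e -> exists n0, forall n, (n0 <= n)%N -> N (u n - l) < e.

Definition norm_cauchy (u : nat -> K) : Prop :=
  forall e : R, 0 < e -> exists n0, forall m n,
    (n0 <= m)%N -> (n0 <= n)%N -> N (u m - u n) < e.

(* The limit of u; 0 if u diverges. *)
Definition norm_lim (u : nat -> K) : K := xget 0 [set l | norm_cvg u l].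
End NormLimits.

HB.mixin Record isAnalyticField (R : realType) K of GRing.Field K := {
  anorm : K -> R;
  anorm_ge0 : forall x, 0 <= anorm x;
  anorm_eq0 : forall x, (anorm x == 0) = (x == 0);
  anormM : forall x y, anorm (x * y) = anorm x * anorm y;
  anormD_le : forall x y, anorm (x + y) <= Num.max (anorm x) (anorm y);
  anorm_complete : forall u, norm_cauchy anorm u -> exists l, norm_cvg anorm u l
}.

#[short(type="analyticFieldType")]
HB.structure Definition AnalyticField (R : realType) :=
  {K of isAnalyticField R K & GRing.Field K}.

Section IntegerRing.
Variables (R : realType) (K : analyticFieldType R).
Implicit Types x y : K.

Lemma anorm1 : anorm (1 : K) = 1.
Proof.
have n0 : anorm (1 : K) != 0 by rewrite anorm_eq0 oner_eq0.
by apply: (mulfI n0); rewrite -anormM !mulr1.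
Qed.

Lemma anormN x : anorm (- x) = anorm x.
Proof.
apply/eqP; rewrite -(@eqrXn2 _ 2) ?anorm_ge0 //.
by rewrite !expr2 -!anormM mulrNN.
Qed.

Definition integer : {pred K} := fun x => anorm x <= 1.

Lemma integer_subring : subring_closed integer.
Proof.
split=> [|x y|x y]; rewrite !unfold_in ?anorm1 // => hx hy.
  by rewrite (le_trans (anormD_le _ _)) // ge_max hx anormN.
by rewrite anormM mulr_ile1 ?anorm_ge0.
Qed.

HB.instance Definition _ := GRing.isSubringClosed.Build K integer integer_subring.

Record oring : Type := OInt { oval :> K; ovalP : oval \in integer }.
HB.instance Definition _ := [isSub for oval].
HB.instance Definition _ := [Choice of oring by <:].
HB.instance Definition _ := [SubChoice_isSubComNzRing of oring by <:].

Definition maximal_ideal : set oring := [set x | anorm (oval x) < 1].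

Lemma maximal_idealP : is_ideal maximal_ideal.
Proof.
have a0 : anorm (0 : K) = 0 by apply/eqP; rewrite anorm_eq0.
split=> [|x y|a x]; rewrite /maximal_ideal /=.
- by rewrite a0 ltr01.
- by move=> hx hy; rewrite (le_lt_trans (anormD_le _ _)) // gt_max hx.
- by move=> hx; rewrite anormM (le_lt_trans _ hx) // ler_piMl ?anorm_ge0 //; exact: (ovalP a).
Qed.

Lemma maximal_ideal_proper : ~ maximal_ideal 1.
Proof. by rewrite /maximal_ideal /= anorm1 ltxx. Qed.

Definition residue_field : Type := quot maximal_ideal.
HB.instance Definition _ := GRing.ComPzRing.on residue_field.
HB.instance Definition _ := GRing.PzSemiRing_isNonZero.Build residue_field
  (quot_nz maximal_idealP (fun _ => id) maximal_ideal_proper).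

Definition value_group : set R := [set anorm x | x in [set x : K | x != 0]].

(* The value group |K^*| is a discrete subset of the reals. *)
Definition discretely_valued : Prop :=
  forall r, value_group r -> isolated value_group r.
End IntegerRing.

HB.mixin Record isMixedChar (R : realType) (p : nat) K of AnalyticField R K := {
  anorm_p : anorm (p%:R : K) = p%:R^-1;
  residue_pchar : p \in [pchar residue_field K]
}.

#[short(type="mixedFieldType")]
HB.structure Definition MixedField (R : realType) (p : nat) :=
  {K of isMixedChar R p K & AnalyticField R K}.

Section ModP.
Variables (R : realType) (p : nat) (K : mixedFieldType R p).

Definition modp : Type := quot [set (p%:R : oring K)].
HB.instance Definition _ := GRing.ComPzRing.on modp.

Lemma prime_residue : prime p.
Proof. exact: pcharf_prime (@residue_pchar R p K). Qed.

Let modp_nz : 1 != 0 :> quot [set (p%:R : oring K)].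
Proof.
apply: (quot_nz (maximal_idealP K)); last exact: maximal_ideal_proper.
move=> _ ->; have -> : maximal_ideal (p%:R : oring K) = (anorm (p%:R : K) < 1 : Prop).
  by rewrite -(rmorph_nat (\val : oring K -> K)).
rewrite anorm_p.
by rewrite invf_lt1 ?ltr1n ?ltr0n ?prime_gt0 ?prime_gt1 // prime_residue.
Qed.
HB.instance Definition _ := GRing.PzSemiRing_isNonZero.Build modp modp_nz.

Definition to_modp (x : oring K) : modp := qclass [set p%:R] x.

Lemma modp_pchar : p \in [pchar modp].
Proof.
apply/andP; split; first exact: prime_residue.
apply/eqP; rewrite -[LHS](rmorph_nat (qclass [set (p%:R : oring K)])).
rewrite -(rmorph0 (qclass [set (p%:R : oring K)])); apply/qclassP.
by rewrite subr0; apply: sub_gen_smallest.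
Qed.

Definition frob_compatible : {pred nat -> modp} :=
  fun x => `[< forall n, x n.+1 ^+ p = x n >].

Lemma frob_compatible_subring : subring_closed frob_compatible.
Proof.
have aut := pFrobenius_autE modp_pchar.
split=> [|x y|x y]; rewrite !unfold_in.
- by apply/asboolP => n; rewrite [LHS]expr1n.
- move=> /asboolP xP /asboolP yP; apply/asboolP => n.
  by rewrite -[LHS]aut rmorphB /= !aut xP yP.
- move=> /asboolP xP /asboolP yP; apply/asboolP => n.
  by rewrite [LHS]exprMn xP yP.
Qed.
HB.instance Definition _ :=
  GRing.isSubringClosed.Build (nat -> modp) frob_compatible frob_compatible_subring.

(* The valuation ring of the perfect norm field: sequences (x_n) in o_K/(p) with
   x_(n+1)^p = x_n. *)
Record tilt_ring : Type := Tilt { tseq :> nat -> modp; tseqP : tseq \in frob_compatible }.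
HB.instance Definition _ := [isSub for tseq].
HB.instance Definition _ := [Choice of tilt_ring by <:].
HB.instance Definition _ := [SubChoice_isSubComNzRing of tilt_ring by <:].

(* repr picks a lift in o_K of a class modulo p; the limit does not depend on
   the lifts. *)
Definition theta (x : tilt_ring) : K :=
  norm_lim (@anorm R K) (fun n => oval (repr (tseq x n)) ^+ (p ^ n)).
End ModP.

Section TeichmullerDigits.
Variables (p : nat) (p_pr : prime p) (A : comNzRingType).

(* z = \sum_n p^n [x_n], as a p-adically convergent series; over a perfect ring
   of characteristic p every z has exactly one such sequence of digits. *)
Definition is_tdigits (z : witt p_pr A) (x : nat -> A) : Prop :=
  forall n, exists w, z = \sum_(i < n) p%:R ^+ i * teich p_pr (x i) + p%:R ^+ n * w.

Definition tdigits (z : witt p_pr A) : nat -> A :=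
  xget (fun=> 0) [set x | is_tdigits z x].
End TeichmullerDigits.

Definition Theta (R : realType) (p : nat) (p_pr : prime p) (K : mixedFieldType R p)
    (z : witt p_pr (tilt_ring K)) : K :=
  norm_lim (@anorm R K) (fun m => \sum_(n < m) p%:R ^+ n * theta (tdigits z n)).

HB.mixin Record isPerfectoid (R : realType) (p : nat) K of MixedField R p K := {
  perfectoid_not_discrete : ~ discretely_valued K;
  perfectoid_frob_surj : forall x : modp K, exists y : modp K, y ^+ p = x
}.

#[short(type="perfectoidFieldType")]
HB.structure Definition PerfectoidField (R : realType) (p : nat) :=
  {K of isPerfectoid R p K & MixedField R p K}.

HB.mixin Record isPerfectAnalytic (R : realType) (p : nat) F of AnalyticField R F := {
  perfect_pchar : p \in [pchar F];
  perfect_frob_surj : forall x : F, exists y : F, y ^+ p = x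
}.

#[short(type="perfectAnalyticFieldType")]
HB.structure Definition PerfectAnalyticField (R : realType) (p : nat) :=
  {F of isPerfectAnalytic R p F & AnalyticField R F}.

(* The second condition says that (z - [z_0])/p is a unit. *)
Definition primitive (R : realType) (p : nat) (p_pr : prime p)
    (F : perfectAnalyticFieldType R p) (z : witt p_pr (oring F)) : Prop :=
  anorm (oval (tdigits z 0)) = p%:R^-1 /\
  exists u v, z - teich p_pr (tdigits z 0) = p%:R * u /\ u * v = 1.

Record primitive_pair (R : realType) (p : nat) (p_pr : prime p) := PrimitivePair {
  pair_field :> perfectAnalyticFieldType R p;
  pair_ideal : set (witt p_pr (oring pair_field));
  pair_idealP : exists2 z, primitive z & pair_ideal = ideal_gen [set z]
}.
Arguments pair_ideal {R p p_pr} _ _.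

Section Untilt.
Variables (R : realType) (p : nat) (p_pr : prime p) (P : primitive_pair R p_pr).
Let W := witt p_pr (oring P).

(* W(o_F)[1/p] / I W(o_F)[1/p] *)
Definition untilt_ring : Type := quot [set to_away (p%:R : W) w | w in pair_ideal P].
HB.instance Definition _ := GRing.ComPzRing.on untilt_ring.

Definition untilt_class (w : W) : untilt_ring := qclass _ (to_away (p%:R : W) w).
End Untilt.

Record isometric_hom (R : realType) (K L : analyticFieldType R) := IsometricHom {
  ihom :> K -> L;
  ihomB : zmod_morphism ihom;
  ihomM : monoid_morphism ihom;
  ihom_norm : forall x, anorm (ihom x) = anorm x
}.

Section IsometricHom.
Variable R : realType.
Implicit Types K L M : analyticFieldType R.

HB.instance Definition _ K L (f : isometric_hom K L) :=
  GRing.isZmodMorphism.Build K L f (ihomB f).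
HB.instance Definition _ K L (f : isometric_hom K L) :=
  GRing.isMonoidMorphism.Build K L f (ihomM f).

Lemma isometric_hom_ext K L (f g : isometric_hom K L) : f =1 g -> f = g.
Proof.
case: f g => [f fB fM fN] [g gB gM gN] /= /funext fg; subst g.
by congr IsometricHom; apply: Prop_irrelevance.
Qed.

Definition isometric_id K : isometric_hom K K.
Proof. by exists idfun. Defined.

Definition isometric_comp K L M (g : isometric_hom L M) (f : isometric_hom K L) :
  isometric_hom K M.
Proof.
exists (g \o f).
- by move=> x y; rewrite /= !rmorphB.
- by split=> [|x y]; rewrite /= ?rmorph1 ?rmorphM.
- by move=> x; rewrite /= !ihom_norm.
Defined.

Lemma oring_map_subproof K L (f : isometric_hom K L) (x : oring K) :
  f (oval x) \in @integer R L.
Proof. by have := ovalP x; rewrite !unfold_in ihom_norm. Qed.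

Definition oring_map K L (f : isometric_hom K L) (x : oring K) : oring L :=
  OInt (oring_map_subproof f x).

Lemma oring_map_zmod K L (f : isometric_hom K L) : zmod_morphism (oring_map f).
Proof. by move=> x y; apply: val_inj; rewrite /= rmorphB. Qed.
Lemma oring_map_monoid K L (f : isometric_hom K L) : monoid_morphism (oring_map f).
Proof. by split=> [|x y]; apply: val_inj; rewrite /= ?rmorph1 ?rmorphM. Qed.
HB.instance Definition _ K L (f : isometric_hom K L) :=
  GRing.isZmodMorphism.Build (oring K) (oring L) (oring_map f) (oring_map_zmod f).
HB.instance Definition _ K L (f : isometric_hom K L) :=
  GRing.isMonoidMorphism.Build (oring K) (oring L) (oring_map f) (oring_map_monoid f).

Definition modp_map p (K L : mixedFieldType R p) (f : isometric_hom K L)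
  (x : modp K) : modp L := to_modp (oring_map f (repr x)).
End IsometricHom.

Record pair_hom (R : realType) (p : nat) (p_pr : prime p) (P Q : primitive_pair R p_pr) :=
  PairHom {
  phom :> isometric_hom P Q;
  phom_ideal : forall w, pair_ideal P w -> pair_ideal Q (witt_map (oring_map phom) w)
}.

Record category := Category {
  cat_obj :> Type;
  cat_hom : cat_obj -> cat_obj -> Type;
  cat_id : forall X, cat_hom X X;
  cat_comp : forall X Y Z, cat_hom Y Z -> cat_hom X Y -> cat_hom X Z;
  cat_idl : forall X Y (f : cat_hom X Y), cat_comp (cat_id Y) f = f;
  cat_idr : forall X Y (f : cat_hom X Y), cat_comp f (cat_id X) = f;
  cat_assoc : forall X Y Z T (h : cat_hom Z T) (g : cat_hom Y Z) (f : cat_hom X Y),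
    cat_comp h (cat_comp g f) = cat_comp (cat_comp h g) f
}.

Record functor (C D : category) := Functor {
  fobj :> C -> D;
  fmap : forall X Y, cat_hom X Y -> cat_hom (fobj X) (fobj Y);
  fmap_id : forall X, fmap (cat_id X) = cat_id (fobj X);
  fmap_comp : forall X Y Z (g : cat_hom Y Z) (f : cat_hom X Y),
    fmap (cat_comp g f) = cat_comp (fmap g) (fmap f)
}.

Definition functor_id (C : category) : functor C C.
Proof. by exists id (fun X Y f => f). Defined.

Definition functor_comp (C D E : category) (G : functor D E) (F : functor C D) :
  functor C E.
Proof.
exists (fun X => G (F X)) (fun X Y f => fmap G (fmap F f)).
- by move=> X; rewrite !fmap_id.
- by move=> X Y Z g f; rewrite !fmap_comp.
Defined.

Definition naturally_isomorphic (C D : category) (F G : functor C D) : Prop :=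
  exists (a : forall X, cat_hom (F X) (G X)) (b : forall X, cat_hom (G X) (F X)),
  [/\ forall X, cat_comp (b X) (a X) = cat_id (F X),
      forall X, cat_comp (a X) (b X) = cat_id (G X) &
      forall X Y (f : cat_hom X Y), cat_comp (a Y) (fmap F f) = cat_comp (fmap G f) (a X)].

Definition quasi_inverse (C D : category) (F : functor C D) (G : functor D C) : Prop :=
  naturally_isomorphic (functor_comp G F) (functor_id C) /\
  naturally_isomorphic (functor_comp F G) (functor_id D).

Definition perfectoid_category (R : realType) (p : nat) : category.
Proof.
exists (perfectoidFieldType R p) (fun K L => isometric_hom K L)
  (fun K => isometric_id K) (fun K L M g f => isometric_comp g f).
- by move=> X Y f; apply: isometric_hom_ext.
- by move=> X Y f; apply: isometric_hom_ext.
- by move=> X Y Z T h g f; apply: isometric_hom_ext.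
Defined.

Section PairCategory.
Variables (R : realType) (p : nat) (p_pr : prime p).
Implicit Types P Q S : primitive_pair R p_pr.

Lemma pair_hom_ext P Q (f g : pair_hom P Q) : f =1 g -> f = g.
Proof.
case: f g => [f fI] [g gI] /= /isometric_hom_ext fg; subst g.
by congr PairHom; apply: Prop_irrelevance.
Qed.

Definition pair_id P : pair_hom P P.
Proof.
exists (isometric_id P) => w; congr (pair_ideal P _).
by apply: wittP => n /=; apply: val_inj.
Defined.

Definition pair_comp P Q S (g : pair_hom Q S) (f : pair_hom P Q) : pair_hom P S.
Proof.
exists (isometric_comp g f) => w /(phom_ideal f) /(phom_ideal g).
by congr (pair_ideal S _); apply: wittP => n /=; apply: val_inj.
Defined.

Definition pair_category : category.
Proof.
exists (primitive_pair R p_pr) (@pair_hom R p p_pr) pair_id pair_comp.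
- by move=> X Y f; apply: pair_hom_ext.
- by move=> X Y f; apply: pair_hom_ext.
- by move=> X Y Z T h g f; apply: pair_hom_ext.
Defined.
End PairCategory.

Section Correspondence.
Variables (R : realType) (p : nat) (p_pr : prime p).
Local Notation perf := (perfectoid_category R p).
Local Notation pairs := (pair_category R p_pr).

(* T is K |-> (K', ker Theta), up to the identification iota: the field of T K is
   the one with valuation ring tilt_ring K and with norm extending |theta(x)|,
   the ideal of T K corresponds to ker Theta, and T f acts termwise on sequences.
   This determines T up to unique natural isomorphism. *)
Definition is_tilting (T : functor perf pairs) : Prop :=
  exists iota : forall K : perfectoidFieldType R p,
    {rmorphism oring (T K : primitive_pair R p_pr) -> tilt_ring K},
  [/\ forall K, bijective (iota K),
      forall K x, anorm (oval x) = anorm (theta (iota K x)),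
      forall K, pair_ideal (T K) = [set w | Theta (witt_map (iota K) w) = 0] &
      forall (K L : perfectoidFieldType R p) (f : isometric_hom K L) x n,
        tseq (iota L (oring_map (fmap T f : pair_hom (T K) (T L)) x)) n =
        modp_map f (tseq (iota K x) n)].

(* U is (F, I) |-> W(o_F)[1/p] / I W(o_F)[1/p], up to the identification kappa: the
   norm of U P is multiplicative and is given on W(o_F)/I by |y_0| at the
   representatives y = \sum_n p^n [y_n] with |y_n| <= |y_0|, and U g is induced
   by W(g). *)
Definition is_untilting (U : functor pairs perf) : Prop :=
  exists kappa : forall P : primitive_pair R p_pr,
    {rmorphism untilt_ring P -> (U P : perfectoidFieldType R p)},
  [/\ forall P, bijective (kappa P),
      forall (P : primitive_pair R p_pr) (y : witt p_pr (oring P)),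
        (forall n, anorm (oval (tdigits y n)) <= anorm (oval (tdigits y 0))) ->
        anorm (kappa P (untilt_class y)) = anorm (oval (tdigits y 0)) &
      forall (P Q : primitive_pair R p_pr) (g : pair_hom P Q) (w : witt p_pr (oring P)),
        (fmap U g : isometric_hom (U P : perfectoidFieldType R p)
                                  (U Q : perfectoidFieldType R p))
          (kappa P (untilt_class w)) =
        kappa Q (untilt_class (witt_map (oring_map g) w))].
End Correspondence.

(* Main.v *)
(* Over a perfect ring, W is p-torsion free and p-adically complete, so a ring
   homomorphism out of W into a p-adically separated ring is determined on
   Teichmueller representatives.

   Tilting.  The norm |theta(x)| makes the tilt of o_K a complete valuation ring,
   whose fraction field is K'.  Theta is a ring homomorphism because modulo
   p^(n+1) it is the n-th ghost component of lifts to W(o_K).  As K is perfectoid,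
   Theta is onto and some z_0 has |theta(z_0)| = 1/p; then Theta kills
   z = [z_0] - p u for a unit u, and p-adic approximation shows that z generates
   the kernel.

   Untilting.  For z primitive, p is a unit times [z_0] modulo z, hence every
   w in W(o_F) is congruent to [a] v with v a unit, and |a| depends only on the
   class of w.  This makes W(o_F)/(z) a complete valuation ring; inverting p gives
   its fraction field.

   Theta induces o_K = W(o_K')/ker Theta, and x |-> ([x^(1/p^n)] mod p)_n is an
   isometry from o_F onto the tilt of W(o_F)/(z); an isometry between valuation
   rings extends uniquely to the fraction fields. *)
From HB Require Import structures.
From mathcomp Require Import all_boot all_order all_algebra generic_quotient.
From mathcomp Require Import ring.
From mathcomp Require Import all_classical all_reals topology normedtype sequences.
Require Import Defs.
Set Implicit Arguments.
Unset Strict Implicit.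
Unset Printing Implicit Defensive.
Import Order.TTheory GRing.Theory Num.Theory.
Import numFieldNormedType.Exports.
Local Open Scope classical_set_scope.
Local Open Scope quotient_scope.
Local Open Scope ring_scope.

(** * Witt vectors of perfect rings *)

(** Two obstacles shape the proof. Ghost components lose information in characteristic p, where o_F
    and o_K' live; identities between Witt vectors are therefore verified over a free torsion-free
    ring and projected, and for multiplication by p the identity over the free ring holds only
    modulo p. Moreover the surjectivity of Frobenius gives approximations modulo p only, and these
    do not see an element of norm 1/p. To find z_0 with |theta(z_0)| = 1/p, the prime is factored as
    p = a (p/a) with both norms strictly between 1/p and 1; non-discreteness supplies a, each factor
    keeps its norm modulo p, and so each is matched by an element of the tilt.

    The norm on W(o_F)/(z) is defined through the form [a] v because this makes multiplicativity
    immediate; the formula at dominated representatives is derived afterwards, by writing y = [y_0]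
    v. Independence of the choice of a rests on a descent: if [b] lies in (z), then so does [b/z_0],
    so b is divisible by every power of z_0. *)

Section WittGeneral.
Variables (p : nat) (p_pr : prime p).
Local Notation cong := WittPolynomials.cong.

Let p0 : (0 < p)%N. Proof. exact: prime_gt0. Qed.

Section Ghost.
Variable A : comNzRingType.

Lemma wghost_zmod n : zmod_morphism (@wghost p p_pr A n).
Proof. by move=> a b; rewrite [LHS]wghost_add; congr (_ + _); exact: wghost_opp. Qed.

Lemma wghost_monoid n : monoid_morphism (@wghost p p_pr A n).
Proof. by split=> [|a b]; [rewrite [LHS]wghost_teich expr1n | exact: wghost_mul]. Qed.

HB.instance Definition _ n := GRing.isZmodMorphism.Build (witt p_pr A) A
  (@wghost p p_pr A n) (@wghost_zmod n).
HB.instance Definition _ n := GRing.isMonoidMorphism.Build (witt p_pr A) A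
  (@wghost p p_pr A n) (@wghost_monoid n).

Definition wred (w : witt p_pr A) : A := wcoord w 0%N.

Lemma wghost0 (w : witt p_pr A) : wghost 0 w = wred w.
Proof. by rewrite /wghost /ghost big_ord1 expr0 mul1r subnn expn0 expr1. Qed.

Lemma wred_zmod : zmod_morphism wred.
Proof. by move=> a b; rewrite -!wghost0 rmorphB. Qed.

Lemma wred_monoid : monoid_morphism wred.
Proof. by split=> [|a b]; rewrite -!wghost0 ?rmorph1 ?rmorphM. Qed.

HB.instance Definition _ := GRing.isZmodMorphism.Build (witt p_pr A) A wred wred_zmod.
HB.instance Definition _ := GRing.isMonoidMorphism.Build (witt p_pr A) A wred wred_monoid.

Lemma wred_teich x : wred (teich p_pr x) = x. Proof. by []. Qed.
End Ghost.
Arguments wred {A} w : simpl never.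

Lemma wred_map (A B : comNzRingType) (f : A -> B) (w : witt p_pr A) :
  wred (witt_map f w) = f (wred w).
Proof. by []. Qed.

(** By induction a_i = b_i modulo p for i < n, so the terms p^i a_i^(p^(n-i)) and p^i b_i^(p^(n-i))
    agree modulo p^(n+1) and cancel. What remains is p^n (a_n - b_n), from which p^n is removed by
    torsion-freeness. *)
Lemma ghost_coord_cong I (a b : nat -> FreeComRing.ring (FreeComRingConstruction.poly I)) :
  (forall n, cong p n.+1 (ghost p n a) (ghost p n b)) -> forall n, cong p 1 (a n) (b n).
Proof.
move=> ab; elim/ltn_ind=> n IH.
have := ab n; rewrite /ghost !big_ord_recr /= subnn expn0 !expr1.
set s := \sum_(i < n) _; set t := \sum_(i < n) _ => h.
have [z st] : cong p n.+1 s t.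
  apply: WittPolynomials.cong_sum => i; have lin : (i <= n)%N by apply: ltnW.
  rewrite -[in cong _ _](subnKC (leqW lin)); apply: WittPolynomials.congMp.
  by rewrite subSn //; apply/WittPolynomials.cong_exppX/IH.
case: h => y; rewrite st => h; exists (y - z).
have : (p ^ n)%:R * (a n - (b n + p%:R ^+ 1 * (y - z))) = 0.
  rewrite natrX expr1; move: h; rewrite exprS => h.
  have -> : p%:R ^+ n * (a n - (b n + p%:R * (y - z))) =
    (t + p%:R * p%:R ^+ n * z + p%:R ^+ n * a n)
     - (t + p%:R ^+ n * b n + p%:R * p%:R ^+ n * y) by ring.
  by rewrite h subrr.
by move/(FreeComRing.torsion_free); rewrite expn_gt0 p0 => /(_ isT)/eqP; rewrite subr_eq0 => /eqP.
Qed.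

Section Cover.
Variable A : comNzRingType.
Let F := FreeComRingConstruction.poly A.
Let B := FreeComRing.ring F.
Let pi : {rmorphism B -> A} := FreeComRing.eval F (fun x : A => x).
Let lift (a : witt p_pr A) : witt p_pr B := witt_map (fun x => FreeComRing.gen F x) a.

Let liftK a : witt_map pi (lift a) = a.
Proof. by apply: wittP => n /=; rewrite FreeComRing.eval_gen. Qed.

Let ghostP (a b : witt p_pr B) : (forall n, wghost n a = wghost n b) -> a = b.
Proof.
move=> ab; apply: wittP => n.
by apply: (WittPolynomials.ghost_inj p_pr (n := n)) => // m _; apply: ab.
Qed.

Lemma teichM (x y : A) : teich p_pr (x * y) = teich p_pr x * teich p_pr y.
Proof.
have gK z : pi (FreeComRing.gen F z) = z by rewrite FreeComRing.eval_gen.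
rewrite -[x]gK -[y]gK -rmorphM -!witt_map_teich -rmorphM; congr witt_map.
by apply: ghostP => n; rewrite rmorphM /= !wghost_teich exprMn.
Qed.

Lemma teichX (x : A) n : teich p_pr (x ^+ n) = teich p_pr x ^+ n.
Proof. by elim: n => [|n IH] //; rewrite !exprS teichM IH. Qed.

(** Vectors with disjoint supports add coordinatewise: over the free cover each coordinate
    contributes its own term to the ghost components. *)
Lemma witt_split (w : witt p_pr A) :
  w = teich p_pr (wred w) +
      Witt p_pr (fun n => if n is m.+1 then wcoord w m.+1 else 0).
Proof.
rewrite -{1 2}(liftK w).
have -> : Witt p_pr (fun n => if n is m.+1 then wcoord w m.+1 else 0) =
  witt_map pi (Witt p_pr (fun n => if n is m.+1 then wcoord (lift w) m.+1 else 0)).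
  by apply: wittP => -[|n]; rewrite /= ?rmorph0 ?FreeComRing.eval_gen.
rewrite wred_map -witt_map_teich -rmorphD; congr witt_map.
apply: ghostP => n; rewrite rmorphD /= wghost_teich /wghost /ghost.
rewrite big_ord_recl [in RHS]big_ord_recl /= subn0 expr0 !mul1r.
by rewrite expr0n expn_eq0 eqn0Ngt p0 add0r.
Qed.

(* In characteristic p, multiplication by p is the composite of Frobenius and
   Verschiebung. *)
Lemma witt_mulp (Ap : p \in [pchar A]) (w : witt p_pr A) :
  p%:R * w = Witt p_pr (fun n => if n is m.+1 then wcoord w m ^+ p else 0).
Proof.
rewrite -{1}(liftK w).
have -> : Witt p_pr (fun n => if n is m.+1 then wcoord w m ^+ p else 0) =
  witt_map pi (Witt p_pr (fun n => if n is m.+1 then wcoord (lift w) m ^+ p else 0)).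
  by apply: wittP => -[|n]; rewrite /= ?rmorph0 ?rmorphXn ?FreeComRing.eval_gen.
rewrite -(rmorph_nat (witt_map pi)) -rmorphM.
set a := p%:R * lift w; set b := Witt _ _; apply: wittP => n.
rewrite -[LHS]/(pi (wcoord a n)) -[RHS]/(pi (wcoord b n)).
(* Over the cover the two sides differ, but their n-th ghost components differ only by p^(n+1) times
   the n-th coordinate of [lift w]. Hence the coordinates agree modulo p, and p dies in A. *)
suff [z ->] : cong p 1 (wcoord a n) (wcoord b n).
  by rewrite rmorphD rmorphM /= expr1 rmorph_nat (pcharf0 Ap) mul0r addr0.
apply: ghost_coord_cong => {}n.
have -> : ghost p n (wcoord a) = p%:R * wghost n (lift w).
  by rewrite -[LHS]/(wghost n a) rmorphM rmorph_nat.
rewrite /wghost /ghost [X in cong _ _ _ X]big_ord_recl big_ord_recr /=.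
rewrite subn0 expr0 mul1r expr0n expn_eq0 eqn0Ngt p0 add0r subnn expn0 expr1.
exists (wcoord (lift w) n); rewrite mulrDr mulrA -exprS; congr (_ + _).
rewrite mulr_sumr; apply: eq_bigr => i _; rewrite mulrA -exprS.
rewrite -exprM -expnS /bump /= add1n subnSK //.
Qed.
End Cover.

Definition perfect_ring (A : comNzRingType) : Prop :=
  [/\ p \in [pchar A], injective (fun x : A => x ^+ p) & forall x : A, exists y, y ^+ p = x].

Lemma perfect_expn_inj (A : comNzRingType) : perfect_ring A ->
  forall n, injective (fun x : A => x ^+ (p ^ n)).
Proof.
case=> _ inj _; elim=> [|n IH] x y /=; first by rewrite !expr1.
by rewrite expnSr !exprM => /inj /IH.
Qed.

Section Perfect.
Variables (A : comNzRingType) (Aperf : perfect_ring A).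
Local Notation W := (witt p_pr A).
Implicit Types w : W.

Let Ap : p \in [pchar A]. Proof. by case: Aperf. Qed.
Let Ainj : injective (fun x : A => x ^+ p). Proof. by case: Aperf. Qed.
Let Asurj (x : A) : exists y, y ^+ p = x. Proof. by case: Aperf. Qed.

Let rt (x : A) : A := sval (cid (Asurj x)).
Let rtK x : rt x ^+ p = x. Proof. exact: (svalP (cid (Asurj x))). Qed.
Let rtX x : rt (x ^+ p) = x. Proof. by apply: Ainj; rewrite rtK. Qed.

(** The quotient of w - [wred w] by p: dividing by p undoes Verschiebung (a shift) and Frobenius (a
    p-th power). *)
Definition wtail w : W := Witt p_pr (fun n => rt (wcoord w n.+1)).

Lemma witt_head_tail w : w = teich p_pr (wred w) + p%:R * wtail w.
Proof.
rewrite {1}[w]witt_split witt_mulp //; congr (_ + _).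
by apply: wittP => -[|n] //=; rewrite rtK.
Qed.

Lemma witt_p_inj w : p%:R * w = 0 -> w = 0.
Proof.
rewrite witt_mulp // => /(congr1 (@wcoord _ _ _)) /= w0; apply: wittP => n.
have := congr1 (fun f => f n.+1) w0 => /= e; rewrite [RHS]if_same.
by apply: Ainj; rewrite /= e expr0n eqn0Ngt p0.
Qed.

Lemma wred0_dvd w : wred w = 0 -> exists r, w = p%:R * r.
Proof.
by move=> w0; exists (wtail w); rewrite {1}[w]witt_head_tail w0 add0r.
Qed.

Lemma witt_separated w : (forall n, exists r, w = p%:R ^+ n * r) -> w = 0.
Proof.
move=> h; apply: wittP => n; have [r ->] := h n.+1; rewrite [RHS]if_same.
elim: n {h} r => [|n IH] r; rewrite exprS -mulrA witt_mulp //.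
by rewrite -[LHS]/(wcoord _ n ^+ p) IH expr0n eqn0Ngt p0.
Qed.

(** An explicit choice of Teichmueller digits, the p^n-th roots of the Witt coordinates; [tdigitsE]
    identifies it with the digits selected by [xget] in [tdigits]. *)
Definition digit w n : A := wred (iter n wtail w).

Lemma wcoord_digit w n : wcoord w n = digit w n ^+ (p ^ n).
Proof.
elim: n w => [|n IH] w; first by rewrite expr1.
by rewrite /digit iterSr expnSr exprM -[wred _]/(digit (wtail w) n) -IH /= rtK.
Qed.

Lemma digit_sum w n :
  w = \sum_(i < n) p%:R ^+ i * teich p_pr (digit w i) + p%:R ^+ n * iter n wtail w.
Proof.
elim: n => [|n IH]; first by rewrite big_ord0 add0r expr0 mul1r.
rewrite {1}IH big_ord_recr /= -addrA; congr (_ + _).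
by rewrite {1}[iter n wtail w]witt_head_tail mulrDr exprSr mulrA.
Qed.

Lemma wred_mulp w : wred (p%:R * w) = 0.
Proof. by rewrite rmorphM rmorph_nat (pcharf0 Ap) mul0r. Qed.

Lemma tdigits_head w x : is_tdigits w x -> x 0%N = wred w.
Proof.
move=> h; have [r ->] := h 1%N.
by rewrite big_ord1 expr0 mul1r expr1 rmorphD /= wred_mulp addr0.
Qed.

Lemma tdigits_uniq w x : is_tdigits w x -> x = digit w.
Proof.
move=> h; apply/funext => n; elim: n w x h => [|n IH] w x h.
  exact: tdigits_head h.
have x0 := tdigits_head h.
rewrite /digit iterSr -[RHS]/(digit (wtail w) n).
apply: (IH _ (fun n => x n.+1)) => m.
have [r] := h m.+1; rewrite {1}[w]witt_head_tail big_ord_recl /= expr0 mul1r x0.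
rewrite -addrA => /addrI E; exists r; apply/eqP; rewrite -subr_eq0; apply/eqP.
apply: witt_p_inj; rewrite mulrBr E; apply/eqP; rewrite subr_eq0; apply/eqP.
rewrite mulrDr mulrA -exprS mulr_sumr; congr (_ + _).
by apply: eq_bigr => i _; rewrite /bump add1n exprS mulrA.
Qed.

Lemma tdigitsE w : tdigits w = digit w.
Proof.
rewrite /tdigits; case: xgetP => [x _ /tdigits_uniq //|/(_ (digit w))[]].
by move=> n; exists (iter n wtail w); apply: digit_sum.
Qed.

Lemma witt_digits (d : nat -> A) : exists w, digit w = d.
Proof.
pose v m : W := Witt p_pr (fun k => d (m + k)%N ^+ (p ^ k)).
exists (v 0%N); apply/funext => n.
suff E : iter n wtail (v 0%N) = v n by rewrite /digit E /wred /= addn0 expr1.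
elim: n => [|n IH] //=; rewrite IH; apply: wittP => k /=.
by rewrite expnSr exprM rtX addSnnS.
Qed.

Lemma digit0P w : (forall n, digit w n = 0) -> w = 0.
Proof.
move=> w0; apply: witt_separated => n; exists (iter n wtail w).
rewrite {1}(digit_sum w n) big1 ?add0r // => i _.
by rewrite w0 mulr0.
Qed.

(** The sequence c carries: the reduction of c n is kept as the n-th digit of the sum, and its tail
    is added to the coefficient a (n+1). *)
Lemma witt_complete (a : nat -> W) :
  exists w, forall n, exists r, w = \sum_(i < n) p%:R ^+ i * a i + p%:R ^+ n * r.
Proof.
pose c := fix c n := if n is m.+1 then a n + wtail (c m) else a 0%N.
have [w wd] := witt_digits (fun n => wred (c n)).
have E n : \sum_(i < n) p%:R ^+ i * teich p_pr (wred (c i)) + p%:R ^+ n * c n =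
  \sum_(i < n.+1) p%:R ^+ i * a i.
  elim: n => [|n IH]; first by rewrite big_ord0 big_ord1 add0r.
  rewrite big_ord_recr /= [RHS]big_ord_recr /= -IH {3}[c n]witt_head_tail.
  by rewrite !mulrDr exprSr !mulrA -!addrA; congr (_ + (_ + _)); rewrite addrC.
exists w => -[|n].
  by exists w; rewrite big_ord0 add0r mul1r.
rewrite -E; exists (iter n.+1 wtail w - wtail (c n)).
rewrite {1}(digit_sum w n.+1) wd big_ord_recr /= -!addrA; congr (_ + _).
rewrite {2}[c n]witt_head_tail mulrDr -addrA; congr (_ + _).
by rewrite mulrA -exprSr -mulrDr addrCA subrr addr0.
Qed.

(** If v0 inverts the reduction, then w [v0] = 1 - p y for some y, and the geometric series in p y
    converges p-adically to an inverse. *)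
Lemma witt_unit w : (exists v, wred w * v = 1) -> exists v, w * v = 1.
Proof.
case=> v0 wv0; have : wred (1 - w * teich p_pr v0) = 0.
  by rewrite rmorphB rmorphM rmorph1 /= wred_teich wv0 subrr.
move/wred0_dvd => [y yE].
have [s sE] := witt_complete (fun n => y ^+ n).
exists (teich p_pr v0 * s); apply/eqP; rewrite -subr_eq0; apply/eqP.
apply: witt_separated => n; have [r ->] := sE n.
have -> : \sum_(i < n) p%:R ^+ i * y ^+ i = \sum_(i < n) (p%:R * y) ^+ i.
  by apply: eq_bigr => i _; rewrite exprMn.
rewrite mulrA.
have -> : w * teich p_pr v0 = 1 - p%:R * y by rewrite -yE opprB addrC subrK.
rewrite mulrDr -{1}[1 - p%:R * y]opprB mulNr -subrX1 opprB exprMn.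
exists ((1 - p%:R * y) * r - y ^+ n).
by rewrite addrAC [1 - _ - 1]addrAC subrr add0r mulrBr mulrCA addrC.
Qed.

End Perfect.

Lemma witt_hom_ext (A B : comNzRingType) (Aperf : perfect_ring A)
    (f g : {rmorphism witt p_pr A -> B}) :
  (forall b : B, (forall n, exists c, b = p%:R ^+ n * c) -> b = 0) ->
  (forall x, f (teich p_pr x) = g (teich p_pr x)) -> f =1 g.
Proof.
move=> sep fg w; apply/eqP; rewrite -subr_eq0; apply/eqP/sep => n.
rewrite (digit_sum Aperf w n) !rmorphD !rmorphM !rmorphXn !rmorph_nat /=.
rewrite opprD addrACA -mulrBr !rmorph_sum -sumrB big1 ?add0r; first by eexists.
by move=> i _; rewrite !rmorphM !rmorphXn !rmorph_nat /= fg subrr.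
Qed.

End WittGeneral.
Arguments wred {p p_pr A} w : simpl never.

(** * Analytic fields from their valuation rings *)

Lemma expr_small (R : realType) (q e : R) : 0 <= q -> q < 1 -> 0 < e -> exists n, q ^+ n < e.
Proof.
move=> q0 q1 e0.
have /cvgrPdist_lt /(_ e e0) [n _ /(_ n (leqnn n))] : (fun n => q ^+ n) @ \oo --> (0 : R).
  by apply: cvg_expr; rewrite ger0_norm.
by rewrite /= sub0r normrN ger0_norm ?exprn_ge0 // => h; exists n.
Qed.

(** Serves estimates known only modulo p^n, where the ultrametric inequality leaves the error inside
    a maximum. *)
Lemma le_eps_pow (R : realType) (q a b : R) : 0 <= q -> q < 1 -> 0 <= b ->
  (forall n : nat, a <= Num.max b (q ^+ n)) -> a <= b.
Proof.
move=> q0 q1 b0 h; rewrite leNgt; apply/negP => ba.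
have [m qm] := expr_small q0 q1 (le_lt_trans b0 ba).
by have := h m; rewrite le_max !leNgt ba qm.
Qed.

Lemma rmorph_inverse (A B : comNzRingType) (f : {rmorphism A -> B}) :
  bijective f -> exists g : {rmorphism B -> A}, cancel f g /\ cancel g f.
Proof.
case=> g fK gK; have inj := can_inj fK.
have gB : zmod_morphism g by move=> x y; apply: inj; rewrite rmorphB !gK.
have gM : monoid_morphism g by split=> [|x y]; apply: inj; rewrite ?rmorph1 ?rmorphM !gK.
pose G : {rmorphism B -> A} := HB.pack_for {rmorphism B -> A} g
  (GRing.isZmodMorphism.Build B A g gB) (GRing.isMonoidMorphism.Build B A g gM).
by exists G.
Qed.

Section AnalyticGeneral.
Variables (R : realType) (K : analyticFieldType R).
Implicit Types x y : K.

Lemma anorm0 : anorm (0 : K) = 0. Proof. by apply/eqP; rewrite anorm_eq0. Qed.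

Lemma anorm_0 x : anorm x = 0 -> x = 0.
Proof. by move/eqP; rewrite anorm_eq0 => /eqP. Qed.

Lemma anorm_gt0 x : x != 0 -> 0 < anorm x.
Proof. by move=> x0; rewrite lt_def anorm_eq0 x0 anorm_ge0. Qed.

Lemma anormX x n : anorm (x ^+ n) = anorm x ^+ n.
Proof. by elim: n => [|n IH]; rewrite ?expr0 ?anorm1 // !exprS anormM IH. Qed.

Lemma anormV x : anorm x^-1 = (anorm x)^-1.
Proof.
have [->|x0] := eqVneq x 0; first by rewrite invr0 anorm0 invr0.
apply: (mulfI (_ : anorm x != 0)); first by rewrite anorm_eq0.
by rewrite -anormM !mulfV ?anorm_eq0 // anorm1.
Qed.

Lemma anormB_le x y : anorm (x - y) <= Num.max (anorm x) (anorm y).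
Proof. by rewrite (le_trans (anormD_le _ _)) ?anormN. Qed.

Lemma anormBC x y : anorm (x - y) = anorm (y - x).
Proof. by rewrite -anormN opprB. Qed.

Lemma anorm_trans x y z e : anorm (x - y) <= e -> anorm (y - z) <= e -> anorm (x - z) <= e.
Proof.
move=> xy yz; rewrite -[x](subrK y) -addrA (le_trans (anormD_le _ _)) //.
by rewrite ge_max xy.
Qed.

Lemma anormD_eq x y : anorm y < anorm x -> anorm (x + y) = anorm x.
Proof.
move=> yx; apply/eqP; rewrite eq_le; apply/andP; split.
  by rewrite (le_trans (anormD_le _ _)) // ge_max lexx ltW.
rewrite leNgt; apply/negP => xyx.
have := anormB_le (x + y) y; rewrite addrK leNgt => /negP; apply.
by rewrite gt_max xyx.
Qed.

Lemma norm_cvg_uniq u l l' :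
  norm_cvg (@anorm R K) u l -> norm_cvg (@anorm R K) u l' -> l = l'.
Proof.
move=> ul ul'; apply/eqP; rewrite -subr_eq0; apply/negPn/negP => ll.
have e0 := anorm_gt0 ll; have [n nl] := ul _ e0; have [m ml] := ul' _ e0.
have := nl _ (leq_maxl n m); have := ml _ (leq_maxr n m).
set v := u _ => h h'; have := anormB_le (v - l') (v - l).
have -> : (v - l') - (v - l) = l - l' by ring.
by rewrite leNgt gt_max h h'.
Qed.

Lemma norm_limE u l : norm_cvg (@anorm R K) u l -> norm_lim (@anorm R K) u = l.
Proof.
move=> ul; rewrite /norm_lim; case: xgetP => [x -> h|/(_ l) //].
exact: norm_cvg_uniq h ul.
Qed.

Lemma oring_le1 (x : oring K) : anorm (oval x) <= 1. Proof. exact: ovalP x. Qed.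

Lemma oring_dvd (x y : oring K) : anorm (oval x) <= anorm (oval y) -> exists c, x = c * y.
Proof.
have [y0|y0] := eqVneq (oval y) 0.
  rewrite y0 anorm0 => x0; exists 0; apply: val_inj; rewrite /= mul0r.
  by apply: anorm_0; apply/eqP; rewrite eq_le x0 anorm_ge0.
move=> xy; have h : oval x / oval y \in @integer R K.
  by rewrite unfold_in anormM anormV ler_pdivrMr ?anorm_gt0 // mul1r.
by exists (OInt h); apply: val_inj; rewrite /= divfK.
Qed.

Lemma oring_unit (x : oring K) : anorm (oval x) = 1 -> exists c, x * c = 1.
Proof.
move=> x1; have [|c ->] := @oring_dvd 1 x; first by rewrite x1 anorm1.
by exists c; rewrite mulrC.
Qed.

(** The ultrametric inequality turns the bound on consecutive terms into one on all later terms, and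
    the closed balls keep the rate r^n in the limit. *)
Lemma oring_complete (r : R) (u : nat -> oring K) : 0 < r -> r < 1 ->
  (forall n, anorm (oval (u n.+1) - oval (u n)) <= r ^+ n) ->
  exists t : oring K, forall n, anorm (oval t - oval (u n)) <= r ^+ n.
Proof.
move=> r0 r1 uS.
have uD n k : anorm (oval (u (n + k)%N) - oval (u n)) <= r ^+ n.
  elim: k => [|k IH]; first by rewrite addn0 subrr anorm0 exprn_ge0 ?ltW.
  rewrite addnS; apply: anorm_trans IH; apply: le_trans (uS _) _.
  by rewrite ler_wiXn2l ?leq_addr // ltW.
have [|l lP] := @anorm_complete R K (fun n => oval (u n)).
  move=> e /(expr_small (ltW r0) r1) [n rn]; exists n => a b na nb.
  rewrite (le_lt_trans _ rn) // -(subnKC na) -(subnKC nb).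
  by apply: (anorm_trans (uD _ _)); rewrite anormBC uD.
have lu n : anorm (l - oval (u n)) <= r ^+ n.
  have [m mP] := lP (r ^+ n) (exprn_gt0 _ r0).
  apply: (@anorm_trans _ (oval (u (n + m)%N))); last exact: uD.
  by rewrite anormBC ltW // mP // leq_addl.
have lO : l \in @integer R K.
  rewrite unfold_in -[l](subrK (oval (u 0%N))) (le_trans (anormD_le _ _)) //.
  by rewrite ge_max oring_le1 (le_trans (lu 0%N)).
by exists (OInt lO).
Qed.

Lemma oring_unit_norm (x y : oring K) : x * y = 1 -> anorm (oval x) = 1.
Proof.
move=> /(congr1 (fun z => anorm (oval z))); rewrite /= anormM anorm1 => xy.
by apply/eqP; rewrite eq_le oring_le1 /= -{1}xy ler_piMr ?anorm_ge0 ?oring_le1.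
Qed.
End AnalyticGeneral.

(** * Extending isometries from valuation rings to fields *)

Section Extension.
Variables (R : realType) (A : comNzRingType) (K L : analyticFieldType R).
Variables (e : {rmorphism A -> K}) (e_surj : forall x, anorm x <= 1 -> exists a, e a = x).

Let quotient_ex (x : K) : exists ab : A * A, e ab.2 != 0 /\ x = e ab.1 / e ab.2.
Proof.
have [x1|x1] := leP (anorm x) 1.
  have [a <-] := e_surj x1; exists (a, 1).
  by rewrite /= rmorph1 oner_neq0 divr1.
have x0 : x != 0 by rewrite -anorm_eq0 gt_eqF // (lt_trans ltr01).
have [|b bx] := e_surj (_ : anorm x^-1 <= 1).
  by rewrite anormV invf_le1 ?ltW // (lt_trans ltr01).
by exists (1, b); rewrite /= bx invr_neq0 // rmorph1 invrK mul1r.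
Qed.

Lemma isometric_hom_uniq (f g : isometric_hom K L) :
  (forall a, f (e a) = g (e a)) -> f =1 g.
Proof.
move=> fg x; have [[a b] /= [_ ->]] := quotient_ex x.
by rewrite !fmorph_div /= !fg.
Qed.

(** The map [e] may have a kernel, as the maps out of W(o_F) do. Equality of norms makes [phi]
    vanish on it, so phi a / phi b depends only on e a / e b. *)
Lemma isometric_hom_ex (phi : {rmorphism A -> L}) :
  (forall a, anorm (phi a) = anorm (e a)) ->
  exists f : isometric_hom K L, forall a, f (e a) = phi a.
Proof.
move=> ephi; have [ab abP] := choice quotient_ex.
pose f x := phi (ab x).1 / phi (ab x).2.
have nz b : e b != 0 -> phi b != 0 by rewrite -!anorm_eq0 ephi.
have phi0 a : e a = 0 -> phi a = 0 by move=> a0; apply: anorm_0; rewrite ephi a0 anorm0.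
have fE a b : e b != 0 -> f (e a / e b) = phi a / phi b.
  move=> b0; have [] := abP (e a / e b); rewrite /f; set c := ab _ => c0 E.
  apply/eqP; rewrite eqr_div ?nz // -subr_eq0 -!rmorphM -rmorphB; apply/eqP/phi0.
  rewrite rmorphB !rmorphM; apply/eqP; rewrite subr_eq0 -eqr_div //.
  by rewrite E.
have fea a : f (e a) = phi a by rewrite -[e a]divr1 -(rmorph1 e) fE ?rmorph1 ?oner_neq0 ?divr1.
have fB : zmod_morphism f.
  move=> x y; have [[a b] /= [b0 ->]] := quotient_ex x; have [[c d] /= [d0 ->]] := quotient_ex y.
  rewrite -mulNr addf_div // -rmorphN -!rmorphM -rmorphD !fE //; last first.
    by rewrite rmorphM mulf_neq0.
  by rewrite rmorphD !rmorphM rmorphN -addf_div ?nz // mulNr.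
have fM : monoid_morphism f.
  split=> [|x y]; first by rewrite -(rmorph1 e) fea rmorph1.
  have [[a b] /= [b0 ->]] := quotient_ex x; have [[c d] /= [d0 ->]] := quotient_ex y.
  by rewrite mulf_div -!rmorphM !fE ?rmorphM ?mulf_neq0 // mulf_div.
suff fN x : anorm (f x) = anorm x by exists (IsometricHom fB fM fN).
have [[a b] /= [b0 ->]] := quotient_ex x.
by rewrite fE // !anormM !anormV !ephi.
Qed.

Section IntegerLift.
Hypothesis e_le1 : forall a, anorm (e a) <= 1.

Definition integer_lift (a : A) : oring K := OInt (e_le1 a : e a \in @integer R K).

Lemma integer_lift_zmod : zmod_morphism integer_lift.
Proof. by move=> x y; apply: val_inj; rewrite /= rmorphB. Qed.
Lemma integer_lift_monoid : monoid_morphism integer_lift.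
Proof. by split=> [|x y]; apply: val_inj; rewrite /= ?rmorph1 ?rmorphM. Qed.
HB.instance Definition _ :=
  GRing.isZmodMorphism.Build A (oring K) integer_lift integer_lift_zmod.
HB.instance Definition _ :=
  GRing.isMonoidMorphism.Build A (oring K) integer_lift integer_lift_monoid.

Lemma integer_lift_bij : injective e -> bijective integer_lift.
Proof.
move=> e_inj; have [g gP] := choice (fun x : oring K => e_surj (oring_le1 x)).
exists g => x; first by apply: e_inj; rewrite gP.
by apply: val_inj; rewrite /= gP.
Qed.
End IntegerLift.
End Extension.

(* The data of the valuation ring of an analytic field. *)
Record normed_ring (R : realType) := NormedRing {
  nring :> comNzRingType;
  nnorm : nring -> R;
  nnorm_ge0 : forall x, 0 <= nnorm x;
  nnorm_0 : forall x, nnorm x = 0 -> x = 0;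
  nnormM : forall x y, nnorm (x * y) = nnorm x * nnorm y;
  nnormD_le : forall x y, nnorm (x + y) <= Num.max (nnorm x) (nnorm y);
  nnorm_le1 : forall x, nnorm x <= 1;
  nnorm_neq0 : exists x, nnorm x != 0;
  nnorm_dvd : forall x y, nnorm x <= nnorm y -> exists c, x = c * y;
  nnorm_complete : forall u, norm_cauchy nnorm u -> exists l, norm_cvg nnorm u l
}.

(** * The complete fraction field of a normed ring *)

Section FractionField.
Variables (R : realType) (A : normed_ring R).

(** An alias of A that receives the integral domain structure required by [{fraction _}]; units and
    inverses are chosen classically. *)
Definition ndomain : Type := A.
HB.instance Definition _ := GRing.ComNzRing.on ndomain.

Let N (x : ndomain) : R := nnorm x.

Let N1 : N 1 = 1.
Proof.
have [x x0] := nnorm_neq0 A.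
by apply: (mulfI x0); rewrite -nnormM !mulr1.
Qed.

Let N0 : N 0 = 0.
Proof.
have : N 0 * (1 - N 0) = 0 by rewrite mulrBr mulr1 -nnormM mulr0 subrr.
move/eqP; rewrite mulf_eq0 subr_eq0 => /orP[/eqP//|/eqP e1].
(* The norm of 0 is idempotent, hence 0 or 1; if it were 1 = |1|, divisibility would give 1 = c *
   0. *)
have : (0 : ndomain) = 1.
  have [|c /= ->] := @nnorm_dvd R A 1 0; last by rewrite mulr0.
  by rewrite -[nnorm 1]/(N 1) -[nnorm 0]/(N 0) N1 -e1.
by move/eqP; rewrite eq_sym oner_eq0.
Qed.

Let ndomain_unit : {pred ndomain} := fun x => `[< exists y, y * x = 1 >].
Let ndomain_inv (x : ndomain) : ndomain :=
  if pselect (exists y, y * x = 1) is left h then sval (cid h) else x.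
Let ndomain_mulV : {in ndomain_unit, left_inverse 1 ndomain_inv *%R}.
Proof.
move=> x /asboolP h; rewrite /ndomain_inv; case: pselect => // h'.
exact: (svalP (cid h')).
Qed.
Let ndomain_unitP : forall x y, y * x = 1 -> ndomain_unit x.
Proof. by move=> x y xy; apply/asboolP; exists y. Qed.
Let ndomain_inv_out : {in [predC ndomain_unit], ndomain_inv =1 id}.
Proof.
move=> x /= /asboolPn h; rewrite /ndomain_inv.
by case: pselect.
Qed.
HB.instance Definition _ := GRing.ComNzRing_hasMulInverse.Build ndomain
  ndomain_mulV ndomain_unitP ndomain_inv_out.

Let ndomain_integral : GRing.integral_domain_axiom ndomain.
Proof.
move=> x y xy; have : N x * N y = 0 by rewrite -nnormM -[nnorm _]/(N (x * y)) xy N0.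
move/eqP; rewrite mulf_eq0 => /orP[] /eqP /nnorm_0 ->; rewrite eqxx ?orbT //.
Qed.
HB.instance Definition _ := GRing.ComUnitRing_isIntegral.Build ndomain ndomain_integral.

Definition nfrac : Type := {fraction ndomain}.
HB.instance Definition _ := GRing.Field.on nfrac.

Definition nfrac_emb (x : A) : nfrac := FracField.tofrac (x : ndomain).

Lemma nfrac_emb_zmod : zmod_morphism nfrac_emb.
Proof. by move=> x y; rewrite /nfrac_emb -[RHS]rmorphB. Qed.
Lemma nfrac_emb_monoid : monoid_morphism nfrac_emb.
Proof.
split=> [|x y]; first exact: (rmorph1 (@FracField.tofrac ndomain)).
exact: (rmorphM (@FracField.tofrac ndomain)).
Qed.
HB.instance Definition _ :=
  GRing.isZmodMorphism.Build A nfrac nfrac_emb nfrac_emb_zmod.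
HB.instance Definition _ :=
  GRing.isMonoidMorphism.Build A nfrac nfrac_emb nfrac_emb_monoid.

Lemma nfrac_emb_eq0 x : (nfrac_emb x == 0) = (x == 0).
Proof. exact: tofrac_eq0. Qed.

Lemma nfrac_quotient (x : nfrac) :
  exists ab : A * A, ab.2 != 0 /\ x = nfrac_emb ab.1 / nfrac_emb ab.2.
Proof.
elim/quotW: x => r; exists (frac r); split; first exact: denom_ratioP.
rewrite /nfrac_emb; unlock FracField.tofrac.
rewrite -[X in _ * X]FracField.pi_inv -[RHS]FracField.pi_mul.
rewrite /FracField.mulf /FracField.invf /= !numden_Ratio ?oner_neq0 ?denom_ratioP //.
by rewrite mulr1 mul1r Ratio_numden.
Qed.

Let num x := (sval (cid (nfrac_quotient x))).1.
Let den x := (sval (cid (nfrac_quotient x))).2.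
Let den0 x : den x != 0. Proof. by have [] := svalP (cid (nfrac_quotient x)). Qed.
Let numden x : x = nfrac_emb (num x) / nfrac_emb (den x).
Proof. by have [] := svalP (cid (nfrac_quotient x)). Qed.

Definition nfrac_norm (x : nfrac) : R := N (num x) / N (den x).

Let Neq0 x : (N x == 0) = (x == 0).
Proof. by apply/eqP/eqP => [/nnorm_0 //|->]. Qed.

Let normE a b : b != 0 -> nfrac_norm (nfrac_emb a / nfrac_emb b) = N a / N b.
Proof.
move=> b0; pose x := nfrac_emb a / nfrac_emb b; rewrite -/x /nfrac_norm.
have := numden x; rewrite {1}/x => /eqP.
rewrite eqr_div ?nfrac_emb_eq0 // -!rmorphM -subr_eq0 -rmorphB nfrac_emb_eq0 subr_eq0.
move=> /eqP E; apply/eqP; rewrite eqr_div ?Neq0 // -!nnormM.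
by rewrite -[nnorm _]/(N (num x * b)) -E mulrC.
Qed.

Lemma nfrac_norm_emb a : nfrac_norm (nfrac_emb a) = nnorm a.
Proof.
by rewrite -[nfrac_emb a]divr1 -(rmorph1 nfrac_emb) normE ?oner_neq0 // N1 divr1.
Qed.

Let norm_ge0 x : 0 <= nfrac_norm x.
Proof. by rewrite /nfrac_norm divr_ge0 ?nnorm_ge0. Qed.

Let norm_eq0 x : (nfrac_norm x == 0) = (x == 0).
Proof.
rewrite [in RHS](numden x) /nfrac_norm !mulf_eq0 !invr_eq0 !nfrac_emb_eq0 !Neq0.
by rewrite (negPf (den0 x)).
Qed.

Let normM x y : nfrac_norm (x * y) = nfrac_norm x * nfrac_norm y.
Proof.
have [[a b] /= [b0 ->]] := nfrac_quotient x; have [[c d] /= [d0 ->]] := nfrac_quotient y.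
have bd : b * d != 0 by rewrite -Neq0 /N nnormM mulf_neq0 ?Neq0.
by rewrite mulf_div -!rmorphM !normE // /N !nnormM mulf_div.
Qed.

Let normD_le x y : nfrac_norm (x + y) <= Num.max (nfrac_norm x) (nfrac_norm y).
Proof.
have [[a b] /= [b0 ->]] := nfrac_quotient x; have [[c d] /= [d0 ->]] := nfrac_quotient y.
have bd : b * d != 0 by rewrite -Neq0 /N nnormM mulf_neq0 ?Neq0.
have gt0 z : z != 0 -> 0 < N z by move=> z0; rewrite lt_def Neq0 z0 nnorm_ge0.
rewrite addf_div ?nfrac_emb_eq0 // -!rmorphM -rmorphD !normE //.
have -> : N a / N b = N (a * d) / N (b * d).
  by rewrite /N !nnormM -mulf_div divff ?mulr1 // Neq0.
have -> : N c / N d = N (c * b) / N (b * d).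
  by rewrite /N !nnormM [nnorm b * nnorm d]mulrC -mulf_div divff ?mulr1 // Neq0.
rewrite -maxr_pMl ?invr_ge0 ?nnorm_ge0 // ler_wpM2r ?invr_ge0 ?nnorm_ge0 //.
exact: nnormD_le.
Qed.

Let norm_surj x : nfrac_norm x <= 1 -> exists a, nfrac_emb a = x.
Proof.
rewrite [x]numden normE ?den0 // ler_pdivrMr; last by rewrite lt_def Neq0 den0 nnorm_ge0.
rewrite mul1r => /nnorm_dvd [c ->]; exists c.
by rewrite rmorphM mulfK // nfrac_emb_eq0.
Qed.

(** Past n0 the sequence stays within distance 1 of u n0, so its difference with u n0 comes from A,
    where limits exist. *)
Let norm_complete u : norm_cauchy nfrac_norm u -> exists l, norm_cvg nfrac_norm u l.
Proof.
move=> uC; have [n0 n0P] := uC _ ltr01.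
have [v vP] : exists v, forall n, nfrac_emb (v n) = u (n0 + n)%N - u n0.
  suff h n : exists a, nfrac_emb a = u (n0 + n)%N - u n0 by have [v vP] := choice h; exists v.
  by apply: norm_surj; rewrite ltW // n0P // leq_addr.
have vE m n : nnorm (v m - v n) = nfrac_norm (u (n0 + m)%N - u (n0 + n)%N).
  by rewrite -nfrac_norm_emb rmorphB /= !vP opprB addrA subrK.
have [|l lP] := @nnorm_complete R A v.
  move=> eps /uC [n1 n1P]; exists n1 => m n hm hn.
  by rewrite vE n1P // (leq_trans _ (leq_addl _ _)).
exists (nfrac_emb l + u n0) => eps /lP [n1 n1P]; exists (n0 + n1)%N => n hn.
have := n1P (n - n0)%N; rewrite leq_subRL ?(leq_trans (leq_addr _ _) hn) // => /(_ hn).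
rewrite -nfrac_norm_emb rmorphB /= vP subnKC ?(leq_trans (leq_addr _ _) hn) //.
by rewrite opprD addrA addrAC.
Qed.

HB.instance Definition _ := isAnalyticField.Build R nfrac
  norm_ge0 norm_eq0 normM normD_le norm_complete.

Lemma anorm_emb a : anorm (nfrac_emb a : nfrac) = nnorm a.
Proof. exact: nfrac_norm_emb. Qed.

Lemma nfrac_emb_surj (x : nfrac) : anorm x <= 1 -> exists a, nfrac_emb a = x.
Proof. exact: norm_surj. Qed.

Lemma nfrac_emb_le1 a : anorm (nfrac_emb a : nfrac) <= 1.
Proof. by rewrite anorm_emb nnorm_le1. Qed.

Lemma nfrac_emb_inj : injective nfrac_emb.
Proof.
move=> x y /eqP; rewrite -subr_eq0 -rmorphB nfrac_emb_eq0 subr_eq0.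
by move=> /eqP.
Qed.
End FractionField.

(** * The norm on the tilt *)

Notation cong := WittPolynomials.cong.

Lemma ideal_gen1 (A : comPzRingType) (a x : A) :
  ideal_gen [set a] x <-> exists c, x = c * a.
Proof.
split=> [h|[c ->]].
  apply: (h [set x | exists c, x = c * a]); split; last by move=> _ ->; exists 1; rewrite mul1r.
  split=> [|_ _ [b ->] [c ->]|b _ [c ->]].
  - by exists 0; rewrite mul0r.
  - by exists (b + c); rewrite mulrDl.
  - by exists (b * c); rewrite mulrA.
by have [_ _] := ideal_genP [set a]; apply; apply: sub_gen_smallest.
Qed.

Section MixedField.
Variables (R : realType) (p : nat) (K : mixedFieldType R p).
Let p_pr : prime p := @prime_residue R p K.
Let p0 : (0 < p)%N := prime_gt0 p_pr.
Let q : R := p%:R^-1.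
Let q0 : 0 < q. Proof. by rewrite invr_gt0 ltr0n. Qed.
Let q1 : q < 1. Proof. by rewrite invf_lt1 ?ltr1n ?ltr0n ?prime_gt1. Qed.
Let q0' : 0 <= q := ltW q0.
Implicit Types x y : oring K.

Lemma oval_nat n : oval (n%:R : oring K) = n%:R.
Proof. exact: (rmorph_nat (\val : oring K -> K)). Qed.

Lemma oval_sum (F : nat -> oring K) n : oval (\sum_(i < n) F i) = \sum_(i < n) oval (F i).
Proof. exact: (rmorph_sum (\val : oring K -> K)). Qed.

Lemma ovalX x n : oval (x ^+ n) = oval x ^+ n.
Proof. exact: (rmorphXn (\val : oring K -> K)). Qed.

Lemma anorm_pX k : anorm (p%:R ^+ k : K) = q ^+ k.
Proof. by rewrite anormX anorm_p. Qed.

Lemma congP k x y : cong p k x y <-> anorm (oval x - oval y) <= q ^+ k.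
Proof.
split=> [[z ->]|h].
  rewrite /= addrAC subrr add0r anormM ovalX oval_nat anorm_pX.
  by rewrite ler_piMr ?exprn_ge0 ?oring_le1.
have [|z zE] := @oring_dvd R K (x - y) (p%:R ^+ k).
  by rewrite ovalX oval_nat anorm_pX.
by exists z; rewrite mulrC -zE addrC subrK.
Qed.

Lemma cong_le j k x y : (j <= k)%N -> cong p k x y -> cong p j x y.
Proof.
by move=> jk [z ->]; exists (p%:R ^+ (k - j) * z); rewrite mulrA -exprD subnKC.
Qed.

Lemma cong_eq x y : (forall n, cong p n x y) -> x = y.
Proof.
move=> h; apply: val_inj => /=; apply/eqP; rewrite -subr_eq0 -anorm_eq0.
rewrite eq_le anorm_ge0 andbT; apply: (le_eps_pow q0' q1) => // n.
by rewrite le_max (iffLR (congP n x y) (h n)) orbT.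
Qed.

Lemma oring_separated x : (forall n, exists z, x = p%:R ^+ n * z) -> x = 0.
Proof. by move=> h; apply: cong_eq => n; have [z ->] := h n; exists z; rewrite add0r. Qed.

Lemma oring_p_inj x : p%:R * x = 0 -> x = 0.
Proof.
move=> /(congr1 (@oval R K)); rewrite /= oval_nat => /eqP; rewrite mulf_eq0 -anorm_eq0 anorm_p.
by rewrite gt_eqF //= => /eqP x0; apply: val_inj.
Qed.

Lemma norm_cvg_cong (u : nat -> oring K) t :
  (forall n, cong p n t (u n)) -> norm_cvg (@anorm R K) (fun n => oval (u n)) (oval t).
Proof.
move=> h e /(expr_small q0' q1) [n qn]; exists n => m nm.
rewrite anormBC (le_lt_trans _ qn) //; apply: le_trans (iffLR (congP m _ _) (h m)) _.
by rewrite ler_wiXn2l ?ltW.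
Qed.

Lemma oring_padic_complete (u : nat -> oring K) :
  (forall n, cong p n (u n.+1) (u n)) -> exists t, forall n, cong p n t (u n).
Proof.
move=> uS; have [|t tP] := oring_complete q0 q1 (u := u).
  by move=> n; apply/congP.
by exists t => n; apply/congP.
Qed.

Lemma to_modp_zmod : zmod_morphism (@to_modp R p K).
Proof. exact: qclassB. Qed.
Lemma to_modp_monoid : monoid_morphism (@to_modp R p K).
Proof. by split=> [|x y]; rewrite // /to_modp qclassM. Qed.
HB.instance Definition _ :=
  GRing.isZmodMorphism.Build (oring K) (modp K) (@to_modp R p K) to_modp_zmod.
HB.instance Definition _ :=
  GRing.isMonoidMorphism.Build (oring K) (modp K) (@to_modp R p K) to_modp_monoid.

Lemma to_modpP x y : to_modp x = to_modp y <-> cong p 1 x y.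
Proof.
split=> [/qclassP/ideal_gen1[c]|[z ->]].
  by move=> h; exists c; rewrite expr1 mulrC -h addrC subrK.
by apply/qclassP/ideal_gen1; exists z; rewrite addrAC subrr add0r expr1 mulrC.
Qed.

Lemma to_modp_repr (c : modp K) : to_modp (repr c) = c.
Proof. exact: reprK. Qed.

End MixedField.

Section Tilt.
Variables (R : realType) (p : nat) (K : mixedFieldType R p).
Let p_pr : prime p := @prime_residue R p K.
Let p0 : (0 < p)%N := prime_gt0 p_pr.
Let q : R := p%:R^-1.
Let q0 : 0 < q. Proof. by rewrite invr_gt0 ltr0n. Qed.
Let q1 : q < 1. Proof. by rewrite invf_lt1 ?ltr1n ?ltr0n ?prime_gt1. Qed.
Let q0' : 0 <= q := ltW q0.
Implicit Types x y : tilt_ring K.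

Lemma tilt_eq x y : tseq x =1 tseq y -> x = y.
Proof. by move=> /funext xy; apply: val_inj. Qed.

Let tval : {rmorphism tilt_ring K -> nat -> modp K} := \val.
Let tvalE x : tseq x = tval x. Proof. by []. Qed.

Lemma tseqB x y n : tseq (x - y) n = tseq x n - tseq y n.
Proof. by rewrite !tvalE (rmorphB tval). Qed.
Lemma tseqD x y n : tseq (x + y) n = tseq x n + tseq y n.
Proof. by rewrite !tvalE (rmorphD tval). Qed.
Lemma tseqM x y n : tseq (x * y) n = tseq x n * tseq y n.
Proof. by rewrite !tvalE (rmorphM tval). Qed.
Lemma tseq1 n : tseq (1 : tilt_ring K) n = 1.
Proof. by rewrite !tvalE (rmorph1 tval). Qed.
Lemma tseq0 n : tseq (0 : tilt_ring K) n = 0.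
Proof. by rewrite !tvalE (rmorph0 tval). Qed.
Lemma tseqX x k n : tseq (x ^+ k) n = tseq x n ^+ k.
Proof.
elim: k => [|k IH]; first by rewrite expr0 tseq1.
by rewrite (exprS x) tseqM IH -exprS.
Qed.

Lemma tseqS x n : tseq x n.+1 ^+ p = tseq x n.
Proof. by have := tseqP x; rewrite unfold_in => /asboolP. Qed.

Lemma troot_subproof x : (fun n => tseq x n.+1) \in @frob_compatible R p K.
Proof. by rewrite unfold_in; apply/asboolP => n; rewrite tseqS. Qed.
Definition troot x : tilt_ring K := Tilt (troot_subproof x).

Lemma trootK x : troot x ^+ p = x.
Proof. by apply: tilt_eq => n; rewrite tseqX tseqS. Qed.

Lemma tseq_iter_troot x n k : tseq (iter n troot x) k = tseq x (k + n)%N.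
Proof. by elim: n k => [|n IH] k; rewrite ?addn0 //= IH addSnnS. Qed.

Lemma iter_trootK x n : iter n troot x ^+ (p ^ n) = x.
Proof.
elim: n => [|n IH]; first by rewrite expr1.
by rewrite expnS exprM /= trootK.
Qed.

Lemma tilt_perfect : perfect_ring p (tilt_ring K).
Proof.
split.
- rewrite inE p_pr; apply/eqP/tilt_eq => n.
  have E k : tseq (k%:R : tilt_ring K) n = k%:R.
    by elim: k => [|k IH]; rewrite ?tseq0 // !mulrS tseqD IH tseq1.
  by rewrite E tseq0 (pcharf0 (modp_pchar K)).
- move=> x y xy; apply: tilt_eq => n; rewrite -(tseqS x n) -(tseqS y n).
  by rewrite -!tseqX /= in xy *; rewrite xy.
- by move=> x; exists (troot x); rewrite trootK.
Qed.

(** The p^n-th powers of two elements congruent modulo p agree modulo p^(n+1); this gives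
    convergence and independence of the lifts at once. The explicit rate, valid for every lift, is
    what later identities are checked against. *)
Lemma theta_ex x : exists t : oring K,
  forall n l, to_modp l = tseq x n -> cong p n.+1 t (l ^+ (p ^ n)).
Proof.
pose u n := repr (tseq x n) ^+ (p ^ n).
have lift n k l : to_modp l = tseq x n -> cong p k.+1 (l ^+ (p ^ k)) (repr (tseq x n) ^+ (p ^ k)).
  by move=> E; apply/WittPolynomials.cong_exppX/to_modpP; rewrite E to_modp_repr.
have uS n : cong p n.+1 (u n.+1) (u n).
  rewrite /u expnS exprM; apply: lift.
  by rewrite rmorphXn /= to_modp_repr tseqS.
(* Prepending 0 shifts the index, so that the limit agrees with u n modulo p^(n+1) and not merely
   modulo p^n. *)
have [|t tP] := @oring_padic_complete R p K (fun n => if n is m.+1 then u m else 0).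
  by case=> [|n]; [exists (u 0%N); rewrite add0r mul1r | apply: uS].
exists t => n l ln; apply: WittPolynomials.cong_trans (tP n.+1) _.
exact/WittPolynomials.cong_sym/lift.
Qed.

Definition otheta x : oring K := sval (cid (theta_ex x)).

Lemma otheta_cong x n l : to_modp l = tseq x n -> cong p n.+1 (otheta x) (l ^+ (p ^ n)).
Proof. exact: (svalP (cid (theta_ex x))). Qed.

Lemma thetaE x : theta x = oval (otheta x).
Proof.
apply: norm_limE; under [X in norm_cvg _ X]funext do rewrite -ovalX.
apply: norm_cvg_cong => n; apply: (cong_le (leqnSn n)); apply: otheta_cong.
exact: to_modp_repr.
Qed.

Lemma otheta_uniq x t :
  (forall n, exists2 l, to_modp l = tseq x n & cong p n.+1 t (l ^+ (p ^ n))) ->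
  otheta x = t.
Proof.
move=> h; apply: cong_eq => n; apply: (cong_le (leqnSn n)).
have [l ln tl] := h n; apply: WittPolynomials.cong_trans (otheta_cong ln) _.
exact: WittPolynomials.cong_sym.
Qed.

Lemma othetaM x y : otheta (x * y) = otheta x * otheta y.
Proof.
apply: otheta_uniq => n; exists (repr (tseq x n) * repr (tseq y n)).
  by rewrite tseqM rmorphM /= !to_modp_repr.
by rewrite exprMn; apply: WittPolynomials.congM; apply: otheta_cong; rewrite to_modp_repr.
Qed.

Lemma otheta1 : otheta 1 = 1.
Proof.
apply: otheta_uniq => n; exists 1; first by rewrite rmorph1 tseq1.
by rewrite expr1n; apply: WittPolynomials.cong_refl.
Qed.

Lemma othetaX x n : otheta (x ^+ n) = otheta x ^+ n.
Proof. by elim: n => [|n IH]; rewrite ?expr0 ?otheta1 // !exprS othetaM IH. Qed.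

Lemma otheta_iter_troot x n : otheta (iter n troot x) ^+ (p ^ n) = otheta x.
Proof. by rewrite -othetaX iter_trootK. Qed.

(** Thus theta(x^(1/p^n)) is a canonical lift of x_n, and these lifts form a system of p-power roots
    in o_K. Conversely, [tilt_of_roots] turns such a system into an element of the tilt. *)
Lemma tseq_otheta x n : to_modp (otheta (iter n troot x)) = tseq x n.
Proof.
rewrite -[tseq x n]to_modp_repr; apply/to_modpP.
have := @otheta_cong (iter n troot x) 0 (repr (tseq x n)).
by rewrite expn0 expr1; apply; rewrite tseq_iter_troot to_modp_repr add0n.
Qed.

Lemma tseq0_otheta x : to_modp (otheta x) = tseq x 0.
Proof. exact: (tseq_otheta x 0). Qed.

Lemma root_seq_subproof (c : nat -> oring K) : (forall n, c n.+1 ^+ p = c n) ->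
  (fun n => to_modp (c n)) \in @frob_compatible R p K.
Proof. by move=> cP; rewrite unfold_in; apply/asboolP => n; rewrite -(cP n) rmorphXn. Qed.
Definition tilt_of_roots c cP : tilt_ring K := Tilt (@root_seq_subproof c cP).

Definition tnorm x : R := anorm (oval (otheta x)).

Lemma tnorm_iter_troot x n : tnorm (iter n troot x) ^+ (p ^ n) = tnorm x.
Proof. by rewrite /tnorm -anormX -ovalX otheta_iter_troot. Qed.

Lemma tnormM x y : tnorm (x * y) = tnorm x * tnorm y.
Proof. by rewrite /tnorm othetaM anormM. Qed.

Lemma tnorm_ge0 x : 0 <= tnorm x. Proof. exact: anorm_ge0. Qed.
Lemma tnorm_le1 x : tnorm x <= 1. Proof. exact: oring_le1. Qed.

Lemma to_modp0P (a : oring K) : to_modp a = 0 <-> anorm (oval a) <= q.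
Proof.
have := to_modpP a 0; have := congP 1 a 0; rewrite rmorph0 /= subr0 expr1 => h1 h2.
by split=> [/h2/h1|/h1/h2].
Qed.

(** The term x_n is the reduction of theta(x^(1/p^n)), whose norm is the p^n-th root of |x|'. Hence
    closeness in norm means agreement of an initial term, and Cauchy sequences stabilise
    termwise. *)
Lemma tseq_eq0 x n : tseq x n = 0 <-> tnorm x <= q ^+ (p ^ n).
Proof.
rewrite -tseq_otheta -(tnorm_iter_troot x n) ler_pXn2r ?nnegrE ?tnorm_ge0 //.
  exact: to_modp0P.
by rewrite expn_gt0 p0.
Qed.

Lemma tnorm_0 x : tnorm x = 0 -> x = 0.
Proof.
by move=> x0; apply: tilt_eq => n; rewrite tseq0; apply/tseq_eq0; rewrite x0 exprn_ge0.
Qed.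

(** Although theta is not additive, theta(x + y) is congruent to (a + b)^(p^n) modulo p^(n+1), where
    a and b are the values of theta at the p^n-th roots of x and y; the norm of this power obeys the
    ultrametric bound for every n. *)
Lemma tnormD_le x y : tnorm (x + y) <= Num.max (tnorm x) (tnorm y).
Proof.
apply: (le_eps_pow q0' q1); first by rewrite le_max tnorm_ge0.
move=> n; pose a := otheta (iter n troot x); pose b := otheta (iter n troot y).
have : cong p n.+1 (otheta (x + y)) ((a + b) ^+ (p ^ n)).
  by apply: otheta_cong; rewrite tseqD rmorphD /= !tseq_otheta.
move/(cong_le (leqnSn n))/congP => h.
rewrite {1}/tnorm -[oval (otheta (x + y))](subrK (oval ((a + b) ^+ (p ^ n)))).
apply: le_trans (anormD_le _ _) _; rewrite maxC ge_max !le_max h orbT andbT.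
have mono (s t : R) : 0 <= s -> s <= t -> s ^+ (p ^ n) <= t ^+ (p ^ n).
  by move=> s0 st; rewrite ler_pXn2r ?expn_gt0 ?p0 ?nnegrE // (le_trans s0).
rewrite -(tnorm_iter_troot x n) -(tnorm_iter_troot y n) ovalX anormX.
have := anormD_le (oval a) (oval b); rewrite le_max => /orP[] ab.
  by rewrite (mono _ _ (anorm_ge0 _) ab).
by rewrite (mono _ _ (anorm_ge0 _) ab) orbT.
Qed.

(** The quotients of theta(x^(1/p^n)) by theta(y^(1/p^n)) lie in o_K. Cancelling the nonzero
    denominators shows that they are compatible under p-th powers, so they define an element of the
    tilt. *)
Lemma tnorm_dvd x y : tnorm x <= tnorm y -> exists c, x = c * y.
Proof.
move=> xy; have [y0|y0] := eqVneq (tnorm y) 0.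
  exists 0; rewrite mul0r; apply: tnorm_0; apply/eqP.
  by rewrite eq_le tnorm_ge0 -y0 xy.
have y0n n : oval (otheta (iter n troot y)) != 0.
  rewrite -anorm_eq0; apply: contraNneq y0 => e.
  by rewrite -(tnorm_iter_troot y n) /tnorm e expr0n expn_eq0 eqn0Ngt p0.
have xyn n : anorm (oval (otheta (iter n troot x))) <= anorm (oval (otheta (iter n troot y))).
  move: xy; rewrite -(tnorm_iter_troot x n) -(tnorm_iter_troot y n).
  by rewrite ler_pXn2r ?nnegrE ?tnorm_ge0 // expn_gt0 p0.
have [c cP] := choice (fun n => oring_dvd (xyn n)).
have cS n : c n.+1 ^+ p = c n.
  apply: val_inj => /=; rewrite ovalX; apply: (mulIf (y0n n)).
  have /(congr1 (@oval R K)) /= := cP n.+1; move/(congr1 (fun z => z ^+ p)).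
  rewrite exprMn -!ovalX -!othetaX !trootK => <-.
  by rewrite {1}cP.
exists (tilt_of_roots cS); apply: tilt_eq => n.
by rewrite tseqM /= -!tseq_otheta -rmorphM -cP.
Qed.

Lemma tnorm_complete u : norm_cauchy tnorm u -> exists l, norm_cvg tnorm u l.
Proof.
move=> uC; have stab n : exists m, forall a b,
    (m <= a)%N -> (m <= b)%N -> tseq (u a) n = tseq (u b) n.
  have [m mP] := uC (q ^+ (p ^ n)) (exprn_gt0 _ q0); exists m => a b ma mb.
  by apply/eqP; rewrite -subr_eq0 -tseqB; apply/eqP/tseq_eq0/ltW/mP.
have [m mP] := choice stab.
have LP : (fun n => tseq (u (m n)) n) \in @frob_compatible R p K.
  rewrite unfold_in; apply/asboolP => n; pose M := maxn (m n) (m n.+1).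
  by rewrite (mP n _ M) ?leq_maxl // (mP n.+1 _ M) ?leq_maxr // tseqS.
exists (Tilt LP) => e /(expr_small q0' q1) [n qn]; exists (m n) => a ma.
apply: le_lt_trans qn; apply: (@le_trans _ _ (q ^+ (p ^ n))); last first.
  by rewrite ler_wiXn2l ?(ltW q1) // ltnW // ltn_expl // prime_gt1.
by apply/tseq_eq0; rewrite tseqB /= (mP n a (m n)) // subrr.
Qed.

Lemma tnorm_neq0 : exists x, tnorm x != 0.
Proof. by exists 1; rewrite /tnorm otheta1 anorm1 oner_neq0. Qed.

Definition tilt_normed : normed_ring R :=
  NormedRing tnorm_ge0 tnorm_0 tnormM tnormD_le tnorm_le1 tnorm_neq0 tnorm_dvd tnorm_complete.
End Tilt.

(** * The homomorphism Theta *)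

Section ThetaMorphism.
Variables (R : realType) (p : nat) (p_pr : prime p) (K : mixedFieldType R p).
Local Notation W := (witt p_pr (tilt_ring K)).
Implicit Types w : W.
Let tperf := @tilt_perfect R p K.

Lemma digit_troot w i : digit tperf w i = iter i (@troot R p K) (wcoord w i).
Proof.
by apply: (perfect_expn_inj tperf (n := i)); rewrite /= -wcoord_digit iter_trootK.
Qed.

Definition lifts n (l : witt p_pr (oring K)) w : Prop :=
  forall i, to_modp (wcoord l i) = tseq (wcoord w i) n.

Lemma lifts_ex n w : exists l, lifts n l w.
Proof. by exists (Witt p_pr (fun i => repr (tseq (wcoord w i) n))) => i; rewrite to_modp_repr. Qed.

(* Modulo p^(n+1), Theta is the n-th ghost component of any lift to W(o_K) of the
   image of w under the n-th projection of the tilt to o_K/(p). *)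
Lemma Theta_ex w : exists t : oring K, oval t = Theta w /\
  forall n l, lifts n l w -> cong p n.+1 t (wghost n l).
Proof.
pose s m := \sum_(i < m) p%:R ^+ i * otheta (digit tperf w i).
have [|t tP] := @oring_padic_complete R p K s.
  by move=> n; exists (otheta (digit tperf w n)); rewrite /s big_ord_recr.
exists t; split=> [|n l ln].
  apply/esym/norm_limE; under [X in norm_cvg _ X]funext => m.
    under eq_bigr do rewrite thetaE tdigitsE -(oval_nat K) -ovalX -[_ * _]/(oval (_ * _)).
    rewrite -(oval_sum (fun i => p%:R ^+ i * otheta (digit tperf w i))).
    over.
  exact: norm_cvg_cong.
apply: WittPolynomials.cong_trans (tP n.+1) _; apply: WittPolynomials.cong_sum => i.
have lin : (i <= n)%N by rewrite -ltnS.
rewrite -[in cong _ _](subnKC (leqW lin)); apply: WittPolynomials.congMp; rewrite subSn //.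
(* The i-th digit is the p^i-th root of the i-th coordinate, so its term of index n - i is the n-th
   term of that coordinate, which [l] lifts. *)
apply: otheta_cong; rewrite digit_troot tseq_iter_troot subnK //.
Qed.

Definition oTheta w : oring K := sval (cid (Theta_ex w)).

Lemma ThetaE w : Theta w = oval (oTheta w).
Proof. by have [->] := svalP (cid (Theta_ex w)). Qed.

Lemma oTheta_cong w n l : lifts n l w -> cong p n.+1 (oTheta w) (wghost n l).
Proof. by have [_] := svalP (cid (Theta_ex w)); apply. Qed.

Lemma oTheta_uniq w t :
  (forall n, exists2 l, lifts n l w & cong p n.+1 t (wghost n l)) -> oTheta w = t.
Proof.
move=> h; apply: cong_eq => n; apply: (cong_le (leqnSn n)).
have [l ln tl] := h n; apply: WittPolynomials.cong_trans (oTheta_cong ln) _.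
exact: WittPolynomials.cong_sym.
Qed.

Let proj_zmod n : zmod_morphism (fun x : tilt_ring K => tseq x n).
Proof. by move=> x y; rewrite tseqB. Qed.
Let proj_monoid n : monoid_morphism (fun x : tilt_ring K => tseq x n).
Proof. by split=> [|x y]; rewrite ?tseq1 ?tseqM. Qed.
Let proj n : {rmorphism tilt_ring K -> modp K} :=
  HB.pack_for {rmorphism tilt_ring K -> modp K} (fun x : tilt_ring K => tseq x n)
  (GRing.isZmodMorphism.Build _ _ _ (proj_zmod n))
  (GRing.isMonoidMorphism.Build _ _ _ (proj_monoid n)).

(** As an equality in W(o_K/(p)) between images under ring morphisms, the lifting condition passes
    to differences and products. *)
Let liftsP n l w : lifts n l w <-> witt_map (@to_modp R p K) l = witt_map (proj n) w.
Proof.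
split=> [h|h i]; first by apply: wittP => i /=; rewrite h.
by have := congr1 (fun v => wcoord v i) h.
Qed.

Lemma oTheta_zmod : zmod_morphism oTheta.
Proof.
move=> w v; apply: oTheta_uniq => n.
have [l lw] := lifts_ex n w; have [m mv] := lifts_ex n v.
exists (l - m); first by apply/liftsP; rewrite !rmorphB; congr (_ - _); apply/liftsP.
rewrite rmorphB; apply: WittPolynomials.congD; first exact: oTheta_cong.
exact/WittPolynomials.congN/oTheta_cong.
Qed.

Lemma oTheta_teich x : oTheta (teich p_pr x) = otheta x.
Proof.
apply: oTheta_uniq => n; exists (teich p_pr (repr (tseq x n))).
  case=> [|i]; first exact: to_modp_repr.
  by rewrite -[LHS]/(to_modp (0 : oring K)) -[RHS]/(tseq (0 : tilt_ring K) n) tseq0 rmorph0.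
by rewrite wghost_teich; apply: otheta_cong; rewrite to_modp_repr.
Qed.

Lemma oTheta_monoid : monoid_morphism oTheta.
Proof.
split=> [|w v]; first by rewrite [LHS]oTheta_teich otheta1.
apply: oTheta_uniq => n.
have [l lw] := lifts_ex n w; have [m mv] := lifts_ex n v.
exists (l * m); first by apply/liftsP; rewrite !rmorphM; congr (_ * _); apply/liftsP.
by rewrite rmorphM; apply: WittPolynomials.congM; apply: oTheta_cong.
Qed.

HB.instance Definition _ := GRing.isZmodMorphism.Build W (oring K) oTheta oTheta_zmod.
HB.instance Definition _ := GRing.isMonoidMorphism.Build W (oring K) oTheta oTheta_monoid.

Lemma oTheta_head w : cong p 1 (oTheta w) (otheta (wred w)).
Proof.
rewrite {1}(witt_head_tail tperf w) rmorphD rmorphM rmorph_nat /= oTheta_teich.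
by exists (oTheta (wtail tperf w)); rewrite expr1.
Qed.
End ThetaMorphism.

(** * Surjectivity of Theta and a generator of its kernel *)

Section Perfectoid.
Variables (R : realType) (p : nat) (p_pr : prime p) (K : perfectoidFieldType R p).
Local Notation W := (witt p_pr (tilt_ring K)).
Let q : R := p%:R^-1.
Let q0 : 0 < q. Proof. by rewrite invr_gt0 ltr0n prime_gt0. Qed.
Let q1 : q < 1. Proof. by rewrite invf_lt1 ?ltr1n ?ltr0n ?prime_gt1 ?prime_gt0. Qed.
Let tperf := @tilt_perfect R p K.

Lemma tilt_head_surj (c : modp K) : exists x : tilt_ring K, tseq x 0 = c.
Proof.
have [r rP] := choice (@perfectoid_frob_surj R p K).
pose s n := iter n r c.
have sP : s \in @frob_compatible R p K by rewrite unfold_in; apply/asboolP => n; rewrite /s /= rP.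
by exists (Tilt sP).
Qed.

Lemma otheta_surj_modp (y : oring K) : exists x, cong p 1 y (otheta x).
Proof.
have [x xP] := tilt_head_surj (to_modp y); exists x; apply/to_modpP.
by rewrite tseq0_otheta xP.
Qed.

(** Successive approximation: an element of the tilt matches the current remainder modulo p and
    supplies the next Teichmueller digit. *)
Lemma oTheta_surj (y : oring K) : exists w : W, oTheta w = y.
Proof.
have step (z : oring K) : exists xz : tilt_ring K * oring K, z = otheta xz.1 + p%:R * xz.2.
  by have [x [t ->]] := otheta_surj_modp z; exists (x, t); rewrite expr1.
have [f fP] := choice step; pose r n := iter n (fun z => (f z).2) y.
have [w wd] := witt_digits p_pr tperf (fun n => (f (r n)).1).
exists w; apply: cong_eq => n.
have -> : y = \sum_(i < n) p%:R ^+ i * otheta (f (r i)).1 + p%:R ^+ n * r n.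
  elim: n => [|n IH]; first by rewrite big_ord0 add0r mul1r.
  by rewrite {1}IH big_ord_recr /= {1}[r n]fP mulrDr addrA mulrA -exprSr.
rewrite (digit_sum tperf w n) rmorphD rmorph_sum rmorphM rmorphXn rmorph_nat wd /=.
set z := oTheta _; exists (z - r n); rewrite mulrBr -[RHS]addrA [_ * r n + _]addrC subrK.
by congr (_ + _); apply: eq_bigr => i _; rewrite rmorphM rmorphXn rmorph_nat /= oTheta_teich.
Qed.

(** If no norm lay strictly between q and 1, then no ratio of two norms would either, and the
    interval from q r to r / q would isolate each r in the value group. *)
Lemma exists_anorm_between : exists a : K, q < anorm a < 1.
Proof.
apply: contrapT => no; apply: (@perfectoid_not_discrete R p K) => r [x x0 xr].
split; first by apply/mem_set; exists x.
have r0 : 0 < r by rewrite -xr anorm_gt0.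
exists [set s | s \in `]q * r, q^-1 * r[].
  apply: near_in_itvoo; rewrite in_itv /= gtr_pMl // q1 ltr_pMl //.
  by rewrite invf_gt1.
apply/seteqP; split=> [s [/= sr [y y0 ys]]|_ ->]; last first.
  split; last by exists x.
  by rewrite /= in_itv /= gtr_pMl // q1 ltr_pMl // invf_gt1.
have yx : anorm (y / x) = s / r by rewrite anormM anormV ys xr.
have xy : anorm (x / y) = r / s by rewrite anormM anormV ys xr.
have s0 : 0 < s by rewrite -ys anorm_gt0.
move: sr; rewrite in_itv /= => /andP[h1 h2].
case: (ltgtP s r) => [sr|sr|//]; exfalso; apply: no.
  exists (y / x); rewrite yx ltr_pdivlMr // h1 ltr_pdivrMr // mul1r sr //.
exists (x / y); rewrite xy ltr_pdivlMr // ltr_pdivrMr // mul1r sr andbT.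
by move: h2; rewrite mulrC ltr_pdivlMr // mulrC.
Qed.

(** A change modulo p alters an element by norm at most q, hence does not affect a norm strictly
    above q. *)
Lemma otheta_norm_ex (a : K) : q < anorm a < 1 -> exists x : tilt_ring K, tnorm x = anorm a.
Proof.
move=> /andP[qa a1]; have aO : a \in @integer R K by rewrite unfold_in ltW.
have [x /congP] := otheta_surj_modp (OInt aO); rewrite /= expr1 -/q => ax.
exists x; rewrite /tnorm -[oval (otheta x)](subKr a) anormD_eq ?anormN //.
exact: le_lt_trans ax qa.
Qed.

(** The norm q is just too small for [otheta_norm_ex]. Both factors of p = a (p/a) have norms in its
    range, and the product of their approximations has norm q. *)
Lemma exists_tnorm_q : exists x : tilt_ring K, tnorm x = q.
Proof.
have [a /andP[qa a1]] := exists_anorm_between.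
have a0 : 0 < anorm a := lt_trans q0 qa.
have bE : anorm (p%:R / a : K) = q / anorm a by rewrite anormM anorm_p anormV.
have [x xE] := otheta_norm_ex (introT andP (conj qa a1)).
have [|y yE] := @otheta_norm_ex (p%:R / a).
  by rewrite bE ltr_pdivlMr // gtr_pMr // a1 ltr_pdivrMr // mul1r qa.
by exists (x * y); rewrite tnormM xE yE bE mulrC divfK // gt_eqF.
Qed.

Lemma Theta_kernel_generator : exists z : W,
  [/\ oTheta z = 0, tnorm (wred z) = q,
      exists u v, z - teich p_pr (wred z) = p%:R * u /\ u * v = 1 &
      forall w, oTheta w = 0 -> exists r, w = r * z].
Proof.
have [z0 z0q] := exists_tnorm_q.
(* Since |theta(z0)| = |p|, the quotient c has norm 1, and a preimage u of c under Theta is a unit.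
   The choice z = [z0] - p u then makes Theta(z) = theta(z0) - p c = 0. *)
have [c cE] : exists c, otheta z0 = c * p%:R.
  by apply: oring_dvd; rewrite oval_nat anorm_p -/q -z0q.
have c1 : anorm (oval c) = 1.
  move: z0q; rewrite /tnorm cE /= anormM oval_nat anorm_p -/q => h.
  by apply: (mulIf (lt0r_neq0 q0)); rewrite mul1r.
have [u uc] := oTheta_surj c.
have u1 : tnorm (wred u) = 1.
  have /congP := oTheta_head u; rewrite uc expr1 -/q => h.
  rewrite /tnorm -[oval (otheta _)](subKr (oval c)) anormD_eq ?anormN // c1.
  exact: le_lt_trans h q1.
have [v uv] : exists v, u * v = 1.
  apply: (witt_unit tperf); have [|v vE] := @tnorm_dvd R p K 1 (wred u).
    by rewrite u1 tnorm_le1.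
  by exists v; rewrite mulrC.
have red_z : wred (teich p_pr z0 - p%:R * u) = z0.
  by rewrite rmorphB /= (wred_mulp tperf) subr0.
exists (teich p_pr z0 - p%:R * u); split; rewrite ?red_z //.
- by rewrite rmorphB rmorphM rmorph_nat /= oTheta_teich uc cE mulrC subrr.
- exists (- u), (- v); rewrite mulrNN uv; split=> //.
  by rewrite addrAC subrr add0r mulrN.
set z := _ - _; have z_ker : oTheta z = 0.
  by rewrite rmorphB rmorphM rmorph_nat /= oTheta_teich uc cE mulrC subrr.
(* If Theta(w) = 0, then theta(w_0) is 0 modulo p, so |w_0| <= q = |z0| and w_0 = a z0. Then w - [a]
   z is divisible by p, with quotient again in the kernel since o_K is p-torsion free. The pair (0,
   0) is a default outside the kernel. *)
have step (w : W) : exists aw : W * W,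
    oTheta w = 0 -> w = aw.1 * z + p%:R * aw.2 /\ oTheta aw.2 = 0.
  have [w0|] := pselect (oTheta w = 0); last by exists (0, 0).
  have [|a aE] := @tnorm_dvd R p K (wred w) z0.
    have /congP := oTheta_head w; rewrite w0 /= sub0r anormN expr1 z0q.
    by [].
  have [|r rE] := @wred0_dvd _ p_pr _ tperf (w - teich p_pr a * z).
    by rewrite rmorphB rmorphM /= red_z -aE subrr.
  exists (teich p_pr a, r) => _; split; first by rewrite /= -rE addrC subrK.
  apply: oring_p_inj; rewrite -(rmorph_nat (@oTheta _ _ p_pr K)) -rmorphM -rE.
  by rewrite rmorphB rmorphM /= w0 z_ker mulr0 subrr.
have [f fP] := choice step => w w0.
pose g n := iter n (fun w => (f w).2) w.
have g0 n : oTheta (g n) = 0 by elim: n => [//|n IH]; have [_] := fP _ IH.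
have [r rE] := witt_complete tperf (fun n => (f (g n)).1).
exists r; apply/eqP; rewrite -subr_eq0; apply/eqP/(witt_separated tperf) => n.
have -> : w = (\sum_(i < n) p%:R ^+ i * (f (g i)).1) * z + p%:R ^+ n * g n.
  elim: n => [|n IH]; first by rewrite big_ord0 mul0r add0r mul1r.
  have [E _] := fP _ (g0 n); rewrite {1}IH big_ord_recr /= {1}E.
  by rewrite exprSr; ring.
have [s ->] := rE n; exists (g n - s * z).
by ring.
Qed.
End Perfectoid.

(** * Quotients by a primitive element *)

Section PrimitiveQuotient.
Variables (R : realType) (p : nat) (p_pr : prime p) (F : perfectAnalyticFieldType R p).
Local Notation W := (witt p_pr (oring F)).
Let q : R := p%:R^-1.
Let q0 : 0 < q. Proof. by rewrite invr_gt0 ltr0n prime_gt0. Qed.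
Let q1 : q < 1. Proof. by rewrite invf_lt1 ?ltr1n ?ltr0n ?prime_gt1 ?prime_gt0. Qed.
Let q0' : 0 <= q := ltW q0.

Let ov : {rmorphism oring F -> F} := \val.
Lemma oring_eq0 (x : oring F) : anorm (oval x) = 0 -> x = 0.
Proof. by move/anorm_0 => x0; apply: val_inj. Qed.

Lemma oring_perfect : perfect_ring p (oring F).
Proof.
have Fp := @perfect_pchar R p F.
split.
- rewrite inE p_pr; apply/eqP/val_inj.
  rewrite -[LHS]/(ov _) -[RHS]/(ov _) rmorph_nat rmorph0.
  exact: pcharf0.
- move=> x y /(congr1 ov); rewrite !rmorphXn => xy; apply: val_inj.
  apply/eqP; rewrite -subr_eq0.
  have /eqP : (ov x - ov y) ^+ p = 0.
    by rewrite -(pFrobenius_autE Fp) rmorphB /= !pFrobenius_autE xy subrr.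
  by rewrite expf_eq0 => /andP[_].
- move=> x; have [y yx] := perfect_frob_surj (oval x).
  have yO : y \in @integer R F.
    rewrite unfold_in -(@expr_le1 R p) ?prime_gt0 ?anorm_ge0 // -anormX yx.
    exact: oring_le1.
  by exists (OInt yO); apply: val_inj; rewrite /= -[LHS]/(ov _) rmorphXn.
Qed.
Let perf := oring_perfect.

Variables (z u v : W).
Hypothesis z_head : anorm (oval (wred z)) = q.
Hypothesis zE : z - teich p_pr (wred z) = p%:R * u.
Hypothesis uv1 : u * v = 1.

Let z0_neq0 : oval (wred z) != 0.
Proof. by rewrite -anorm_eq0 z_head gt_eqF. Qed.

Definition eqz (x y : W) : Prop := exists c, x - y = c * z.

Lemma eqz_refl x : eqz x x. Proof. by exists 0; rewrite subrr mul0r. Qed.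
Lemma eqz_sym x y : eqz x y -> eqz y x.
Proof. by move=> [c cE]; exists (- c); rewrite -opprB cE mulNr. Qed.
Lemma eqz_trans x y t : eqz x y -> eqz y t -> eqz x t.
Proof. by move=> [c cE] [d dE]; exists (c + d); rewrite mulrDl -cE -dE addrA subrK. Qed.
Lemma eqzD x y x' y' : eqz x y -> eqz x' y' -> eqz (x + x') (y + y').
Proof. by move=> [c cE] [d dE]; exists (c + d); rewrite mulrDl -cE -dE opprD addrACA. Qed.
Lemma eqzM x y x' y' : eqz x y -> eqz x' y' -> eqz (x * x') (y * y').
Proof.
move=> [c cE] [d dE]; exists (c * x' + y * d).
by rewrite mulrDl mulrAC -cE -mulrA -dE mulrBr mulrBl addrA subrK.
Qed.
Lemma eqzMl x y t : eqz x y -> eqz (t * x) (t * y).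
Proof. by apply: eqzM; apply: eqz_refl. Qed.
Lemma eqzX x y n : eqz x y -> eqz (x ^+ n) (y ^+ n).
Proof. by move=> xy; elim: n => [|n IH]; [apply: eqz_refl | rewrite !exprS; apply: eqzM]. Qed.

Lemma eqz_p : eqz p%:R (- (v * teich p_pr (wred z))).
Proof.
have pE : p%:R = (z - teich p_pr (wred z)) * v by rewrite zE -mulrA uv1 mulr1.
by exists v; rewrite pE opprK [v * teich _ _]mulrC -mulrDl subrK mulrC.
Qed.

Lemma eqz_teich_head : eqz (teich p_pr (wred z)) (- (p%:R * u)).
Proof. by exists 1; rewrite opprK mul1r -zE addrC subrK. Qed.

(** The reduction z_0 is nonzero in the domain o_F, so z is a nonzerodivisor modulo p; factors of p
    are then split off one at a time. *)
Lemma dvd_pX_mulz n x r : x * z = p%:R ^+ n * r -> exists s, x = p%:R ^+ n * s.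
Proof.
elim: n x r => [|n IH] x r xz; first by exists x; rewrite mul1r.
have [|y yE] := @wred0_dvd _ p_pr _ perf x.
  apply: val_inj; have := congr1 (fun w => ov (wred w)) xz.
  rewrite exprS -mulrA (wred_mulp perf) rmorphM rmorphM rmorph0 => /eqP.
  by rewrite mulf_eq0 -[ov (wred z)]/(oval (wred z)) (negPf z0_neq0) orbF => /eqP.
have [|s sE] := IH y r; last by exists s; rewrite yE sE exprS mulrA.
apply/eqP; rewrite -subr_eq0; apply/eqP/(witt_p_inj perf).
by rewrite mulrBr !mulrA -yE xz exprS subrr.
Qed.

(** The ideal (z) is p-adically closed: by [dvd_pX_mulz] the approximate quotients c n form a p-adic
    Cauchy sequence, whose limit is an exact quotient. *)
Lemma eqz_closed w : (forall n, exists c r, w = c * z + p%:R ^+ n * r) -> eqz w 0.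
Proof.
move=> h; have [c cP] := choice h.
have step n : exists e, c n.+1 - c n = p%:R ^+ n * e.
  have [r rE] := cP n; have [s sE] := cP n.+1.
  apply: (@dvd_pX_mulz _ _ (r - p%:R * s)).
  rewrite mulrBl mulrBr mulrA -exprSr; apply/eqP; rewrite subr_eq addrAC eq_sym subr_eq.
  by rewrite -sE addrC -rE.
have [e eP] := choice step; have [s sP] := witt_complete perf e.
have cE n : c n = c 0%N + \sum_(i < n) p%:R ^+ i * e i.
  elim: n => [|n IH]; first by rewrite big_ord0 addr0.
  by rewrite big_ord_recr /= addrA -IH -eP addrC subrK.
exists (c 0%N + s); rewrite subr0; apply/eqP; rewrite -subr_eq0; apply/eqP.
apply: (witt_separated perf) => n; have [r wE] := cP n; have [t ->] := sP n.
by exists (r - t * z); rewrite {1}wE cE; ring.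
Qed.

(** Let y = [y_0] + p y'. If |z_0| < |y_0|, then z_0 = c y_0 with |c| < 1, and replacing p by -v
    [z_0] gives [y_0] (1 - v [c] y'), whose second factor is a unit. Otherwise y_0 is a multiple of
    z_0, and replacing [z_0] by -p u exhibits y as p times something modulo z. Starting from w,
    either the first case occurs after n divisions, and p^n is turned back into (-v)^n [z_0]^n, or w
    lies in (z) by [eqz_closed] and a = 0 works. *)
Lemma eqz_teich_unit w : exists a t, (exists t', t * t' = 1) /\ eqz w (teich p_pr a * t).
Proof.
have step y : (exists a t, (exists t', t * t' = 1) /\ eqz y (teich p_pr a * t)) \/
    exists y', eqz y (p%:R * y').
  have yE := witt_head_tail perf y; set y' := wtail perf y in yE.
  have [lt|le] := ltP (anorm (oval (wred z))) (anorm (oval (wred y))).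
    left; have [c cE] := oring_dvd (ltW lt).
    exists (wred y), (1 - v * teich p_pr c * y'); split.
      apply: (witt_unit perf); apply: oring_unit.
      rewrite rmorphB !rmorphM rmorph1 /= wred_teich.
      rewrite anormD_eq ?anorm1 // anormN anormM.
      rewrite (le_lt_trans (ler_piMr _ (oring_le1 _))) ?anorm_ge0 //.
      rewrite anormM (le_lt_trans (ler_piMl _ (oring_le1 _))) ?anorm_ge0 //.
      by move: (lt); rewrite cE /= anormM gtr_pMl // (le_lt_trans (anorm_ge0 _) lt).
    rewrite {1}yE mulrBr mulr1; apply: eqzD; first exact: eqz_refl.
    have := eqzM eqz_p (eqz_refl y'); rewrite cE teichM.
    by congr eqz; rewrite mulNr; congr (- _); rewrite [teich _ c * _]mulrC !mulrA [v * _]mulrC.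
  right; have [c cE] := oring_dvd le; exists (y' - teich p_pr c * u).
  rewrite {1}yE addrC mulrBr; apply: eqzD; first exact: eqz_refl.
  have := eqzMl (teich p_pr c) eqz_teich_head; rewrite -teichM -cE.
  by congr eqz; rewrite mulrN mulrCA.
have [//|no] := pselect (exists a t, (exists t', t * t' = 1) /\ eqz w (teich p_pr a * t)).
exists 0, 1; split; first by exists 1; rewrite mulr1.
rewrite mulr1; apply: eqz_closed => n.
have [r [c cE]] : exists r, eqz w (p%:R ^+ n * r).
  elim: n => [|n [y wy]]; first by exists w; rewrite mul1r; apply: eqz_refl.
  case: (step y) => [[a [t [[t' tt'] yat]]]|[y' yy']]; last first.
    by exists y'; apply: eqz_trans wy _; rewrite exprSr -mulrA; apply: eqzMl.
  case: no; exists (wred z ^+ n * a), ((- v) ^+ n * t); split.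
    exists ((- u) ^+ n * t').
    by rewrite mulrACA tt' mulr1 -exprMn mulrNN [v * u]mulrC uv1 expr1n.
  apply: eqz_trans wy _; have := eqzM (eqzX n eqz_p) yat.
  by congr eqz; rewrite teichM teichX -mulNr exprMn; ring.
by exists c, r; rewrite -cE subrK.
Qed.

(** Let [b] = c z and c = [c_0] + p c', so that b = c_0 z_0. Expanding with z = [z_0] + p u leaves p
    ([c_0] u + c' z) = 0, so [c_0] = - v c' z lies in (z) as well. Iterating, |b| <= q^n for every
    n. *)
Lemma teich_eqz0 b : eqz (teich p_pr b) 0 -> b = 0.
Proof.
move=> bz; apply: oring_eq0; apply/eqP; rewrite eq_le anorm_ge0 andbT.
apply: (le_eps_pow q0' q1) => // n; rewrite le_max; apply/orP; right.
elim: n b bz => [|n IH] b [c]; rewrite subr0 => cE; first exact: oring_le1.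
have bE : b = wred c * wred z by rewrite -rmorphM -cE.
suff /IH h : eqz (teich p_pr (wred c)) 0.
  by rewrite bE /= anormM z_head exprSr ler_wpM2r.
have cE' := witt_head_tail perf c; set c' := wtail perf c in cE'.
exists (- (v * c')); rewrite subr0.
have : p%:R * (teich p_pr (wred c) * u + c' * z) = 0.
  apply: (addrI (teich p_pr b)); rewrite addr0 [RHS]cE.
  have -> : c * z = (teich p_pr (wred c) + p%:R * c') * z by rewrite -cE'.
  have -> : teich p_pr b = teich p_pr (wred c) * teich p_pr (wred z) by rewrite bE teichM.
  have zT : z = teich p_pr (wred z) + p%:R * u by rewrite -zE addrC subrK.
  rewrite mulrDl.
  have -> : teich p_pr (wred c) * z =
    teich p_pr (wred c) * (teich p_pr (wred z) + p%:R * u) by rewrite -zT.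
  by ring.
move/(witt_p_inj perf)/(congr1 (fun w => w * v)).
rewrite mul0r mulrDl -mulrA uv1 mulr1 => /eqP; rewrite addr_eq0 => /eqP ->.
by rewrite mulNr; congr (- _); rewrite mulrAC [v * _]mulrC mulrAC.
Qed.

(** Write a = c b. If |c| < 1, then [c] t - s is a unit whose product with [b] lies in (z), so b = 0
    by [teich_eqz0] and a = 0 too. *)
Lemma eqz_teich_norm a b t s :
  (exists t', t * t' = 1) -> (exists s', s * s' = 1) ->
  eqz (teich p_pr a * t) (teich p_pr b * s) -> anorm (oval a) = anorm (oval b).
Proof.
wlog ab : a b t s / anorm (oval a) <= anorm (oval b).
  move=> h tu su E; have [ab|/ltW ab] := leP (anorm (oval a)) (anorm (oval b)).
    exact: h ab tu su E.
  by apply/esym; apply: h ab su tu (eqz_sym E).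
move=> tu [s' ss'] [e eE]; have [c cE] := oring_dvd ab.
have [c1|c1] := eqVneq (anorm (oval c)) 1; first by rewrite cE /= anormM c1 mul1r.
have {}c1 : anorm (oval c) < 1 by rewrite lt_neqAle c1 oring_le1.
have [w wE] : exists w, (teich p_pr c * t - s) * w = 1.
  apply: (witt_unit perf); apply: oring_unit; rewrite rmorphB rmorphM /= wred_teich.
  have s1 : anorm (oval (wred s)) = 1.
    apply: (@oring_unit_norm _ _ _ (wred s')).
    by have := congr1 wred ss'; rewrite rmorphM rmorph1.
  rewrite addrC anormD_eq anormN s1 // anormM.
  by rewrite (le_lt_trans (ler_piMr _ (oring_le1 _))) ?anorm_ge0.
suff b0 : b = 0 by rewrite cE b0 mulr0.
apply: teich_eqz0; exists (e * w); rewrite subr0 mulrAC -eE cE teichM.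
rewrite -[LHS]mulr1 -wE; ring.
Qed.

Definition wnorm_rep w : oring F := sval (cid (eqz_teich_unit w)).
Definition wnorm w : R := anorm (oval (wnorm_rep w)).

Lemma wnormE w a t : (exists t', t * t' = 1) -> eqz w (teich p_pr a * t) ->
  wnorm w = anorm (oval a).
Proof.
move=> tu wat; rewrite /wnorm /wnorm_rep; case: cid => b /= [s [su wbs]].
by apply: eqz_teich_norm su tu (eqz_trans (eqz_sym wbs) wat).
Qed.

Lemma wnorm_ex w : exists a t, [/\ exists t', t * t' = 1, eqz w (teich p_pr a * t) &
  wnorm w = anorm (oval a)].
Proof.
by have [a [t [tu wat]]] := eqz_teich_unit w; exists a, t; rewrite (wnormE tu wat).
Qed.

Lemma wnorm_teich a : wnorm (teich p_pr a) = anorm (oval a).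
Proof.
apply: (@wnormE _ a 1); first by exists 1; rewrite mulr1.
by rewrite mulr1; apply: eqz_refl.
Qed.

Lemma wnorm_eqz x y : eqz x y -> wnorm x = wnorm y.
Proof.
have [a [t [tu yat ->]]] := wnorm_ex y.
by move=> xy; apply: wnormE tu (eqz_trans xy yat).
Qed.

Lemma wnorm_ge0 w : 0 <= wnorm w. Proof. exact: anorm_ge0. Qed.
Lemma wnorm_le1 w : wnorm w <= 1. Proof. exact: oring_le1. Qed.

Lemma wnorm_0 w : wnorm w = 0 -> eqz w 0.
Proof.
have [a [t [tu wat ->]]] := wnorm_ex w => /oring_eq0 a0.
by move: wat; rewrite a0 -[teich _ 0]/(0 : W) mul0r.
Qed.

Lemma wnormM x y : wnorm (x * y) = wnorm x * wnorm y.
Proof.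
have [a [t [[t' tt'] xat ->]]] := wnorm_ex x; have [b [s [[s' ss'] ybs ->]]] := wnorm_ex y.
rewrite -anormM -[oval a * _]/(oval (a * b)); apply: (@wnormE _ _ (t * s)).
  by exists (t' * s'); rewrite mulrACA tt' ss' mulr1.
by rewrite teichM mulrACA; apply: eqzM.
Qed.

(** Factoring out the larger term leaves [b] ([c] t + s), and every class has norm at most 1. *)
Lemma wnormD_le x y : wnorm (x + y) <= Num.max (wnorm x) (wnorm y).
Proof.
wlog xy : x y / wnorm x <= wnorm y.
  move=> h; have /orP[xy|yx] := le_total (wnorm x) (wnorm y); first exact: h.
  by rewrite addrC maxC h.
rewrite le_max; apply/orP; right.
have [b [s [su ybs yE]]] := wnorm_ex y; have [a [t [tu xat xE]]] := wnorm_ex x.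
have [|c cE] := @oring_dvd _ _ a b; first by rewrite -yE -xE.
have E : eqz (x + y) (teich p_pr b * (teich p_pr c * t + s)).
  apply: eqz_trans (eqzD xat ybs) _; rewrite cE teichM mulrDr mulrA.
  by rewrite [teich _ c * _]mulrC; apply: eqz_refl.
by rewrite (wnorm_eqz E) wnormM wnorm_teich yE ler_piMr ?anorm_ge0 ?wnorm_le1.
Qed.

Lemma wnorm_dvd x y : wnorm x <= wnorm y -> exists c, eqz x (c * y).
Proof.
have [b [s [[s' ss'] ybs ->]]] := wnorm_ex y; have [a [t [tu xat ->]]] := wnorm_ex x.
move=> /oring_dvd [c cE]; exists (teich p_pr c * t * s').
apply: eqz_trans xat _; apply: eqz_trans (eqz_sym (eqzMl _ ybs)).
rewrite cE teichM.
have -> : teich p_pr c * t * s' * (teich p_pr b * s) =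
  teich p_pr c * teich p_pr b * t * (s * s') by ring.
by rewrite ss' mulr1; apply: eqz_refl.
Qed.

Lemma wnorm_unit t t' : t * t' = 1 -> wnorm t = 1.
Proof.
move=> tt'; rewrite -[1](@anorm1 _ F) -[1]/(oval (1 : oring F)).
apply: (@wnormE _ _ t); first by exists t'.
by rewrite -[teich _ 1]/(1 : W) mul1r; apply: eqz_refl.
Qed.

Lemma wnormN x : wnorm (- x) = wnorm x.
Proof. by rewrite -mulN1r wnormM (@wnorm_unit _ (-1)) ?mul1r // mulrNN mulr1. Qed.

Lemma wnorm_p : wnorm p%:R = q.
Proof.
rewrite (wnorm_eqz eqz_p) wnormN wnormM wnorm_teich (@wnorm_unit v u) ?mul1r //.
by rewrite mulrC.
Qed.

Lemma wnorm_pX n : wnorm (p%:R ^+ n) = q ^+ n.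
Proof.
elim: n => [|n IH]; last by rewrite !exprS wnormM wnorm_p IH.
by apply: (@wnorm_unit _ 1); rewrite mulr1.
Qed.

(** Norm at most q^n means divisibility by p^n modulo z, so a fast subsequence has increments of the
    form c n * p^n and is summed p-adically in W(o_F). *)
Lemma wnorm_complete u' : norm_cauchy wnorm u' -> exists l, norm_cvg wnorm u' l.
Proof.
move=> uC; have [k kP] := choice (fun n => uC (q ^+ n) (exprn_gt0 _ q0)).
(* Partial sums make the chosen indices monotone while keeping m n >= k n. *)
pose m n := (\sum_(i < n.+1) k i)%N.
have km n : (k n <= m n)%N by rewrite /m big_ord_recr leq_addl.
have mS n : (m n <= m n.+1)%N by rewrite /m [in leqRHS]big_ord_recr leq_addr.
have step n : exists c, eqz (u' (m n.+1) - u' (m n)) (c * p%:R ^+ n).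
  by apply: wnorm_dvd; rewrite wnorm_pX ltW // kP // (leq_trans (km n)).
have [c cP] := choice step; have [s sP] := witt_complete perf c.
have uE n : eqz (u' (m n)) (u' (m 0%N) + \sum_(i < n) p%:R ^+ i * c i).
  elim: n => [|n IH]; first by rewrite big_ord0 addr0; apply: eqz_refl.
  rewrite big_ord_recr /= addrA mulrC.
  have -> : u' (m n.+1) = u' (m n) + (u' (m n.+1) - u' (m n)) by rewrite addrC subrK.
  exact: eqzD IH (cP n).
exists (u' (m 0%N) + s) => e /(expr_small q0' q1) [n qn]; exists (m n) => a ma.
apply: le_lt_trans qn; rewrite -[u' a](subrK (u' (m n))) -addrA.
apply: le_trans (wnormD_le _ _) _; rewrite ge_max.
rewrite ltW /=; last by rewrite kP // (leq_trans (km n)).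
have [r rE] := sP n.
have E : eqz (u' (m n) - (u' (m 0%N) + s)) (- (p%:R ^+ n * r)).
  apply: eqz_trans (eqzD (uE n) (eqz_refl _)) _; rewrite {1}rE.
  by rewrite [_ + (\sum_(_ < _) _ + _)]addrA opprD addrA subrr add0r; apply: eqz_refl.
by rewrite (wnorm_eqz E) wnormN wnormM wnorm_pX ler_piMr ?exprn_ge0 ?wnorm_le1.
Qed.

(** When y_0 is nonzero, y = [y_0] t where t has digits y_n / y_0; its reduction is 1, so t is a
    unit. *)
Lemma wnorm_dominant y :
  (forall n, anorm (oval (digit perf y n)) <= anorm (oval (digit perf y 0))) ->
  wnorm y = anorm (oval (wred y)).
Proof.
move=> h; have [y0|y0] := eqVneq (oval (wred y)) 0.
  have -> : y = 0.
    apply: (digit0P (Aperf := perf)) => n; apply: oring_eq0; apply/eqP.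
    by rewrite eq_le anorm_ge0 (le_trans (h n)) // /digit /= y0 anorm0.
  by rewrite rmorph0 -[0 in LHS]/(teich p_pr 0) wnorm_teich.
have [c cP] := choice (fun n => oring_dvd (h n)).
have [t tc] := witt_digits p_pr perf c.
apply: (@wnormE _ _ t).
  apply: (witt_unit perf); apply: oring_unit.
  have -> : wred t = c 0%N by rewrite -tc.
  have /(congr1 (fun x => anorm (ov x))) := cP 0%N.
  rewrite rmorphM anormM => E; have y1 : anorm (oval (wred y)) != 0 by rewrite anorm_eq0.
  by apply: (mulIf y1); rewrite mul1r; apply/esym.
suff <- : y = teich p_pr (wred y) * t by apply: eqz_refl.
apply/eqP; rewrite -subr_eq0; apply/eqP/(witt_separated perf) => n.
rewrite {1}(digit_sum perf y n) [X in _ - _ * X](digit_sum perf t n) tc mulrDr mulr_sumr.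
have -> : \sum_(i < n) teich p_pr (wred y) * (p%:R ^+ i * teich p_pr (c i)) =
    \sum_(i < n) p%:R ^+ i * teich p_pr (digit perf y i).
  by apply: eq_bigr => i _; rewrite mulrCA -teichM mulrC [wred y * _]mulrC cP mulrC.
rewrite opprD addrACA subrr add0r mulrCA -mulrBr; by eexists.
Qed.
End PrimitiveQuotient.

(** * The untilt *)

Section Untilt.
Variables (R : realType) (p : nat) (p_pr : prime p).
Implicit Type P : primitive_pair R p_pr.
Let q : R := p%:R^-1.
Let q0 : 0 < q. Proof. by rewrite invr_gt0 ltr0n prime_gt0. Qed.
Let q1 : q < 1. Proof. by rewrite invf_lt1 ?ltr1n ?ltr0n ?prime_gt1 ?prime_gt0. Qed.
Let q0' : 0 <= q := ltW q0.

Lemma pair_generator P :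
  exists zuv : witt p_pr (oring P) * witt p_pr (oring P) * witt p_pr (oring P),
  [/\ anorm (oval (wred zuv.1.1)) = q,
      zuv.1.1 - teich p_pr (wred zuv.1.1) = p%:R * zuv.1.2,
      zuv.1.2 * zuv.2 = 1 &
      forall w, pair_ideal P w <-> exists c, w = c * zuv.1.1].
Proof.
case: (pair_idealP P) => z [z_head [u [v [zE uv]]]] PE.
rewrite (tdigitsE (oring_perfect p_pr P)) in z_head zE.
by exists (z, u, v); split=> // w; rewrite PE; apply: ideal_gen1.
Qed.

Section OnePair.
Variable P : primitive_pair R p_pr.
Local Notation W := (witt p_pr (oring P)).
Let zuv := sval (cid (pair_generator P)).
Let z := zuv.1.1.
Let z_head : anorm (oval (wred z)) = q. Proof. by have [] := svalP (cid (pair_generator P)). Qed.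
Let zE : z - teich p_pr (wred z) = p%:R * zuv.1.2.
Proof. by have [] := svalP (cid (pair_generator P)). Qed.
Let uv1 : zuv.1.2 * zuv.2 = 1. Proof. by have [] := svalP (cid (pair_generator P)). Qed.
Let PE w : pair_ideal P w <-> exists c, w = c * z.
Proof. by have [_ _ _] := svalP (cid (pair_generator P)). Qed.
Let N := wnorm z_head zE uv1.

(** The future valuation ring, taken before p is inverted. *)
Definition untilt_integers : Type := quot (pair_ideal P).
HB.instance Definition _ := GRing.ComPzRing.on untilt_integers.
Local Notation cls := (qclass (pair_ideal P)).

Let pair_is_ideal : is_ideal (pair_ideal P).
Proof. by case: (pair_idealP P) => t _ ->; apply: ideal_genP. Qed.

Let gen_pair_ideal w : ideal_gen (pair_ideal P) w <-> pair_ideal P w.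
Proof.
split=> [h|h]; last exact: sub_gen_smallest.
by apply: (h (pair_ideal P)); split.
Qed.

Let clsP x y : cls x = cls y <-> eqz z x y.
Proof.
split=> [/qclassP/gen_pair_ideal/PE //|[c cE]].
by apply/qclassP/gen_pair_ideal/PE; exists c.
Qed.

Let N0 : N 0 = 0. Proof. by rewrite /N -[0]/(teich p_pr 0) wnorm_teich anorm0. Qed.

Let N1 : N 1 = 1. Proof. by apply: (@wnorm_unit _ _ _ _ _ _ _ _ _ _ _ 1); rewrite mulr1. Qed.

Let ideal_proper : ~ pair_ideal P 1.
Proof.
move=> /PE [c cE]; have : eqz z 1 0 by exists c; rewrite subr0.
move/(wnorm_eqz z_head zE uv1); rewrite -/N N0 N1.
by move/eqP; rewrite oner_eq0.
Qed.

HB.instance Definition _ := GRing.PzSemiRing_isNonZero.Build untilt_integers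
  (quot_nz pair_is_ideal (fun _ => id) ideal_proper).

Definition untilt_norm (x : untilt_integers) : R := N (repr x).

Let reprE (x : untilt_integers) : cls (repr x) = x. Proof. exact: reprK. Qed.

Let normE w : untilt_norm (cls w) = N w.
Proof. by apply/wnorm_eqz/clsP; rewrite reprE. Qed.

Let norm_ge0 x : 0 <= untilt_norm x. Proof. exact: wnorm_ge0. Qed.
Let norm_le1 x : untilt_norm x <= 1. Proof. exact: wnorm_le1. Qed.
Let norm_0 x : untilt_norm x = 0 -> x = 0.
Proof. by move/wnorm_0/clsP; rewrite reprE rmorph0. Qed.
Let normM x y : untilt_norm (x * y) = untilt_norm x * untilt_norm y.
Proof. by rewrite -(reprE x) -(reprE y) -rmorphM /= !normE /N wnormM. Qed.
Let normD_le x y : untilt_norm (x + y) <= Num.max (untilt_norm x) (untilt_norm y).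
Proof. by rewrite -(reprE x) -(reprE y) -rmorphD /= !normE /N wnormD_le. Qed.
Let norm_neq0 : exists x, untilt_norm x != 0.
Proof.
by exists (cls 1); rewrite normE N1 oner_neq0.
Qed.
Let norm_dvd x y : untilt_norm x <= untilt_norm y -> exists c, x = c * y.
Proof.
move=> /wnorm_dvd [c /clsP]; rewrite reprE rmorphM /= reprE => ->.
by exists (cls c).
Qed.
Let norm_complete u : norm_cauchy untilt_norm u -> exists l, norm_cvg untilt_norm u l.
Proof.
have E x y : untilt_norm (x - cls y) = N (repr x - y).
  by rewrite -{1}(reprE x) -rmorphB normE.
move=> uC; have [|l lP] := @wnorm_complete _ _ _ _ _ _ _ z_head zE uv1 (fun n => repr (u n)).
  by move=> e /uC [n nP]; exists n => a b na nb; have := nP a b na nb; rewrite -{1}(reprE (u b)) E.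
by exists (cls l) => e /lP [n nP]; exists n => a /nP; rewrite E.
Qed.

Definition untilt_normed : normed_ring R :=
  NormedRing norm_ge0 norm_0 normM normD_le norm_le1 norm_neq0 norm_dvd norm_complete.

(** The field and its norm come from the fraction field construction; [untilt_ring_map_bij]
    identifies the result with [untilt_ring]. *)
Definition untilt_field : Type := nfrac untilt_normed.
HB.instance Definition _ := AnalyticField.on untilt_field.

Definition untilt_map (w : W) : oring untilt_field :=
  integer_lift (@nfrac_emb_le1 R untilt_normed) (cls w).

Lemma untilt_map_zmod : zmod_morphism untilt_map.
Proof. by move=> x y; rewrite /untilt_map !rmorphB. Qed.
Lemma untilt_map_monoid : monoid_morphism untilt_map.
Proof. by split=> [|x y]; rewrite /untilt_map ?rmorph1 ?rmorphM. Qed.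
HB.instance Definition _ :=
  GRing.isZmodMorphism.Build W (oring untilt_field) untilt_map untilt_map_zmod.
HB.instance Definition _ :=
  GRing.isMonoidMorphism.Build W (oring untilt_field) untilt_map untilt_map_monoid.

Let anorm_map w : anorm (oval (untilt_map w)) = N w.
Proof. by rewrite -normE; apply: anorm_emb. Qed.

Lemma untilt_map_surj x : exists w, untilt_map w = x.
Proof.
have [a aE] := nfrac_emb_surj (oring_le1 x).
by exists (repr a); apply: val_inj; rewrite -[RHS]aE /= reprE.
Qed.

Lemma untilt_map_eq0 w : untilt_map w = 0 <-> pair_ideal P w.
Proof.
rewrite -gen_pair_ideal -[w in ideal_gen _ w]subr0; split=> [|/qclassP] h.
  apply/qclassP/(@nfrac_emb_inj R untilt_normed).
  by have := congr1 (@oval _ _) h; rewrite /= => ->; rewrite !rmorph0.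
by apply: val_inj; rewrite /= [qclass _ w]h !rmorph0.
Qed.

Lemma anorm_untilt_teich x : anorm (oval (untilt_map (teich p_pr x))) = anorm (oval x).
Proof. by rewrite anorm_map; apply: wnorm_teich. Qed.

Lemma anorm_untilt_dominant y :
  (forall n, anorm (oval (tdigits y n)) <= anorm (oval (tdigits y 0))) ->
  anorm (oval (untilt_map y)) = anorm (oval (tdigits y 0)).
Proof. by rewrite (tdigitsE (oring_perfect p_pr P)) anorm_map; apply: wnorm_dominant. Qed.

Lemma untilt_map_teich_unit w :
  exists a t t', t * t' = 1 /\ untilt_map w = untilt_map (teich p_pr a * t).
Proof.
have [a [t [[t' tt'] /clsP E]]] := eqz_teich_unit z_head zE uv1 w.
by exists a, t, t'; split=> //; rewrite /untilt_map E.
Qed.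

Let anorm_untilt_p : anorm (p%:R : untilt_field) = p%:R^-1.
Proof.
have -> : (p%:R : untilt_field) = oval (untilt_map p%:R).
  by rewrite rmorph_nat -(rmorph_nat (\val : oring untilt_field -> untilt_field)).
by rewrite anorm_map /N wnorm_p.
Qed.

Let untilt_residue : p \in [pchar residue_field untilt_field].
Proof.
rewrite inE p_pr /=; apply/eqP.
rewrite -(rmorph_nat (qclass (maximal_ideal (K := untilt_field)))).
rewrite -(rmorph0 (qclass (maximal_ideal (K := untilt_field)))).
apply/qclassP; rewrite subr0; apply: sub_gen_smallest; rewrite /maximal_ideal /=.
rewrite -[oval _]/((\val : oring untilt_field -> untilt_field) _) rmorph_nat.
by rewrite anorm_untilt_p.
Qed.

HB.instance Definition _ := isMixedChar.Build R p untilt_field anorm_untilt_p untilt_residue.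

(** Modulo p only the leading Teichmueller term of w survives, and o_F is perfect. *)
Lemma untilt_map_frob (w : W) : exists x, cong p 1 (untilt_map w) (untilt_map (teich p_pr x) ^+ p).
Proof.
have perf := oring_perfect p_pr P; have [_ _ /(_ (wred w)) [x xw]] := perf.
exists x; exists (untilt_map (wtail perf w)).
by rewrite -rmorphXn -teichX xw {1}(witt_head_tail perf w) rmorphD rmorphM rmorph_nat.
Qed.

Let untilt_frob (x : modp untilt_field) : exists y, y ^+ p = x.
Proof.
have [w wx] := untilt_map_surj (repr x); have [y wy] := untilt_map_frob w.
exists (to_modp (untilt_map (teich p_pr y))).
by rewrite -rmorphXn -[x]to_modp_repr -wx; apply/esym/to_modpP.
Qed.

(** The p^n-th roots of z_0 have norms s n < 1 with s n ^ (p^n) = q. An isolating ball of radius e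
    around 1 would force s n <= 1 - e for all n, hence q <= (1 - e)^n, which fails for large n. *)
Let untilt_not_discrete : ~ discretely_valued untilt_field.
Proof.
have [_ _ rt] := oring_perfect p_pr P; have {rt} [rt rtP] := choice rt.
pose t n := iter n rt (wred z); pose s n : R := anorm (oval (t n)).
have tX n : t n ^+ (p ^ n) = wred z.
  by elim: n => [|n IH]; rewrite ?expr1 // expnS exprM /= rtP.
have sX n : s n ^+ (p ^ n) = q.
  by rewrite /s -anormX -z_head -(tX n) -(rmorphXn (\val : oring P -> P)).
have s0 n : 0 <= s n := anorm_ge0 _.
have s1 n : s n < 1.
  by have := q1; rewrite -(sX n) expr_lt1 // expn_gt0 prime_gt0.
have sV n : value_group untilt_field (s n).
  exists (oval (untilt_map (teich p_pr (t n)))); last exact: anorm_untilt_teich.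
  rewrite /= -anorm_eq0 anorm_untilt_teich; apply/eqP => E.
  by have := sX n; rewrite /s E expr0n expn_eq0 eqn0Ngt prime_gt0 //= => /eqP; rewrite lt_eqF.
move=> /(_ 1) [|_ [V /nbhs_ballP [e /= e0 eV] VE]].
  by exists 1; [exact: oner_neq0 | exact: anorm1].
have se n : s n <= 1 - e.
  rewrite leNgt; apply/negP => h; have : (V `&` value_group untilt_field) (s n).
    split; last exact: sV.
    apply: eV; rewrite /ball /= ger0_norm ?subr_ge0 ?ltW //.
    by rewrite ltrBlDr addrC -ltrBlDr.
  by rewrite VE /= => E; have := s1 n; rewrite E ltxx.
have e1 : 0 <= 1 - e by apply: le_trans (se 0%N).
have e1' : 1 - e < 1 by rewrite gtrBl.
have [n nq] := expr_small e1 e1' q0.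
have : s n ^+ (p ^ n) <= (1 - e) ^+ n.
  apply: (@le_trans _ _ ((1 - e) ^+ (p ^ n))).
    by rewrite ler_pXn2r ?nnegrE // expn_gt0 prime_gt0.
  by rewrite ler_wiXn2l ?(ltW e1') // ltnW // ltn_expl // prime_gt1.
by rewrite sX leNgt nq.
Qed.

HB.instance Definition _ := isPerfectoid.Build R p untilt_field untilt_not_discrete untilt_frob.
End OnePair.
End Untilt.

(** * The tilting functor *)

Lemma quot_factor (A B : comPzRingType) (S : set A) (f : {rmorphism A -> B}) :
  (forall s, S s -> f s = 0) ->
  exists g : {rmorphism quot S -> B}, forall a, g (qclass S a) = f a.
Proof.
move=> fS; pose g (x : quot S) := f (repr x).
have kerf x : ideal_gen S x -> f x = 0.
  move=> h; apply: (h [set x | f x = 0]); split=> //; split=> [|a b|a b] /=.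
  - by rewrite rmorph0.
  - by rewrite rmorphD => -> ->; rewrite addr0.
  - by rewrite rmorphM => ->; rewrite mulr0.
have gE a : g (qclass S a) = f a.
  apply/eqP; rewrite /g -subr_eq0 -rmorphB; apply/eqP/kerf/qclassP.
  exact: reprK.
have clsK x : qclass S (repr x) = x by exact: reprK.
have gB : zmod_morphism g.
  by move=> x y; rewrite -(clsK x) -(clsK y) -rmorphB !gE rmorphB.
have gM : monoid_morphism g.
  split=> [|x y]; first by rewrite -(rmorph1 (qclass S)) gE rmorph1.
  by rewrite -(clsK x) -(clsK y) -rmorphM !gE rmorphM.
pose G : {rmorphism quot S -> B} := HB.pack_for {rmorphism quot S -> B} g
  (GRing.isZmodMorphism.Build _ _ g gB) (GRing.isMonoidMorphism.Build _ _ g gM).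
by exists G.
Qed.

Lemma isometric_iso (R : realType) (A : comNzRingType) (K L : analyticFieldType R)
    (e : {rmorphism A -> K}) (phi : {rmorphism A -> L}) :
  (forall x, anorm x <= 1 -> exists a, e a = x) ->
  (forall x, anorm x <= 1 -> exists a, phi a = x) ->
  (forall a, anorm (phi a) = anorm (e a)) ->
  exists fg : isometric_hom K L * isometric_hom L K,
    [/\ forall a, fg.1 (e a) = phi a, forall a, fg.2 (phi a) = e a,
        isometric_comp fg.2 fg.1 = isometric_id K &
        isometric_comp fg.1 fg.2 = isometric_id L].
Proof.
move=> es ps en; have [f fE] := isometric_hom_ex es en.
have [g gE] := isometric_hom_ex ps (fun a => esym (en a)).
exists (f, g); split=> //; apply: isometric_hom_ext.
  by apply: (isometric_hom_uniq es) => a; rewrite /= fE gE.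
by apply: (isometric_hom_uniq ps) => a; rewrite /= gE fE.
Qed.

Section TiltField.
Variables (R : realType) (p : nat).

Section OneField.
Variable K : mixedFieldType R p.
Let p_pr : prime p := @prime_residue R p K.

Definition tilt_field : Type := nfrac (tilt_normed K).
HB.instance Definition _ := AnalyticField.on tilt_field.

Definition tilt_in (x : tilt_ring K) : oring tilt_field :=
  integer_lift (@nfrac_emb_le1 R (tilt_normed K)) x.
Lemma tilt_in_zmod : zmod_morphism tilt_in.
Proof. by move=> x y; rewrite /tilt_in rmorphB. Qed.
Lemma tilt_in_monoid : monoid_morphism tilt_in.
Proof. by split=> [|x y]; rewrite /tilt_in ?rmorph1 ?rmorphM. Qed.
HB.instance Definition _ :=
  GRing.isZmodMorphism.Build (tilt_ring K) (oring tilt_field) tilt_in tilt_in_zmod.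
HB.instance Definition _ :=
  GRing.isMonoidMorphism.Build (tilt_ring K) (oring tilt_field) tilt_in tilt_in_monoid.

Definition tilt_emb (x : tilt_ring K) : tilt_field := oval (tilt_in x).
Lemma tilt_emb_zmod : zmod_morphism tilt_emb.
Proof. by move=> x y; rewrite /tilt_emb rmorphB. Qed.
Lemma tilt_emb_monoid : monoid_morphism tilt_emb.
Proof. by split=> [|x y]; rewrite /tilt_emb ?rmorph1 ?rmorphM. Qed.
HB.instance Definition _ :=
  GRing.isZmodMorphism.Build (tilt_ring K) tilt_field tilt_emb tilt_emb_zmod.
HB.instance Definition _ :=
  GRing.isMonoidMorphism.Build (tilt_ring K) tilt_field tilt_emb tilt_emb_monoid.

Let tilt_field_pchar : p \in [pchar tilt_field].
Proof.
have [tp _ _] := @tilt_perfect R p K.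
by rewrite inE p_pr /= -(rmorph_nat tilt_emb) (pcharf0 tp) rmorph0.
Qed.

Let tilt_field_frob (x : tilt_field) : exists y, y ^+ p = x.
Proof.
have [_ _ rt] := @tilt_perfect R p K; have [[a b] /= [_ ->]] := nfrac_quotient x.
have [c <-] := rt a; have [d <-] := rt b.
by exists (tilt_emb c / tilt_emb d); rewrite expr_div_n -!rmorphXn.
Qed.

HB.instance Definition _ := isPerfectAnalytic.Build R p tilt_field
  tilt_field_pchar tilt_field_frob.

Lemma tilt_in_bij : bijective tilt_in.
Proof. exact: (integer_lift_bij (@nfrac_emb_surj _ _) _ (@nfrac_emb_inj _ _)). Qed.

Definition tilt_out : {rmorphism oring tilt_field -> tilt_ring K} :=
  sval (cid (rmorph_inverse tilt_in_bij)).

Lemma tilt_inK : cancel tilt_in tilt_out.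
Proof. by have [] := svalP (cid (rmorph_inverse tilt_in_bij)). Qed.
Lemma tilt_outK : cancel tilt_out tilt_in.
Proof. by have [] := svalP (cid (rmorph_inverse tilt_in_bij)). Qed.

Lemma anorm_tilt_emb x : anorm (tilt_emb x) = tnorm x.
Proof. exact: anorm_emb. Qed.

Lemma anorm_tilt_out x : anorm (oval x) = tnorm (tilt_out x).
Proof. by rewrite -{1}[x]tilt_outK -anorm_tilt_emb. Qed.

Lemma tilt_emb_surj (x : tilt_field) : anorm x <= 1 -> exists a, tilt_emb a = x.
Proof. exact: nfrac_emb_surj. Qed.
End OneField.

Section Map.
Variables (K L : mixedFieldType R p) (f : isometric_hom K L).

Lemma modp_map_to_modp x : modp_map f (to_modp x) = to_modp (oring_map f x).
Proof.
apply/to_modpP/congP; rewrite /= -rmorphB ihom_norm; apply/congP/to_modpP.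
exact: to_modp_repr.
Qed.

Lemma modp_map_zmod : zmod_morphism (@modp_map R p K L f).
Proof.
move=> x y; rewrite -(to_modp_repr x) -(to_modp_repr y).
by rewrite -(rmorphB (@to_modp R p K)) /= !modp_map_to_modp !rmorphB.
Qed.
Lemma modp_map_monoid : monoid_morphism (@modp_map R p K L f).
Proof.
split=> [|x y].
  by rewrite -(rmorph1 (@to_modp R p K)) /= modp_map_to_modp !rmorph1.
rewrite -(to_modp_repr x) -(to_modp_repr y).
by rewrite -(rmorphM (@to_modp R p K)) /= !modp_map_to_modp !rmorphM.
Qed.
HB.instance Definition _ :=
  GRing.isZmodMorphism.Build (modp K) (modp L) (@modp_map R p K L f) modp_map_zmod.
HB.instance Definition _ :=
  GRing.isMonoidMorphism.Build (modp K) (modp L) (@modp_map R p K L f) modp_map_monoid.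

Lemma tilt_map_subproof (x : tilt_ring K) :
  (fun n => modp_map f (tseq x n)) \in @frob_compatible R p L.
Proof. by rewrite unfold_in; apply/asboolP => n; rewrite -rmorphXn /= tseqS. Qed.
Definition tilt_map (x : tilt_ring K) : tilt_ring L := Tilt (tilt_map_subproof x).

Lemma tseq_tilt_map x n : tseq (tilt_map x) n = modp_map f (tseq x n).
Proof. by []. Qed.

Lemma tilt_map_zmod : zmod_morphism tilt_map.
Proof. by move=> x y; apply: tilt_eq => n; rewrite tseqB !tseq_tilt_map tseqB rmorphB. Qed.
Lemma tilt_map_monoid : monoid_morphism tilt_map.
Proof.
split=> [|x y]; apply: tilt_eq => n.
  by rewrite tseq_tilt_map !tseq1 rmorph1.
by rewrite tseqM !tseq_tilt_map tseqM rmorphM.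
Qed.
HB.instance Definition _ :=
  GRing.isZmodMorphism.Build (tilt_ring K) (tilt_ring L) tilt_map tilt_map_zmod.
HB.instance Definition _ :=
  GRing.isMonoidMorphism.Build (tilt_ring K) (tilt_ring L) tilt_map tilt_map_monoid.

Lemma otheta_tilt_map x : otheta (tilt_map x) = oring_map f (otheta x).
Proof.
apply: otheta_uniq => n; exists (oring_map f (repr (tseq x n))) => //.
have /WittPolynomials.cong_sym [z zE] := otheta_cong (to_modp_repr (tseq x n)).
apply: WittPolynomials.cong_sym; exists (oring_map f z).
by rewrite -rmorphXn zE rmorphD rmorphM rmorphXn rmorph_nat.
Qed.

Lemma tnorm_tilt_map x : tnorm (tilt_map x) = tnorm x.
Proof. by rewrite /tnorm otheta_tilt_map ihom_norm. Qed.

Lemma oTheta_tilt_map (p_pr : prime p) (w : witt p_pr (tilt_ring K)) :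
  oTheta (witt_map tilt_map w) = oring_map f (oTheta w).
Proof.
apply: (witt_hom_ext (@tilt_perfect R p K)
  (f := @oTheta R p p_pr L \o witt_map tilt_map) (g := oring_map f \o @oTheta R p p_pr K)).
  exact: oring_separated.
by move=> x; rewrite /= witt_map_teich !oTheta_teich otheta_tilt_map.
Qed.
End Map.
End TiltField.
Arguments tilt_out {R p K}.

Section TiltFunctor.
Variables (R : realType) (p : nat) (p_pr : prime p).
Implicit Types K L : perfectoidFieldType R p.

Definition tilt_ideal K : set (witt p_pr (oring (tilt_field K))) :=
  [set w | Theta (witt_map (@tilt_out R p K) w) = 0].
Arguments tilt_ideal : clear implicits.

Lemma tilt_idealP K : exists2 z, primitive z & tilt_ideal K = ideal_gen [set z].
Proof.
have [z [z_ker z_norm [u [v [zE uv]]] z_gen]] := Theta_kernel_generator p_pr K.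
have ioK (w : witt p_pr (tilt_ring K)) :
    witt_map (@tilt_out R p K) (witt_map (@tilt_in R p K) w) = w.
  by apply: wittP => n /=; rewrite tilt_inK.
have oiK (w : witt p_pr (oring (tilt_field K))) :
    witt_map (@tilt_in R p K) (witt_map (@tilt_out R p K) w) = w.
  by apply: wittP => n /=; rewrite tilt_outK.
exists (witt_map (@tilt_in R p K) z).
  rewrite /primitive (tdigitsE (oring_perfect p_pr _)) /digit /= wred_map; split.
    by apply: etrans (anorm_tilt_out (tilt_in (wred z))) _; rewrite tilt_inK.
  exists (witt_map (@tilt_in R p K) u), (witt_map (@tilt_in R p K) v); split.
    by rewrite -witt_map_teich -rmorphB zE rmorphM rmorph_nat.
  by rewrite -rmorphM uv rmorph1.
apply/seteqP; split=> w; rewrite /tilt_ideal /= ThetaE.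
  move=> h; have /z_gen [r rE] : oTheta (witt_map (@tilt_out R p K) w) = 0 by apply: val_inj.
  by apply/ideal_gen1; exists (witt_map (@tilt_in R p K) r); rewrite -[LHS]oiK rE rmorphM.
move=> /ideal_gen1 [c ->].
have -> : witt_map (@tilt_out R p K) (c * witt_map (@tilt_in R p K) z) =
  witt_map (@tilt_out R p K) c * z by rewrite rmorphM; congr (_ * _); apply: ioK.
by rewrite rmorphM /= z_ker mulr0.
Qed.

Definition tilt_pair K : primitive_pair R p_pr :=
  @PrimitivePair R p p_pr (tilt_field K) (tilt_ideal K) (tilt_idealP K).

Lemma tilt_pair_ideal K w : pair_ideal (tilt_pair K) w <->
  oTheta (witt_map (@tilt_out R p K) w) = 0.
Proof.
rewrite /= /tilt_ideal /= ThetaE; split=> [h|->//].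
exact: val_inj.
Qed.

Lemma tilt_hom_ex K L (f : isometric_hom K L) :
  exists g : isometric_hom (tilt_field K) (tilt_field L),
    forall x, g (tilt_emb x) = tilt_emb (tilt_map f x).
Proof.
apply: (isometric_hom_ex (@tilt_emb_surj R p K) (phi := @tilt_emb R p L \o tilt_map f)).
by move=> x; rewrite /= !anorm_tilt_emb tnorm_tilt_map.
Qed.

Definition tilt_ihom K L (f : isometric_hom K L) := sval (cid (tilt_hom_ex f)).

Lemma tilt_ihom_emb K L (f : isometric_hom K L) x :
  tilt_ihom f (tilt_emb x) = tilt_emb (tilt_map f x).
Proof. exact: (svalP (cid (tilt_hom_ex f))). Qed.

Lemma tilt_out_ihom K L (f : isometric_hom K L) x :
  tilt_out (oring_map (tilt_ihom f) x) = tilt_map f (tilt_out x).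
Proof.
apply: (can_inj (@tilt_inK R p L)); rewrite tilt_outK; apply: val_inj.
by rewrite /= -{1}[x]tilt_outK -[oval (tilt_in _)]/(tilt_emb _) tilt_ihom_emb.
Qed.

Lemma tilt_ihom_ideal K L (f : isometric_hom K L) w :
  pair_ideal (tilt_pair K) w -> pair_ideal (tilt_pair L) (witt_map (oring_map (tilt_ihom f)) w).
Proof.
move=> /tilt_pair_ideal w0; apply/tilt_pair_ideal.
have -> : witt_map (@tilt_out R p L) (witt_map (oring_map (tilt_ihom f)) w) =
    witt_map (tilt_map f) (witt_map (@tilt_out R p K) w).
  by apply: wittP => n /=; rewrite tilt_out_ihom.
by rewrite oTheta_tilt_map w0 rmorph0.
Qed.

Definition tilt_hom K L (f : isometric_hom K L) : pair_hom (tilt_pair K) (tilt_pair L) :=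
  PairHom (@tilt_ihom_ideal K L f).

Definition tilt_functor : functor (perfectoid_category R p) (pair_category R p_pr).
Proof.
exists (fun K : perfectoid_category R p => tilt_pair K : pair_category R p_pr) tilt_hom.
- move=> K; apply: pair_hom_ext; apply: (isometric_hom_uniq (@tilt_emb_surj R p K)) => x.
  rewrite /= tilt_ihom_emb; congr tilt_emb; apply: tilt_eq => n /=.
  rewrite -[in RHS](to_modp_repr (tseq x n)) /modp_map; congr to_modp.
  exact: val_inj.
- move=> K L M g f; apply: pair_hom_ext.
  apply: (isometric_hom_uniq (@tilt_emb_surj R p K)) => x.
  rewrite /= !tilt_ihom_emb; congr tilt_emb; apply: tilt_eq => n /=.
  rewrite -(to_modp_repr (tseq x n)) !modp_map_to_modp; congr to_modp.
  exact: val_inj.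
Defined.

Lemma tilt_functorP : is_tilting tilt_functor.
Proof.
exists (fun K => @tilt_out R p K); split.
- by move=> K; exists (@tilt_in R p K); [exact: tilt_outK | exact: tilt_inK].
- by move=> K x; rewrite thetaE; exact: anorm_tilt_out.
- by [].
- move=> K L f x n.
  by rewrite -[tseq _ n]/(tseq (tilt_out (oring_map (tilt_ihom f) x)) n) tilt_out_ihom.
Qed.
End TiltFunctor.

(** * The untilting functor *)

Section UntiltFunctor.
Variables (R : realType) (p : nat) (p_pr : prime p).
Implicit Types P Q S : primitive_pair R p_pr.

Definition untilt_emb P (w : witt p_pr (oring P)) : untilt_field P := oval (untilt_map w).
Lemma untilt_emb_zmod P : zmod_morphism (@untilt_emb P).
Proof. by move=> x y; rewrite /untilt_emb rmorphB. Qed.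
Lemma untilt_emb_monoid P : monoid_morphism (@untilt_emb P).
Proof. by split=> [|x y]; rewrite /untilt_emb ?rmorph1 ?rmorphM. Qed.
HB.instance Definition _ P := GRing.isZmodMorphism.Build
  (witt p_pr (oring P)) (untilt_field P) (@untilt_emb P) (@untilt_emb_zmod P).
HB.instance Definition _ P := GRing.isMonoidMorphism.Build
  (witt p_pr (oring P)) (untilt_field P) (@untilt_emb P) (@untilt_emb_monoid P).

Lemma untilt_emb_surj P (x : untilt_field P) : anorm x <= 1 -> exists w, untilt_emb w = x.
Proof.
move=> x1; have [w wx] := untilt_map_surj (OInt (x1 : x \in @integer _ _)).
by exists w; rewrite /untilt_emb wx.
Qed.

(* Every class is [a] times a unit, so isometry can be checked on Teichmueller
   representatives. *)
Lemma untilt_isometry P (L : analyticFieldType R)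
    (phi : {rmorphism witt p_pr (oring P) -> oring L}) :
  (forall w, pair_ideal P w -> phi w = 0) ->
  (forall a, anorm (oval (phi (teich p_pr a))) = anorm (oval a)) ->
  forall w, anorm (oval (phi w)) = anorm (untilt_emb w).
Proof.
move=> phi0 phiT w; have [a [t [t' [tt' wat]]]] := untilt_map_teich_unit w.
have -> : phi w = phi (teich p_pr a * t).
  apply/eqP; rewrite -subr_eq0 -rmorphB; apply/eqP/phi0/untilt_map_eq0.
  by rewrite rmorphB /= wat subrr.
rewrite /untilt_emb wat !rmorphM /= !anormM phiT anorm_untilt_teich.
rewrite (@oring_unit_norm _ _ (phi t) (phi t')) -?rmorphM ?tt' ?rmorph1 //.
by rewrite (@oring_unit_norm _ _ (untilt_map t) (untilt_map t')) // -rmorphM tt' rmorph1.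
Qed.

Lemma untilt_hom_ex P Q (g : pair_hom P Q) :
  exists f : isometric_hom (untilt_field P) (untilt_field Q),
    forall w, f (untilt_emb w) = untilt_emb (witt_map (oring_map g) w).
Proof.
apply: (isometric_hom_ex (@untilt_emb_surj P)
  (phi := @untilt_emb Q \o witt_map (oring_map g))) => w.
apply: (untilt_isometry
  (phi := @untilt_map R p p_pr Q \o witt_map (oring_map g))) => [{}w wI|a] /=.
  exact/untilt_map_eq0/phom_ideal.
by rewrite witt_map_teich anorm_untilt_teich /= ihom_norm.
Qed.

Definition untilt_hom P Q (g : pair_hom P Q) := sval (cid (untilt_hom_ex g)).

Lemma untilt_hom_emb P Q (g : pair_hom P Q) w :
  untilt_hom g (untilt_emb w) = untilt_emb (witt_map (oring_map g) w).
Proof. exact: (svalP (cid (untilt_hom_ex g))). Qed.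

Definition untilt_functor : functor (pair_category R p_pr) (perfectoid_category R p).
Proof.
exists (fun P : pair_category R p_pr => untilt_field P : perfectoid_category R p) untilt_hom.
- move=> P; apply: isometric_hom_ext; apply: (isometric_hom_uniq (@untilt_emb_surj P)) => w.
  rewrite /= untilt_hom_emb; congr untilt_emb; apply: wittP => n /=.
  exact: val_inj.
- move=> P Q S g f; apply: isometric_hom_ext.
  apply: (isometric_hom_uniq (@untilt_emb_surj P)) => w.
  rewrite /= !untilt_hom_emb; congr untilt_emb; apply: wittP => n /=.
  exact: val_inj.
Defined.

(** * Identification of W(o_F)[1/p] / I W(o_F)[1/p] with the fraction field *)

Section UntiltRing.
Variable P : primitive_pair R p_pr.
Local Notation W := (witt p_pr (oring P)).
Local Notation pW := (p%:R : W).

Let p_neq0 : p%:R != 0 :> untilt_field P.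
Proof. by rewrite -anorm_eq0 anorm_p invr_eq0 pnatr_eq0 -lt0n prime_gt0. Qed.

Lemma untilt_ring_map_ex : exists k : {rmorphism untilt_ring P -> untilt_field P},
  forall w, k (untilt_class w) = untilt_emb w.
Proof.
pose ev : {rmorphism {poly W} -> untilt_field P} :=
  horner_eval (p%:R^-1 : untilt_field P) \o map_poly (@untilt_emb P).
have evC w : ev w%:P = untilt_emb w by rewrite /= map_polyC /= /horner_eval hornerC.
have [|ev1 ev1E] := @quot_factor _ _ [set pW *: 'X - 1 : {poly W}] ev.
  move=> _ ->; rewrite rmorphB rmorph1 -mul_polyC rmorphM evC rmorph_nat /=.
  by rewrite map_polyX /horner_eval hornerX mulfV // subrr.
have [|k kE] := @quot_factor _ _ [set to_away pW w | w in pair_ideal P] ev1.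
  move=> _ [w wI <-]; rewrite /to_away ev1E evC /untilt_emb.
  by rewrite (iffRL (untilt_map_eq0 w) wI).
by exists k => w; rewrite /untilt_class kE /to_away ev1E evC.
Qed.

Definition untilt_ring_map : {rmorphism untilt_ring P -> untilt_field P} :=
  sval (cid untilt_ring_map_ex).

Lemma untilt_ring_map_class w : untilt_ring_map (untilt_class w) = untilt_emb w.
Proof. exact: (svalP (cid untilt_ring_map_ex)). Qed.

Let qc1 : {rmorphism {poly W} -> away pW} := qclass [set pW *: 'X - 1 : {poly W}].
Let qc2 : {rmorphism away pW -> untilt_ring P} :=
  qclass [set to_away pW w | w in pair_ideal P].
Let X : untilt_ring P := qc2 (qc1 'X).
Let cE w : untilt_class w = qc2 (qc1 w%:P). Proof. by []. Qed.

Let pX : p%:R * X = 1.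
Proof.
have : qc1 (p%:R * 'X) = qc1 1.
  apply/qclassP; apply: sub_gen_smallest.
  by rewrite /= -mul_polyC polyC_natr.
move=> /(congr1 qc2); rewrite (rmorphM qc1) (rmorphM qc2) (rmorph_nat qc1) (rmorph_nat qc2).
by rewrite (rmorph1 qc1) (rmorph1 qc2).
Qed.

(** Induction on a polynomial representing x, in Horner form: in f X + c one more factor p absorbs
    the variable, which is the inverse of p. *)
Lemma untilt_ring_denominator (x : untilt_ring P) :
  exists n w, p%:R ^+ n * x = untilt_class w.
Proof.
have [a <-] : exists a, qc2 a = x by exists (repr x); apply: reprK.
have [f <-] : exists f, qc1 f = a by exists (repr a); apply: reprK.
elim/poly_ind: f => [|f c [n [w E]]].
  by exists 0%N, 0; rewrite cE polyC0 !rmorph0 mulr0.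
exists n.+1, (w + p%:R ^+ n.+1 * c).
rewrite cE polyCD !rmorphD !rmorphM -cE -E; set y := qc2 (qc1 f).
rewrite mulrDr; congr (_ + _).
  by rewrite exprSr -/X mulrACA pX mulr1.
by rewrite !rmorphXn !rmorph_nat.
Qed.

(** Powers of p clear denominators on both sides. In the source this reduces injectivity to the
    kernel of [untilt_emb], which is I; in the target it moves any element into the valuation ring,
    where W(o_F) is onto. *)
Lemma untilt_ring_map_bij : bijective untilt_ring_map.
Proof.
have inv n : p%:R ^+ n * X ^+ n = 1 by rewrite -exprMn pX expr1n.
have inj : injective untilt_ring_map.
  move=> x y xy; apply/eqP; rewrite -subr_eq0; apply/eqP.
  have E : untilt_ring_map (x - y) = 0 by rewrite rmorphB xy subrr.
  have [n [w wE]] := untilt_ring_denominator (x - y).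
  have w0 : untilt_class w = 0.
    have /untilt_map_eq0 wI : untilt_map w = 0.
      apply: val_inj; rewrite -[LHS]/(untilt_emb w) -untilt_ring_map_class.
      by rewrite -wE rmorphM E mulr0.
    rewrite cE -(rmorph0 qc2); apply/qclassP; rewrite subr0; apply: sub_gen_smallest.
    by exists w.
  by rewrite -[x - y]mul1r -(inv n) mulrAC wE w0 mul0r.
have surj y : exists x, untilt_ring_map x = y.
  have q1 : (p%:R^-1 : R) < 1 by rewrite invf_lt1 ?ltr1n ?ltr0n ?prime_gt1 ?prime_gt0.
  have q0 : 0 <= (p%:R^-1 : R) by rewrite invr_ge0.
  have [n nP] : exists n, p%:R^-1 ^+ n * anorm y <= 1.
    have [->|y0] := eqVneq y 0; first by exists 0%N; rewrite anorm0 mulr0.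
    have yp := anorm_gt0 y0.
    have yV : 0 < (anorm y)^-1 by rewrite invr_gt0.
    have [n nP] := expr_small q0 q1 yV.
    by exists n; rewrite -ler_pdivlMr // mul1r ltW.
  have [|w wE] := @untilt_emb_surj P (p%:R ^+ n * y).
    by rewrite anormM anormX anorm_p.
  exists (X ^+ n * untilt_class w); rewrite rmorphM untilt_ring_map_class wE.
  have := congr1 untilt_ring_map (inv n).
  rewrite rmorph1 rmorphM (rmorphXn _ n p%:R) rmorph_nat => E.
  by rewrite mulrA [_ * p%:R ^+ n]mulrC E mul1r.
have [g gK] := choice surj.
by exists g => // x; apply: inj; rewrite gK.
Qed.
End UntiltRing.

Lemma untilt_functorP : is_untilting untilt_functor.
Proof.
exists untilt_ring_map; split.
- exact: untilt_ring_map_bij.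
- by move=> P y yd; rewrite untilt_ring_map_class; exact: anorm_untilt_dominant.
- by move=> P Q g w; rewrite !untilt_ring_map_class; exact: untilt_hom_emb.
Qed.
End UntiltFunctor.

(** * The natural isomorphisms *)

Section UntiltTilt.
Variables (R : realType) (p : nat) (p_pr : prime p).
Implicit Types K L : perfectoidFieldType R p.
Local Notation TP := (tilt_pair p_pr).

Definition Theta_emb K (w : witt p_pr (oring (TP K))) : K :=
  oval (oTheta (witt_map (@tilt_out R p K) w)).
Lemma Theta_emb_zmod K : zmod_morphism (@Theta_emb K).
Proof. by move=> x y; rewrite /Theta_emb !rmorphB. Qed.
Lemma Theta_emb_monoid K : monoid_morphism (@Theta_emb K).
Proof. by split=> [|x y]; rewrite /Theta_emb ?rmorph1 ?rmorphM. Qed.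
HB.instance Definition _ K := GRing.isZmodMorphism.Build
  (witt p_pr (oring (TP K))) K (@Theta_emb K) (@Theta_emb_zmod K).
HB.instance Definition _ K := GRing.isMonoidMorphism.Build
  (witt p_pr (oring (TP K))) K (@Theta_emb K) (@Theta_emb_monoid K).

Lemma Theta_emb_surj K (x : K) : anorm x <= 1 -> exists w, Theta_emb w = x.
Proof.
move=> x1; have [w wx] := oTheta_surj p_pr (OInt (x1 : x \in @integer _ _)).
exists (witt_map (@tilt_in R p K) w).
have -> : Theta_emb (witt_map (@tilt_in R p K) w) = oval (oTheta w).
  by congr (oval (oTheta _)); apply: wittP => n /=; apply: tilt_inK.
by rewrite wx.
Qed.

Lemma Theta_emb_isometry K w : anorm (Theta_emb w) = anorm (@untilt_emb R p p_pr (TP K) w).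
Proof.
apply: (untilt_isometry (P := TP K) (phi := @oTheta R p p_pr K \o witt_map (@tilt_out R p K))).
  by move=> v /tilt_pair_ideal.
by move=> a; rewrite /= witt_map_teich oTheta_teich; apply/esym/anorm_tilt_out.
Qed.

(** [untilt_emb] and [Theta_emb] map the same ring W(o_K') onto the two valuation rings with equal
    norms. Their compatibility with morphisms therefore gives naturality. *)
Lemma untilt_tilt : naturally_isomorphic
  (functor_comp (untilt_functor R p_pr) (tilt_functor R p_pr))
  (functor_id (perfectoid_category R p)).
Proof.
have h K := isometric_iso (@untilt_emb_surj R p p_pr (TP K)) (@Theta_emb_surj K)
  (@Theta_emb_isometry K).
exists (fun K => (sval (cid (h K))).1), (fun K => (sval (cid (h K))).2); split.
- by move=> K; case: (svalP (cid (h K))).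
- by move=> K; case: (svalP (cid (h K))).
move=> K L f; have [aK _ _ _] := svalP (cid (h K)); have [aL _ _ _] := svalP (cid (h L)).
apply: isometric_hom_ext; apply: (isometric_hom_uniq (@untilt_emb_surj R p p_pr (TP K))) => w.
rewrite /= aK untilt_hom_emb aL.
have E : witt_map (@tilt_out R p L) (witt_map (oring_map (tilt_hom p_pr f)) w) =
    witt_map (tilt_map f) (witt_map (@tilt_out R p K) w).
  by apply: wittP => n /=; apply: tilt_out_ihom.
apply: etrans (congr1 (fun v => oval (oTheta v)) E) _.
by rewrite oTheta_tilt_map.
Qed.
End UntiltTilt.

(** * Recovering a pair from the tilt of its untilt *)

Section TiltUntilt.
Variables (R : realType) (p : nat) (p_pr : prime p).
Implicit Types P Q : primitive_pair R p_pr.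

Section OnePair.
Variable P : primitive_pair R p_pr.
Local Notation K := (untilt_field P).
Let q : R := p%:R^-1.
Let q0 : 0 < q. Proof. by rewrite invr_gt0 ltr0n prime_gt0. Qed.
Let q1 : q < 1. Proof. by rewrite invf_lt1 ?ltr1n ?ltr0n ?prime_gt1 ?prime_gt0. Qed.
Let perf := oring_perfect p_pr P.
Let Ap : p \in [pchar oring P]. Proof. by case: perf. Qed.
Let frob_inj : injective (fun x : oring P => x ^+ p). Proof. by case: perf. Qed.
Let frob_surj (x : oring P) : exists y, y ^+ p = x. Proof. by case: perf. Qed.

Definition oroot (x : oring P) : oring P := sval (cid (frob_surj x)).
Lemma orootK x : oroot x ^+ p = x. Proof. exact: (svalP (cid (frob_surj x))). Qed.

Lemma iter_orootK x n : iter n oroot x ^+ (p ^ n) = x.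
Proof.
elim: n => [|n IH]; first by rewrite expr1.
by rewrite expnS exprM /= orootK.
Qed.

Lemma orootB x y : oroot (x - y) = oroot x - oroot y.
Proof.
apply: frob_inj; rewrite /= orootK -(pFrobenius_autE Ap) rmorphB /= !pFrobenius_autE.
by rewrite !orootK.
Qed.

Lemma orootM x y : oroot (x * y) = oroot x * oroot y.
Proof. by apply: frob_inj; rewrite /= exprMn !orootK. Qed.

Lemma oroot1 : oroot 1 = 1.
Proof. by apply: frob_inj; rewrite /= orootK expr1n. Qed.

Definition untilt_modp (x : oring P) : modp K := to_modp (untilt_map (teich p_pr x)).

Lemma untilt_modp_head w : untilt_modp (wred w) = to_modp (untilt_map w).
Proof.
apply/esym/to_modpP; rewrite {1}(witt_head_tail perf w) rmorphD rmorphM rmorph_nat.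
by exists (untilt_map (wtail perf w)); rewrite expr1.
Qed.

(** The Teichmueller map is not additive, but modulo p any Witt vector with head x - y may replace
    [x - y], in particular [x] - [y]. *)
Lemma untilt_modpB x y : untilt_modp (x - y) = untilt_modp x - untilt_modp y.
Proof.
rewrite -[x in LHS](wred_teich p_pr) -[y in LHS](wred_teich p_pr) -rmorphB.
by rewrite untilt_modp_head !rmorphB.
Qed.

Lemma untilt_modpM x y : untilt_modp (x * y) = untilt_modp x * untilt_modp y.
Proof. by rewrite /untilt_modp teichM !rmorphM. Qed.

Lemma pair_tilt_subproof x : (fun n => untilt_modp (iter n oroot x)) \in @frob_compatible R p K.
Proof.
rewrite unfold_in; apply/asboolP => n.
by rewrite /untilt_modp -rmorphXn -rmorphXn -teichX /= orootK.
Qed.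
Definition pair_tilt x : tilt_ring K := Tilt (pair_tilt_subproof x).

Lemma tseq_pair_tilt x n : tseq (pair_tilt x) n = untilt_modp (iter n oroot x).
Proof. by []. Qed.

Lemma pair_tilt_zmod : zmod_morphism pair_tilt.
Proof.
move=> x y; apply: tilt_eq => n; rewrite tseqB !tseq_pair_tilt -untilt_modpB.
by congr untilt_modp; elim: n => [//|n IH]; rewrite !iterS IH orootB.
Qed.
Lemma pair_tilt_monoid : monoid_morphism pair_tilt.
Proof.
split=> [|x y]; apply: tilt_eq => n.
  rewrite tseq1 tseq_pair_tilt; have -> : iter n oroot 1 = 1.
    by elim: n => [//|n IH]; rewrite iterS IH oroot1.
  by rewrite /untilt_modp -[teich _ 1]/(1 : witt p_pr _) !rmorph1.
rewrite tseqM !tseq_pair_tilt -untilt_modpM.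
by congr untilt_modp; elim: n => [//|n IH]; rewrite !iterS IH orootM.
Qed.
HB.instance Definition _ :=
  GRing.isZmodMorphism.Build (oring P) (tilt_ring K) pair_tilt pair_tilt_zmod.
HB.instance Definition _ :=
  GRing.isMonoidMorphism.Build (oring P) (tilt_ring K) pair_tilt pair_tilt_monoid.

(** The n-th term has the lift [x^(1/p^n)], whose p^n-th power is exactly [x], so the limit defining
    theta is constant. Hence Theta composed with W([pair_tilt]) is [untilt_map], which is what
    matches the ideals. *)
Lemma otheta_pair_tilt x : otheta (pair_tilt x) = untilt_map (teich p_pr x).
Proof.
apply: otheta_uniq => n; exists (untilt_map (teich p_pr (iter n oroot x))) => //.
rewrite -rmorphXn -teichX iter_orootK; exact: WittPolynomials.cong_refl.
Qed.

Lemma tnorm_pair_tilt x : tnorm (pair_tilt x) = anorm (oval x).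
Proof. by rewrite /tnorm otheta_pair_tilt anorm_untilt_teich. Qed.

Lemma oTheta_pair_tilt w : oTheta (witt_map pair_tilt w) = untilt_map w.
Proof.
apply: (witt_hom_ext perf (f := @oTheta R p p_pr K \o witt_map pair_tilt)
  (g := @untilt_map R p p_pr P)).
  exact: oring_separated.
by move=> x; rewrite /= witt_map_teich oTheta_teich otheta_pair_tilt.
Qed.

(** Approximation in powers of z_0: any t agrees with some image of o_F in its term of index 0, so
    the difference has norm at most q = |z_0| and is divisible by [pair_tilt z0]. The resulting
    series in z_0 converges in o_F. *)
Lemma pair_tilt_surj y : exists x, pair_tilt x = y.
Proof.
have [[[z u] v] [/= z_norm _ _ _]] := pair_generator P; set z0 := wred z in z_norm.
have step (t : tilt_ring K) : exists xt : oring P * tilt_ring K,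
    t = pair_tilt xt.1 + pair_tilt z0 * xt.2.
  have [w wE] := untilt_map_surj (repr (tseq t 0)).
  have t0 : tseq (t - pair_tilt (wred w)) 0 = 0.
    by rewrite tseqB tseq_pair_tilt untilt_modp_head wE to_modp_repr subrr.
  have [|s sE] := @tnorm_dvd R p K (t - pair_tilt (wred w)) (pair_tilt z0).
    by rewrite tnorm_pair_tilt z_norm; have /tseq_eq0 := t0; rewrite expn0 expr1.
  by exists (wred w, s); rewrite /= mulrC -sE addrC subrK.
have [f fP] := choice step; pose r n := iter n (fun t => (f t).2) y.
pose S n := \sum_(i < n) z0 ^+ i * (f (r i)).1.
have yE n : y = pair_tilt (S n) + pair_tilt z0 ^+ n * r n.
  elim: n => [|n IH]; first by rewrite /S big_ord0 rmorph0 add0r mul1r.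
  rewrite {1}IH /S big_ord_recr /= rmorphD rmorphM rmorphXn /= {1}[r n]fP.
  by rewrite mulrDr addrA mulrA -exprSr.
have [|s sP] := @oring_complete R P q S q0 q1.
  move=> n; rewrite /S big_ord_recr /= addrAC subrr add0r anormM.
  rewrite -[oval (z0 ^+ n)]/((\val : oring P -> P) _) rmorphXn anormX z_norm.
  by rewrite ler_piMr ?exprn_ge0 ?oring_le1 ?ltW.
exists s; apply/eqP; rewrite -subr_eq0; apply/eqP/tnorm_0/eqP.
rewrite eq_le tnorm_ge0 andbT; apply: (le_eps_pow (ltW q0) q1) => // n.
rewrite le_max; apply/orP; right.
rewrite {1}(yE n) opprD addrA -rmorphB.
have := tnormD_le (pair_tilt (s - S n)) (- (pair_tilt z0 ^+ n * r n)).
move/le_trans; apply; rewrite ge_max tnorm_pair_tilt sP /=.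
rewrite -mulN1r tnormM tnormM -rmorphXn tnorm_pair_tilt.
rewrite -[oval (z0 ^+ n)]/((\val : oring P -> P) _) rmorphXn anormX z_norm.
have qn : 0 <= q ^+ n by rewrite exprn_ge0 ?ltW.
have qr : q ^+ n * tnorm (r n) <= q ^+ n by rewrite ler_piMr ?tnorm_le1.
by apply: le_trans qr; rewrite ler_piMl ?tnorm_le1 // mulr_ge0 ?tnorm_ge0.
Qed.

Definition pair_tilt_emb (x : oring P) : tilt_field K := tilt_emb (pair_tilt x).
Lemma pair_tilt_emb_zmod : zmod_morphism pair_tilt_emb.
Proof. by move=> x y; rewrite /pair_tilt_emb !rmorphB. Qed.
Lemma pair_tilt_emb_monoid : monoid_morphism pair_tilt_emb.
Proof. by split=> [|x y]; rewrite /pair_tilt_emb ?rmorph1 ?rmorphM. Qed.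
HB.instance Definition _ := GRing.isZmodMorphism.Build
  (oring P) (tilt_field K) pair_tilt_emb pair_tilt_emb_zmod.
HB.instance Definition _ := GRing.isMonoidMorphism.Build
  (oring P) (tilt_field K) pair_tilt_emb pair_tilt_emb_monoid.

Lemma pair_tilt_emb_surj (x : tilt_field K) : anorm x <= 1 -> exists a, pair_tilt_emb a = x.
Proof.
move=> /tilt_emb_surj [y <-]; have [a <-] := pair_tilt_surj y.
by exists a.
Qed.

Lemma oval_surj (x : P) : anorm x <= 1 -> exists a : oring P, oval a = x.
Proof. by move=> x1; exists (OInt (x1 : x \in @integer _ _)). Qed.

Lemma tilt_untilt_pair : exists fg :
    pair_hom (tilt_pair p_pr K) P * pair_hom P (tilt_pair p_pr K),
  [/\ forall a, fg.1 (pair_tilt_emb a) = oval a,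
      pair_comp fg.2 fg.1 = pair_id (tilt_pair p_pr K) &
      pair_comp fg.1 fg.2 = pair_id P].
Proof.
have isom a : anorm (pair_tilt_emb a) = anorm (oval a).
  by rewrite anorm_tilt_emb tnorm_pair_tilt.
have [[f g] /= [fE gE fg gf]] := isometric_iso (e := (\val : {rmorphism oring P -> P}))
  oval_surj pair_tilt_emb_surj isom.
(* Both f and its inverse must respect the ideals. In each direction f is recognised as [pair_tilt]
   on integers, and [oTheta_pair_tilt] turns the kernel of Theta into that of [untilt_map], which is
   I. *)
have fI w : pair_ideal P w -> pair_ideal (tilt_pair p_pr K) (witt_map (oring_map f) w).
  move=> wI; apply/tilt_pair_ideal.
  have -> : witt_map (@tilt_out R p K) (witt_map (oring_map f) w) = witt_map pair_tilt w.
    apply: wittP => n /=; apply: (can_inj (@tilt_inK R p K)); rewrite tilt_outK.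
    by apply: val_inj; apply: fE.
  by rewrite oTheta_pair_tilt; apply/untilt_map_eq0.
have gI w : pair_ideal (tilt_pair p_pr K) w -> pair_ideal P (witt_map (oring_map g) w).
  move=> /tilt_pair_ideal w0; apply/untilt_map_eq0; rewrite -oTheta_pair_tilt -w0; congr oTheta.
  apply: wittP => n /=; apply: (can_inj (@tilt_inK R p K)); rewrite tilt_outK.
  apply: val_inj; rewrite -[LHS]/(pair_tilt_emb _) -fE.
  exact: (congr1 (fun h => (h : isometric_hom _ _) _) gf).
exists (PairHom gI, PairHom fI); split=> //.
- by apply: pair_hom_ext => x; apply: (congr1 (fun h => (h : isometric_hom _ _) x) gf).
- by apply: pair_hom_ext => x; apply: (congr1 (fun h => (h : isometric_hom _ _) x) fg).
Qed.
End OnePair.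

Lemma oroot_hom P Q (h : pair_hom P Q) x : oring_map h (oroot x) = oroot (oring_map h x).
Proof.
have [_ inj _] := oring_perfect p_pr Q.
by apply: inj; rewrite /= orootK -rmorphXn orootK.
Qed.

Lemma pair_tilt_hom P Q (h : pair_hom P Q) x :
  tilt_map (untilt_hom h) (pair_tilt x) = pair_tilt (oring_map h x).
Proof.
apply: tilt_eq => n; rewrite tseq_tilt_map !tseq_pair_tilt /untilt_modp modp_map_to_modp.
have -> : iter n (@oroot Q) (oring_map h x) = oring_map h (iter n (@oroot P) x).
  by elim: n => [//|n IH]; rewrite !iterS IH oroot_hom.
congr to_modp; apply: val_inj; rewrite -witt_map_teich.
exact: untilt_hom_emb.
Qed.

Lemma tilt_untilt : naturally_isomorphic
  (functor_comp (tilt_functor R p_pr) (untilt_functor R p_pr))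
  (functor_id (pair_category R p_pr)).
Proof.
exists (fun P => (sval (cid (tilt_untilt_pair P))).1),
  (fun P => (sval (cid (tilt_untilt_pair P))).2); split.
- by move=> P; case: (svalP (cid (tilt_untilt_pair P))).
- by move=> P; case: (svalP (cid (tilt_untilt_pair P))).
move=> P Q h; have [aP _ _] := svalP (cid (tilt_untilt_pair P)).
have [aQ _ _] := svalP (cid (tilt_untilt_pair Q)).
apply: pair_hom_ext; apply: (isometric_hom_uniq (@pair_tilt_emb_surj P)) => x.
rewrite /= aP [tilt_ihom _ _]tilt_ihom_emb pair_tilt_hom -[tilt_emb _]/(pair_tilt_emb _).
exact: aQ.
Qed.
End TiltUntilt.

Theorem theorem1p5p1 (R : realType) (p : nat) (p_pr : prime p) :
  exists (T : functor (perfectoid_category R p) (pair_category R p_pr))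
         (U : functor (pair_category R p_pr) (perfectoid_category R p)),
    [/\ is_tilting T, is_untilting U & quasi_inverse T U].
Proof.
exists (tilt_functor R p_pr), (untilt_functor R p_pr); split.
- exact: tilt_functorP.
- exact: untilt_functorP.
- by split; [exact: untilt_tilt | exact: tilt_untilt].
Qed.
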